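(* Let $X$ be a real-valued continuous random variable with density $f$. (i) $\sigma[X]\geq\sqrt2$, with equality if and only if $X$ is Gaussian. (ii) If $\sigma[X]\leq C$ and $X$ has finite variance $\sigma^2$ and finite Poincaré constant $R=R(X)$, then $$\tfrac12\|f-\phi\|_1^2\leq D(f\|\phi)\leq\Big(\frac{2R}{\sigma^2}+1\Big)\log\Big(\frac{C}{\sqrt2}\Big),$$ where $\phi$ is the Gaussian density with the same mean and variance as $X$.
   Context: Differential entropy $h$ is assumed to exist and be finite for all random variables considered. Doubling constant: $\sigma[X]=\exp\{h(X+X')-h(X)\}$ where $X'$ is an independent copy of $X$. Poincaré constant: $R(X)=\sup_{g}\frac{E[g(X)^2]}{E[g'(X)^2]}$, the supremum over all absolutely continuous $g$ with $E[g(X)]=0$ and $0<\mathrm{Var}(g(X))<\infty$. $D(f\|g)=\int f\log(f/g)$ is relative entropy; $\|\cdot\|_1$ is the $L^1$ norm; $\log$ is natural. *)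

(* Defs.v *)
From HB Require Import structures.
From mathcomp Require Import all_boot all_order all_algebra.
From mathcomp Require Import all_classical all_reals all_analysis.
From mathcomp Require Import normal_distribution.
Set Implicit Arguments. Unset Strict Implicit. Unset Printing Implicit Defensive.
Import Order.TTheory GRing.Theory Num.Theory.
Import numFieldNormedType.Exports.
Local Open Scope classical_set_scope.
Local Open Scope ring_scope.

Section Defs.
Variable R : realType.
Local Notation mu := (@lebesgue_measure R).

Definition is_density (f : R -> R) : Prop :=
  measurable_fun setT f /\ (forall x, 0 <= f x) /\
  (\int[mu]_x (f x)%:E = 1)%E.

(** Density of X + X' (X' independent copy): the convolution f * f. *)
Definition convol (f g : R -> R) : R -> R :=
  fun x => \int[mu]_y (f y * g (x - y)).

Definition entropy_finite (f : R -> R) : Prop :=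
  mu.-integrable setT (fun x => (f x * ln (f x))%:E).

(** Differential entropy h = - \int f log f (natural log; 0 log 0 = 0). *)
Definition entropy (f : R -> R) : R := - \int[mu]_x (f x * ln (f x)).

Definition doubling (f : R -> R) : R := expR (entropy (convol f f) - entropy f).

Definition is_gaussian (f : R -> R) : Prop :=
  exists m s : R, 0 < s /\ {ae mu, forall x, f x = normal_pdf m s x}.

Definition finite_variance (f : R -> R) : Prop :=
  mu.-integrable setT (fun x => (x ^+ 2 * f x)%:E).

Definition dmean (f : R -> R) : R := \int[mu]_x (x * f x).
Definition dvariance (f : R -> R) : R := \int[mu]_x ((x - dmean f) ^+ 2 * f x).

Definition gauss_match (f : R -> R) : R -> R :=
  normal_pdf (dmean f) (Num.sqrt (dvariance f)).

Definition abs_cont_with_deriv (g dg : R -> R) : Prop :=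
  forall a b : R, a <= b ->
    mu.-integrable `[a, b] (fun x => (dg x)%:E) /\
    g b - g a = \int[mu]_(x in `[a, b]) dg x.

Definition poincare_admissible (f g dg : R -> R) : Prop :=
  abs_cont_with_deriv g dg /\
  mu.-integrable setT (fun x => (g x * f x)%:E) /\
  \int[mu]_x (g x * f x) = 0 /\
  mu.-integrable setT (fun x => (g x ^+ 2 * f x)%:E) /\
  0 < \int[mu]_x (g x ^+ 2 * f x).

(** Poincaré constant R(X) = sup E[g(X)^2] / E[g'(X)^2], in \bar R
    (x / 0 = +oo, x / +oo = 0). *)
Definition poincare (f : R -> R) : \bar R :=
  ereal_sup [set r | exists g dg, poincare_admissible f g dg /\
     r = ((\int[mu]_x (g x ^+ 2 * f x))%:E *
          (\int[mu]_x ((dg x) ^+ 2 * f x)%:E)^-1)%E].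

Definition rel_entropy (f g : R -> R) : \bar R :=
  (\int[mu]_x (f x * ln (f x / g x))%:E)%E.

Definition L1dist (f g : R -> R) : \bar R :=
  (\int[mu]_x (`|f x - g x|)%:E)%E.

End Defs.

(* Main.v *)
(** Part (i).  Let [T] be the monotone map carrying the standard normal law to [f]
    and [t x = phi x / f (T x)] its formal derivative.  For fixed [w], the map
    [S y = T (y + w) + T y] is monotone, and bounding [t] by oscillations of [T] gives
    [\int h (S y) (t (y + w) + t y) dy <= \int h] for [h >= 0] without differentiating
    [T].  With [ln z <= z - 1] and the arithmetic-geometric mean inequality this
    yields [h(f * f) >= h(f) + ln 2 / 2].  In the equality case
    [T x + T y] is a strictly increasing function of [x + y], hence [T] is affine.

    Part (ii).  Along the heat flow [p = f * heat t], let [K] be the Stein kernel of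
    [p], [n = K / v - 1], [rho] the score, and [psi = rho + (x - m) / v].  On each fibre
    [x + y = s] the function [psi(x) + n(x) rho(y)] has mean zero, so the score of the
    sum is a projection of [rho - th psi] symmetrised plus a product term; the Poincaré
    inequality for [p] controls the variance of [K].  This gives
    [2 J(p * p) <= (1 - th) J(p) + th / v] with [th = (2 R / sigma^2 + 1)^-1].  By
    de Bruijn's identity [h((f * f)_2t) - (1 - th) h(f_t) - (th / 2) ln (v + t)] is then
    nonincreasing in [t]; part (i) bounds it below as [t -> +oo], and lower
    semicontinuity of the relative entropy lets [t -> 0]. *)
Require Import Defs.
From HB Require Import structures.
From mathcomp Require Import all_boot all_order all_algebra.
From mathcomp Require Import ring lra.
From mathcomp Require Import all_classical all_reals all_analysis.
From mathcomp Require Import measurable_realfun normal_distribution.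
Set Implicit Arguments.
Unset Strict Implicit.
Unset Printing Implicit Defensive.
Import Order.TTheory GRing.Theory Num.Theory.
Import numFieldNormedType.Exports.
Local Open Scope classical_set_scope.
Local Open Scope ring_scope.

(** * Integrable functions *)

(** The obstacle in part (i) is that [f] is merely measurable, so no change of variables by
    differentiating [T] is available. For smooth [T] the map [(x, y) |-> (T x + T y, y - x)] has
    Jacobian [T' x + T' y], and pulling back the product of [convol f f] with a centred normal
    density of variance 2 gives a probability density. The proof works with the same expression, [t]
    replacing [T'], and with the weaker fact that its integral is at most 1. The variance 2 comes
    from rotating two standard normals into their sum and difference, and it is the source of
    [ln 2 / 2].

    In part (ii) the Fisher information inequality asks for [th * (1 + 2 * R' / v') <= 1], with [R']
    and [v'] the Poincaré constant and the variance at the current time. Time [t] adds [t] to the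
    variance and at most [t] to the Poincaré constant; since [R >= v], the ratio [(R + t) / (v + t)]
    never exceeds [R / v], so one [th] serves the whole flow. The return to time 0 rests on two
    one-sided facts: smoothing does not decrease the entropy of [f], and it does not lift that of
    [convol f f] by more than any given amount at some short time. *)

Lemma measurable_addrl (R : realType) (x : R) : measurable_fun setT (GRing.add x).
Proof. by apply: measurable_funD; [exact: measurable_cst|exact: measurable_id]. Qed.

Ltac mfun := repeat first
  [ assumption
  | exact: measurable_cst | exact: measurable_id
  | exact: measurable_fst | exact: measurable_snd
  | exact: measurable_normal_pdf | exact: mulrl_measurable
  | exact: measurable_addrl
  | match goal with
    | |- measurable_fun _ (fun x => _ + _) => apply: measurable_funD
    | |- measurable_fun _ (fun x => _ * _) => apply: measurable_funM
    | |- measurable_fun _ (fun x => - _) => apply: measurable_funN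
    | |- measurable_fun _ (fun x => _ ^+ _) => apply: measurable_funX
    | |- measurable_fun _ (fun x => expR _) => apply: (measurableT_comp (@measurable_expR _))
    end ].

Section integrable_functions.
Context d (T : measurableType d) (R : realType) (mu : {measure set T -> \bar R}).
Implicit Types f g h a b : T -> R.

Definition L1 h := mu.-integrable setT (EFin \o h).

Lemma L1_measurable h : L1 h -> measurable_fun setT h.
Proof. by move=> /measurable_int/measurable_EFinP. Qed.

Lemma eq_L1 f g : f =1 g -> L1 f -> L1 g.
Proof. by move=> /funext ->. Qed.

Lemma L1D f g : L1 f -> L1 g -> L1 (fun x => f x + g x).
Proof. by move=> f1 g1; apply: (integrableD _ f1 g1). Qed.

Lemma L1N f : L1 f -> L1 (fun x => - f x).
Proof. by rewrite /L1 => /integrableN; exact. Qed.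

Lemma L1B f g : L1 f -> L1 g -> L1 (fun x => f x - g x).
Proof. by move=> f1 g1; apply: L1D => //; exact: L1N. Qed.

Lemma L1Z (k : R) f : L1 f -> L1 (fun x => k * f x).
Proof. by move=> f1; apply: (integrableZl _ k f1). Qed.

Lemma L1Zr (k : R) f : L1 f -> L1 (fun x => f x * k).
Proof. by move=> f1; apply: eq_L1 (L1Z k f1) => x; rewrite mulrC. Qed.

Lemma L1_0 : L1 (fun=> 0).
Proof. exact: integrable0. Qed.

Lemma L1_norm f : L1 f -> L1 (fun x => `|f x|).
Proof. by move=> f1; apply: (integrable_norm f1). Qed.

Lemma L1_le f g : measurable_fun setT f -> (forall x, `|f x| <= g x) ->
  L1 g -> L1 f.
Proof.
move=> mf fg g1; apply: (le_integrable _ _ _ g1) => //; first exact/measurable_EFinP.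
by move=> x _ /=; rewrite lee_fin (le_trans (fg x))// ler_norm.
Qed.

Lemma L1_ae_le f g : measurable_fun setT f -> {ae mu, forall x, `|f x| <= g x} ->
  L1 g -> L1 f.
Proof.
move=> mf fg g1; apply/integrableP; split; first exact/measurable_EFinP.
have /integrableP[mg] := g1; apply: le_lt_trans.
apply: ae_ge0_le_integral => //.
- by apply: measurableT_comp => //; exact/measurable_EFinP.
- by apply: measurableT_comp.
- by apply: filterS fg => x fgx _; rewrite lee_fin (le_trans fgx)// ler_norm.
Qed.

Lemma L1_ge0 h : measurable_fun setT h -> (forall x, 0 <= h x) ->
  (\int[mu]_x (h x)%:E < +oo)%E -> L1 h.
Proof.
move=> mh h0 hoo; apply/integrableP; split; first exact/measurable_EFinP.
by under eq_integral do rewrite /= ger0_norm//.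
Qed.

Lemma L1_lty h : L1 h -> (\int[mu]_x `|h x|%:E < +oo)%E.
Proof. by move=> /integrableP[]. Qed.

Lemma EFin_Rint h : L1 h -> (\int[mu]_x h x)%:E = (\int[mu]_x (h x)%:E)%E.
Proof. by move=> h1; rewrite fineK//; exact: integrable_fin_num. Qed.

Lemma RintD f g : L1 f -> L1 g ->
  \int[mu]_x (f x + g x) = \int[mu]_x f x + \int[mu]_x g x.
Proof. by move=> f1 g1; rewrite RintegralD. Qed.

Lemma RintB f g : L1 f -> L1 g ->
  \int[mu]_x (f x - g x) = \int[mu]_x f x - \int[mu]_x g x.
Proof. by move=> f1 g1; rewrite RintegralB. Qed.

Lemma RintZ (k : R) f : L1 f -> \int[mu]_x (k * f x) = k * \int[mu]_x f x.
Proof. by move=> f1; rewrite RintegralZl. Qed.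

Lemma RintZr (k : R) f : L1 f -> \int[mu]_x (f x * k) = (\int[mu]_x f x) * k.
Proof. by move=> f1; rewrite RintegralZr. Qed.

Lemma RintN f : L1 f -> \int[mu]_x (- f x) = - \int[mu]_x f x.
Proof.
by move=> f1; under eq_Rintegral do rewrite -mulN1r; rewrite RintZ// mulN1r.
Qed.

Lemma eq_Rint f g : f =1 g -> \int[mu]_x f x = \int[mu]_x g x.
Proof. by move=> fg; apply: eq_Rintegral. Qed.

Lemma ae_eq_L1 f g : measurable_fun setT g -> {ae mu, forall x, f x = g x} ->
  L1 f -> L1 g.
Proof.
move=> mg fg f1; apply: L1_ae_le (L1_norm f1) => //.
by apply: filterS fg => x ->.
Qed.

Lemma ae_eq_Rint f g : measurable_fun setT f -> measurable_fun setT g ->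
  {ae mu, forall x, f x = g x} -> \int[mu]_x f x = \int[mu]_x g x.
Proof.
move=> mf mg fg; congr fine; apply: ae_eq_integral => //.
- exact/measurable_EFinP.
- exact/measurable_EFinP.
- by apply: filterS fg => x /= -> _.
Qed.

Lemma Rint_ge0 f : (forall x, 0 <= f x) -> 0 <= \int[mu]_x f x.
Proof. by move=> f0; apply: Rintegral_ge0. Qed.

Lemma Rint_ae_ge0 f : L1 f -> {ae mu, forall x, 0 <= f x} -> 0 <= \int[mu]_x f x.
Proof.
move=> f1 f0; rewrite (@ae_eq_Rint f (fun x => `|f x|)) ?Rint_ge0//.
- exact: L1_measurable.
- exact/L1_measurable/L1_norm.
- by apply: filterS f0 => x /ger0_norm.
Qed.

Lemma Rint_le f g : L1 f -> L1 g -> (forall x, f x <= g x) ->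
  \int[mu]_x f x <= \int[mu]_x g x.
Proof. by move=> f1 g1 fg; apply: le_Rintegral. Qed.

Lemma Rint_ae_le f g : L1 f -> L1 g -> {ae mu, forall x, f x <= g x} ->
  \int[mu]_x f x <= \int[mu]_x g x.
Proof.
move=> f1 g1 fg; rewrite -subr_ge0 -RintB// Rint_ae_ge0//; first exact: L1B.
by apply: filterS fg => x; rewrite subr_ge0.
Qed.

Lemma Rint_eq0 f : L1 f -> {ae mu, forall x, 0 <= f x} -> \int[mu]_x f x <= 0 ->
  {ae mu, forall x, f x = 0}.
Proof.
move=> f1 f0 i0.
have mf := L1_measurable f1.
have /ae_eq_integral_abs H : measurable_fun setT (EFin \o f) by exact/measurable_EFinP.
have : (\int[mu]_x `|(EFin \o f) x| = 0)%E.
  have -> : (\int[mu]_x `|(EFin \o f) x| = (\int[mu]_x `|f x|)%:E)%E.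
    by rewrite EFin_Rint//; exact: L1_norm.
  congr EFin; apply/eqP; rewrite eq_le Rint_ge0// andbT.
  rewrite (@ae_eq_Rint _ f)//; first exact/L1_measurable/L1_norm.
  by apply: filterS f0 => x /ger0_norm.
move=> /(H mu measurableT); apply: filterS => x /= /(_ I) [].

done.
Qed.

Lemma L1M2 a b : measurable_fun setT a -> measurable_fun setT b ->
  L1 (fun x => a x ^+ 2) -> L1 (fun x => b x ^+ 2) -> L1 (fun x => a x * b x).
Proof.
move=> ma mb a2 b2; apply: L1_le (L1D a2 b2); first exact: measurable_funM.
move=> x; rewrite normrM.
have := sqr_ge0 (`|a x| - `|b x|); rewrite -(real_normK (num_real (a x))) -(real_normK (num_real (b x))).
have := normr_ge0 (a x); have := normr_ge0 (b x).
by move: (`|a x|) (`|b x|) => s t *; nra.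
Qed.

Lemma CauchySchwarz a b : measurable_fun setT a -> measurable_fun setT b ->
  L1 (fun x => a x ^+ 2) -> L1 (fun x => b x ^+ 2) ->
  (\int[mu]_x (a x * b x)) ^+ 2 <=
    (\int[mu]_x (a x ^+ 2)) * (\int[mu]_x (b x ^+ 2)).
Proof.
move=> ma mb a2 b2; have ab := L1M2 ma mb a2 b2.
set A := \int[mu]_x (a x ^+ 2); set B := \int[mu]_x (b x ^+ 2).
set P := \int[mu]_x (a x * b x).
have B0 : 0 <= B by apply: Rint_ge0 => x; rewrite sqr_ge0.
have A0 : 0 <= A by apply: Rint_ge0 => x; rewrite sqr_ge0.
have H t : 0 <= A + 2 * t * P + t ^+ 2 * B.
  rewrite -RintZ// -RintZ// -RintD//; last exact: L1Z.
  rewrite -RintD//; [|by apply: L1D => //; exact: L1Z|exact: L1Z].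
  apply: Rint_ge0 => x; rewrite (_ : _ + _ = (a x + t * b x) ^+ 2) ?sqr_ge0//; ring.
have [B00|Bn0] := eqVneq B 0.
  rewrite B00 mulr0; have [->|P0] := eqVneq P 0; first by rewrite expr0n.
  (* For [B = 0] the nonnegative quadratic is affine in [t], and this [t] would give it the value
     -1. *)
  have := H (- (A + 1) / (2 * P)); rewrite B00 mulr0 addr0.
  by rewrite (_ : A + _ = -1) ?oppr_ge0 ?ler10//; field.
have := H (- P / B); have {}B0 : 0 < B by rewrite lt_def Bn0.
rewrite (_ : A + _ + _ = (A * B - P ^+ 2) / B); last by field.
by rewrite pmulr_lge0 ?invr_gt0// subr_ge0.
Qed.

End integrable_functions.
(** The inverse is written as [x * expR (- ln (x ^+ 2))], built from measurable functions; the
    factor [x] makes both sides vanish at 0. *)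
Lemma measurable_invr (R : realType) : measurable_fun [set: R] (@GRing.inv R).
Proof.
rewrite (_ : @GRing.inv R = fun x => x * expR (- ln (x ^+ 2))).
  apply: measurable_funM; first exact: measurable_id.
  apply: (measurableT_comp (@measurable_expR _)); apply: measurable_funN.
  by apply: (measurableT_comp (@measurable_ln _)); exact: measurable_funX.
apply/funext => x; have [->|x0] := eqVneq x 0; first by rewrite invr0 mul0r.
rewrite expRN lnK ?posrE ?exprn_even_gt0//.
by rewrite expr2 invfM mulrA divff// mul1r.
Qed.

Ltac mfun2 := repeat first [ progress mfun
  | match goal with
    | |- measurable_fun _ (fun x => ln _) => apply: (measurableT_comp (@measurable_ln _))
    | |- measurable_fun _ (fun x => _^-1) => apply: (measurableT_comp (@measurable_invr _))
    | |- measurable_fun _ (fun x => `|_|) => apply: measurableT_comp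
    | H : measurable_fun setT ?f |- measurable_fun _ (fun x => ?f _) => apply: (measurableT_comp H)
    end].

(** * Affine changes of variable for Lebesgue integrals *)

Section line.
Variable R : realType.
Local Notation mu := (@lebesgue_measure R).
Implicit Types (h : R -> R).

(** Uniqueness of Lebesgue measure reduces the claim to half-open intervals. For [c < 0] the
    preimage is closed on the left and open on the right, which does not affect its length. *)
Lemma pushforward_affine (a c : R) (A : set R) : c != 0 -> measurable A ->
  (`|c|%:E * pushforward mu ((fun x : R => c * x + a)%R : _ -> measurableTypeR R) A = mu A)%E.
Proof.
move=> c0 mA.
have mf : measurable_fun setT ((fun x => c * x + a) : measurableTypeR R -> measurableTypeR R).
  by apply: measurable_funD => //; exact: measurable_funM.
have /(_ mf) H := @lebesgue_measure_unique R (mscale (NngNum (normr_ge0 c))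
  (pushforward mu ((fun x : R => c * x + a)%R : _ -> measurableTypeR R))).
apply/esym; move: A mA; apply: H => X [[x y]] _ <-; apply/esym.
change ((`|c|%:E * mu ((fun x : R => (c * x + a)%R) @^-1` `]x, y]) = mu `]x, y])%E).
have [cgt|clt|c00] := ltgtP 0 c; last by rewrite c00 eqxx in c0.
- rewrite (_ : _ @^-1` _ = `](x - a) / c, (y - a) / c]%classic); last first.
    apply/seteqP; split => z; rewrite /= !in_itv/= ltr_pdivrMr// ler_pdivlMr// ltrBlDr lerBrDr mulrC//.
  rewrite !lebesgue_measure_itv/= !lte_fin ltr_pM2r ?invr_gt0// ltrD2r.
  case: ifPn => _; last by rewrite mule0.
  by rewrite -!EFinD -EFinM; congr EFin; rewrite gtr0_norm//; field.
- rewrite (_ : _ @^-1` _ = `[(y - a) / c, (x - a) / c[%classic); last first.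
    apply/seteqP; split => z; rewrite /= !in_itv/= ltr_ndivlMr// ler_ndivrMr// ltrBlDr lerBrDr mulrC andbC//.
  rewrite !lebesgue_measure_itv/= !lte_fin ltr_nM2r ?invr_lt0// ltrD2r.
  case: ifPn => _; last by rewrite mule0.
  by rewrite -!EFinD -EFinM; congr EFin; rewrite ltr0_norm//; field.
Qed.

Lemma ge0_integral_affine (a c : R) (h : R -> \bar R) : c != 0 ->
  measurable_fun setT h -> (forall x, (0 <= h x)%E) ->
  (`|c|%:E * \int[mu]_x h (c * x + a)%R = \int[mu]_x h x)%E.
Proof.
move=> c0 mh h0; pose aff : measurableTypeR R -> measurableTypeR R := fun x => c * x + a.
have mf : measurable_fun setT aff.
  by apply: measurable_funD => //; exact: measurable_funM.
have H := @ge0_integral_pushforward _ _ _ _ R aff mf mu setT h measurableT mh (fun x _ => h0 x).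
rewrite [X in (_ * X)%E](_ : _ = \int[pushforward mu aff]_x h x)%E; last first.
  by rewrite H preimage_setT.
have /(_ mf) <- := @ge0_integral_mscale _ _ R (pushforward mu aff) setT measurableT
   (NngNum (normr_ge0 c)) h mh (fun x _ => h0 x).
apply: eq_measure_integral => A mA _.
exact: (pushforward_affine a c0 mA).
Qed.

Lemma ge0_integral_shift (a : R) (h : R -> \bar R) :
  measurable_fun setT h -> (forall x, (0 <= h x)%E) ->
  (\int[mu]_x h (x + a)%R = \int[mu]_x h x)%E.
Proof.
move=> mh h0; rewrite -[RHS](@ge0_integral_affine a 1) ?oner_eq0//.
by rewrite normr1 mul1e; apply: eq_integral => x _; rewrite mul1r.
Qed.

Lemma ge0_integral_reflect (a : R) (h : R -> \bar R) :
  measurable_fun setT h -> (forall x, (0 <= h x)%E) ->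
  (\int[mu]_x h (a - x)%R = \int[mu]_x h x)%E.
Proof.
move=> mh h0; rewrite -[RHS](@ge0_integral_affine a (- 1)) ?oppr_eq0 ?oner_eq0//.
by rewrite normrN1 mul1e; apply: eq_integral => x _; rewrite mulN1r addrC.
Qed.

Lemma L1_affine (a c : R) h : c != 0 -> L1 mu h -> L1 mu (fun x => h (c * x + a)).
Proof.
move=> c0 h1; apply/integrableP; split.
  apply/measurable_EFinP; apply: (measurableT_comp (L1_measurable h1)); mfun.
have mh : measurable_fun setT (fun x => `|h x|%:E).
  by apply/measurable_EFinP; exact: (L1_measurable (L1_norm h1)).
have := @ge0_integral_affine a c (fun x => `|h x|%:E) c0 mh (fun x => normr_ge0 (h x)).
have := L1_lty h1; set J := (\int[mu]_x _)%E => Joo; move: Joo => /[swap] <-.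
by rewrite !ltey; apply: contra => /eqP /= ->; rewrite gt0_muley// lte_fin normr_gt0.
Qed.

Lemma Rint_affine (a c : R) h : c != 0 -> L1 mu h ->
  `|c| * (\int[mu]_x h (c * x + a)) = \int[mu]_x h x.
Proof.
move=> c0 h1.
have mh := L1_measurable h1.
have pos (g : R -> R) : (forall x, 0 <= g x) -> L1 mu g -> `|c| * (\int[mu]_x g (c * x + a)) = \int[mu]_x g x.
  move=> g0 g1; apply: EFin_inj; rewrite EFinM !EFin_Rint//; last exact: (L1_affine a c0).
  apply: (@ge0_integral_affine a c (EFin \o g)) => //.
  by apply/measurable_EFinP; exact: (L1_measurable g1).
pose p x := (`|h x| + h x) / 2; pose q x := (`|h x| - h x) / 2.
have p1 : L1 mu p by apply: L1Zr; apply: L1D => //; exact: L1_norm.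
have q1 : L1 mu q by apply: L1Zr; apply: L1B => //; exact: L1_norm.
have hE x : h x = p x - q x by rewrite /p /q; field.
rewrite (eq_Rint mu hE) RintB// -(pos p) -?(pos q)//.
- rewrite -mulrBr -RintB; [|exact: L1_affine|exact: L1_affine].
  by congr (_ * _); apply: eq_Rint => x; rewrite hE.
- by move=> x; rewrite /q divr_ge0// subr_ge0 ler_norm.
- by move=> x; rewrite /p divr_ge0// -[X in _ + X]opprK subr_ge0 -normrN ler_norm.
Qed.

Lemma L1_shift (a : R) h : L1 mu h -> L1 mu (fun x => h (x + a)).
Proof. by move=> /(@L1_affine a 1 _ (oner_neq0 _)); apply: eq_L1 => x; rewrite mul1r. Qed.

Lemma Rint_shift (a : R) h : L1 mu h -> \int[mu]_x h (x + a) = \int[mu]_x h x.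
Proof.
move=> h1; rewrite -[RHS](@Rint_affine a 1) ?oner_eq0// normr1 mul1r.
by apply: eq_Rint => x; rewrite mul1r.
Qed.

Lemma L1_reflect (a : R) h : L1 mu h -> L1 mu (fun x => h (a - x)).
Proof.
move=> /(@L1_affine a (- 1)); rewrite oppr_eq0 oner_eq0 => /(_ erefl).
by apply: eq_L1 => x; rewrite mulN1r addrC.
Qed.

Lemma Rint_reflect (a : R) h : L1 mu h -> \int[mu]_x h (a - x) = \int[mu]_x h x.
Proof.
move=> h1; rewrite -[RHS](@Rint_affine a (- 1)) ?oppr_eq0 ?oner_eq0// normrN1 mul1r.
by apply: eq_Rint => x; rewrite mulN1r addrC.
Qed.

End line.

(** * Fubini and Tonelli for real-valued integrands *)

Section product_space.
Context d1 d2 (T1 : measurableType d1) (T2 : measurableType d2) (R : realType).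
Variables (m1 : {sigma_finite_measure set T1 -> \bar R})
          (m2 : {sigma_finite_measure set T2 -> \bar R}).
Local Notation m12 := (m1 \x m2)%E.
Implicit Types (H : T1 * T2 -> R) (a : T1 -> R) (b : T2 -> R).

Lemma L1_prod12 H : measurable_fun setT H ->
  (\int[m1]_x \int[m2]_y `|H (x, y)|%:E < +oo)%E -> L1 m12 H.
Proof. by move=> mH Hoo; apply/integrable12ltyP => //; exact/measurable_EFinP. Qed.

Lemma L1_prod21 H : measurable_fun setT H ->
  (\int[m2]_y \int[m1]_x `|H (x, y)|%:E < +oo)%E -> L1 m12 H.
Proof. by move=> mH Hoo; apply/integrable21ltyP => //; exact/measurable_EFinP. Qed.

Lemma prod12_L1 H : L1 m12 H -> (\int[m1]_x \int[m2]_y `|H (x, y)|%:E < +oo)%E.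
Proof.
move=> H1; have /measurable_EFinP mH := L1_measurable H1.
exact: ((integrable12ltyP m1 m2 mH).1 H1).
Qed.

Lemma ge0_measurable_int2 H : measurable_fun setT H -> (forall z, 0 <= H z) ->
  measurable_fun setT (fun x => \int[m2]_y (H (x, y))%:E)%E.
Proof.
move=> mH H0; apply: (measurable_fun_fubini_tonelli_F (EFin \o H)) => //; exact/measurable_EFinP.
Qed.

Lemma ge0_measurable_int1 H : measurable_fun setT H -> (forall z, 0 <= H z) ->
  measurable_fun setT (fun y => \int[m1]_x (H (x, y))%:E)%E.
Proof.
move=> mH H0; apply: (measurable_fun_fubini_tonelli_G (EFin \o H)) => //; exact/measurable_EFinP.
Qed.

Lemma ge0_measurable_Rint2 H : measurable_fun setT H -> (forall z, 0 <= H z) ->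
  measurable_fun setT (fun x => \int[m2]_y H (x, y)).
Proof.
move=> mH H0; apply: measurableT_comp; first exact: fine_measurable.
apply: (measurable_fun_fubini_tonelli_F (EFin \o H)) => //; exact/measurable_EFinP.
Qed.

Lemma ge0_measurable_Rint1 H : measurable_fun setT H -> (forall z, 0 <= H z) ->
  measurable_fun setT (fun y => \int[m1]_x H (x, y)).
Proof.
move=> mH H0; apply: measurableT_comp; first exact: fine_measurable.
apply: (measurable_fun_fubini_tonelli_G (EFin \o H)) => //; exact/measurable_EFinP.
Qed.

Lemma L1_fubini1 H : L1 m12 H -> L1 m1 (fun x => \int[m2]_y H (x, y)).
Proof.
move=> H1; have F1 := integrable_fubini_F H1.
apply/integrableP; split.
  apply/measurable_EFinP; apply: (measurableT_comp (fine_measurable measurableT)).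
  exact: measurable_int F1.
have /integrableP[_] := F1; apply: le_lt_trans.
apply: ge0_le_integral => //.
- apply/measurable_EFinP; apply: measurableT_comp => //.
  apply: (measurableT_comp (fine_measurable measurableT)); exact: measurable_int F1.
- by apply: measurableT_comp => //; exact: measurable_int F1.
(* Where the inner integral is infinite [fine] returns 0, so passing to real values only decreases
   the absolute value. *)
- move=> x _ /=; rewrite /Rintegral /fubini_F.
  by case: (\int[m2]_y (EFin \o H) (x, y))%E => [r| |] //=; rewrite leey.
Qed.

Lemma Rint_fubini1 H : L1 m12 H ->
  \int[m12]_z H z = \int[m1]_x \int[m2]_y H (x, y).
Proof.
move=> H1; rewrite /Rintegral -(integral12_prod_meas1 H1); congr fine.
have F1 := integrable_fubini_F H1.
apply: ae_eq_integral => //; first exact: measurable_int F1.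
- exact: measurable_int (L1_fubini1 H1).
- apply: filterS (integrable_ae _ F1) => // x /(_ I) fx _ /=.
  by rewrite /Rintegral fineK.
Qed.

Lemma L1_prodM a b : L1 m1 a -> L1 m2 b -> L1 m12 (fun z => a z.1 * b z.2).
Proof.
move=> a1 b1; have ma := L1_measurable a1; have mb := L1_measurable b1.
apply: L1_prod12; first by mfun2.
rewrite (eq_integral (fun x => `|a x|%:E * \int[m2]_y `|b y|%:E)%E); last first.
  move=> x _; under eq_integral => y _ do rewrite /= normrM EFinM.
  by rewrite ge0_integralZl//; apply/measurable_EFinP; mfun2.
rewrite ge0_integralZr//.
- rewrite -[X in (X * _)%E]EFin_Rint; last exact: L1_norm.
  rewrite -[X in (_ * X)%E]EFin_Rint; last exact: L1_norm.
  by rewrite -EFinM ltry.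
- by apply/measurable_EFinP; mfun2.
- by apply: integral_ge0.
Qed.

Lemma Rint_prodM a b : L1 m1 a -> L1 m2 b ->
  \int[m12]_z (a z.1 * b z.2) = (\int[m1]_x a x) * (\int[m2]_x b x).
Proof.
move=> a1 b1; rewrite Rint_fubini1; last exact: L1_prodM.
rewrite -RintZr//; apply: eq_Rint => x /=; exact: RintZ.
Qed.

Lemma tonelli12 H : measurable_fun setT H -> (forall z, 0 <= H z) ->
  (\int[m1]_x \int[m2]_y (H (x, y))%:E = \int[m2]_y \int[m1]_x (H (x, y))%:E)%E.
Proof.
move=> mH H0; apply: (fubini_tonelli (EFin \o H)); first exact/measurable_EFinP.
by move=> z; rewrite lee_fin.
Qed.

End product_space.

Section product_space_swap.
Context d1 d2 (T1 : measurableType d1) (T2 : measurableType d2) (R : realType).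
Variables (m1 : {sigma_finite_measure set T1 -> \bar R})
          (m2 : {sigma_finite_measure set T2 -> \bar R}).
Implicit Types (H : T1 * T2 -> R).

Lemma L1_swap H : L1 (m1 \x m2)%E H -> L1 (m2 \x m1)%E (fun z => H (z.2, z.1)).
Proof.
move=> H1; have mH := L1_measurable H1.
apply: L1_prod21.
  by apply: (measurableT_comp mH); apply: measurable_fun_pair.
exact: prod12_L1.
Qed.

Lemma Rint_swap H : L1 (m1 \x m2)%E H ->
  \int[(m1 \x m2)%E]_z H z = \int[(m2 \x m1)%E]_z H (z.2, z.1).
Proof.
move=> H1; rewrite /Rintegral -(integral12_prod_meas1 H1).
by rewrite -(integral21_prod_meas1 (L1_swap H1)).
Qed.

Lemma Rint_fubini2 H : L1 (m1 \x m2)%E H ->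
  \int[(m1 \x m2)%E]_z H z = \int[m2]_y \int[m1]_x H (x, y).
Proof. by move=> H1; rewrite Rint_swap// Rint_fubini1//; exact: L1_swap. Qed.

Lemma L1_fubini2 H : L1 (m1 \x m2)%E H -> L1 m2 (fun y => \int[m1]_x H (x, y)).
Proof. by move=> /L1_swap/L1_fubini1. Qed.

End product_space_swap.

Section plane.
Variable R : realType.
Local Notation mu := (@lebesgue_measure R).
Local Notation mu2 := (mu \x mu)%E.
Implicit Types (H : R * R -> R) (a b : R -> R).

Lemma tonelli H : measurable_fun setT H -> (forall z, 0 <= H z) ->
  (\int[mu]_x \int[mu]_y (H (x, y))%:E = \int[mu]_y \int[mu]_x (H (x, y))%:E)%E.
Proof.
move=> mH H0; exact: (@tonelli12 _ _ _ _ R mu mu H mH H0).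
Qed.

Lemma plane_tonelli1 H : measurable_fun setT H -> (forall z, 0 <= H z) ->
  (\int[mu]_x \int[mu]_y (H (x, y))%:E = \int[mu2]_z (H z)%:E)%E.
Proof.
move=> mH H0; apply/esym; apply: (@fubini_tonelli1 _ _ _ _ R mu mu (EFin \o H)) => //.
exact/measurable_EFinP.
Qed.

Lemma tonelli_shear H : measurable_fun setT H -> (forall z, 0 <= H z) ->
  (\int[mu]_x \int[mu]_y (H (x, y))%:E = \int[mu]_w \int[mu]_x (H (x, x + w))%:E)%E.
Proof.
move=> mH H0.
have mS : measurable_fun setT (fun z : R * R => H (z.1, z.1 + z.2)).
  apply: (measurableT_comp mH); apply: measurable_fun_pair => //; mfun.
have <- := @tonelli (fun z => H (z.1, z.1 + z.2)) mS (fun z => H0 _).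
apply: eq_integral => x _.
rewrite -(@ge0_integral_shift R x (fun y => (H (x, y))%:E)).
- by apply: eq_integral => y _; rewrite addrC.
- by apply/measurable_EFinP; exact: measurableT_comp.
- by move=> y; rewrite lee_fin.
Qed.

Lemma L1_plane12 H : measurable_fun setT H ->
  (\int[mu]_x \int[mu]_y `|H (x, y)|%:E < +oo)%E -> L1 mu2 H.
Proof. move=> mH; exact: (@L1_prod12 _ _ _ _ R mu mu H mH). Qed.

Lemma L1_plane21 H : measurable_fun setT H ->
  (\int[mu]_y \int[mu]_x `|H (x, y)|%:E < +oo)%E -> L1 mu2 H.
Proof. move=> mH; exact: (@L1_prod21 _ _ _ _ R mu mu H mH). Qed.

Lemma L1_line_measurable a : L1 mu a -> measurable_fun (setT : set R) a.
Proof. move=> H; exact: (L1_measurable H). Qed.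

Lemma L1_plane_measurable H : L1 mu2 H -> measurable_fun (setT : set (R * R)) H.
Proof. move=> H1; exact: (L1_measurable H1). Qed.

Lemma plane_measurable_int2 H : measurable_fun setT H -> (forall z, 0 <= H z) ->
  measurable_fun (setT : set R) (fun x => \int[mu]_y (H (x, y))%:E)%E.
Proof. move=> mH; exact: (@ge0_measurable_int2 _ _ _ _ R mu H mH). Qed.

Lemma plane_measurable_int1 H : measurable_fun setT H -> (forall z, 0 <= H z) ->
  measurable_fun (setT : set R) (fun y => \int[mu]_x (H (x, y))%:E)%E.
Proof. move=> mH; exact: (@ge0_measurable_int1 _ _ _ _ R mu H mH). Qed.

Lemma plane_measurable_Rint2 H : measurable_fun setT H -> (forall z, 0 <= H z) ->
  measurable_fun (setT : set R) (fun x => \int[mu]_y (H (x, y))).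
Proof. move=> mH; exact: (@ge0_measurable_Rint2 _ _ _ _ R mu H mH). Qed.

Lemma plane_measurable_Rint1 H : measurable_fun setT H -> (forall z, 0 <= H z) ->
  measurable_fun (setT : set R) (fun y => \int[mu]_x (H (x, y))).
Proof. move=> mH; exact: (@ge0_measurable_Rint1 _ _ _ _ R mu H mH). Qed.

Lemma L1_shear H : L1 mu2 H -> L1 mu2 (fun z => H (z.1, z.1 + z.2)).
Proof.
move=> H1; have mH := L1_plane_measurable H1.
have mS : measurable_fun setT (fun z : R * R => H (z.1, z.1 + z.2)).
  by apply: (measurableT_comp mH); apply: measurable_fun_pair => //; mfun.
apply: (L1_plane21 mS).
have mN : measurable_fun setT (fun z => `|H z|) by exact: measurableT_comp.
have <- := @tonelli_shear (fun z => `|H z|) mN (fun z => normr_ge0 _).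
exact: (prod12_L1 H1).
Qed.

End plane.

(** * Convolution *)

Section convolution.
Variable R : realType.
Local Notation mu := (@lebesgue_measure R).
Local Notation mu2 := (mu \x mu)%E.
Implicit Types (f g h : R -> R) (H : R * R -> R).

Lemma tonelli_unshear H : measurable_fun setT H -> (forall z, 0 <= H z) ->
  (\int[mu]_x \int[mu]_y (H (x, y))%:E = \int[mu]_s \int[mu]_x (H (x, s - x)%R)%:E)%E.
Proof.
move=> mH H0.
have mS : measurable_fun setT (fun z : R * R => H (z.1, z.2 - z.1)).
  by apply: (measurableT_comp mH); apply: measurable_fun_pair => //; mfun.
have <- := @tonelli _ (fun z => H (z.1, z.2 - z.1)) mS (fun z => H0 _).
apply: eq_integral => x _.
rewrite -(@ge0_integral_shift R (- x) (fun y => (H (x, y))%:E))//.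
- by apply/measurable_EFinP; exact: measurableT_comp.
- by move=> y; rewrite lee_fin.
Qed.

Lemma L1_unshear H : L1 mu2 H -> L1 mu2 (fun z => H (z.1, z.2 - z.1)).
Proof.
move=> H1; have mH := L1_plane_measurable H1.
have mS : measurable_fun setT (fun z : R * R => H (z.1, z.2 - z.1)).
  by apply: (measurableT_comp mH); apply: measurable_fun_pair => //; mfun.
apply: (L1_plane21 mS).
have mN : measurable_fun setT (fun z => `|H z|) by exact: measurableT_comp.
have <- := @tonelli_unshear (fun z => `|H z|) mN (fun z => normr_ge0 _).
exact: (prod12_L1 H1).
Qed.

Lemma Rint_unshear H : L1 mu2 H ->
  \int[mu2]_z H z = \int[mu]_s \int[mu]_x H (x, s - x).
Proof.
move=> H1; rewrite -(Rint_fubini2 (L1_unshear H1)) (Rint_fubini1 (L1_unshear H1)).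
rewrite (Rint_fubini1 H1).
have [N [mN N0 HN]] := ae_integrable1 H1.
apply: ae_eq_Rint.
- exact: L1_measurable (L1_fubini1 H1).
- exact: L1_measurable (L1_fubini1 (L1_unshear H1)).
- exists N; split => // x /= Hx; apply: HN => /= Lx; apply: Hx.
  by rewrite -(Rint_shift (- x) (h := fun y => H (x, y))).
Qed.

Lemma measurable_convol_kernel f g : measurable_fun setT f -> measurable_fun setT g ->
  measurable_fun setT (fun z : R * R => f z.1 * g (z.2 - z.1)).
Proof.
move=> mf mg; apply: measurable_funM; first exact: measurableT_comp.
by apply: (measurableT_comp mg); mfun.
Qed.

Lemma convol_ge0 f g x : (forall x, 0 <= f x) -> (forall x, 0 <= g x) -> 0 <= convol f g x.
Proof. by move=> f0 g0; apply: Rint_ge0 => y; rewrite mulr_ge0. Qed.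

Lemma measurable_convol f g : measurable_fun setT f -> measurable_fun setT g ->
  (forall x, 0 <= f x) -> (forall x, 0 <= g x) -> measurable_fun setT (convol f g).
Proof.
move=> mf mg f0 g0.
exact: (plane_measurable_Rint1 (measurable_convol_kernel mf mg) (fun z => mulr_ge0 (f0 _) (g0 _))).
Qed.

Lemma L1_convol f g : L1 mu f -> L1 mu g -> L1 mu (convol f g).
Proof. by move=> f1 g1; exact: (L1_fubini2 (L1_unshear (L1_prodM f1 g1))). Qed.

Lemma Rint_convol f g : L1 mu f -> L1 mu g ->
  \int[mu]_x convol f g x = (\int[mu]_x f x) * (\int[mu]_x g x).
Proof.
by move=> f1 g1; rewrite -Rint_prodM// (Rint_unshear (L1_prodM f1 g1)).
Qed.

Lemma ae_convolE f g : L1 mu f -> L1 mu g ->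
  {ae mu, forall x, L1 mu (fun y => f y * g (x - y))}.
Proof. by move=> f1 g1; exact: ae_integrable2 (L1_unshear (L1_prodM f1 g1)). Qed.

(** [convol] is a real-valued integral and agrees with the extended one where [f y * g (x - y)] is
    integrable in [y]. That holds for almost every [x], and there [h x] moves inside; the rest is
    Tonelli in the coordinates [y] and [x - y]. *)
Lemma ge0_integral_convol f g h : L1 mu f -> L1 mu g -> measurable_fun setT h ->
  (forall x, 0 <= f x) -> (forall x, 0 <= g x) -> (forall x, 0 <= h x) ->
  (\int[mu]_x (h x * convol f g x)%:E =
   \int[mu]_y \int[mu]_w (h (y + w)%R * (f y * g w))%:E)%E.
Proof.
move=> f1 g1 mh f0 g0 h0.
have mf := L1_line_measurable f1; have mg := L1_line_measurable g1.
have mH : measurable_fun setT (fun z : R * R => h (z.1 + z.2) * (f z.1 * g z.2)).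
  apply: measurable_funM; first by apply: (measurableT_comp mh); mfun.
  by apply: measurable_funM; exact: measurableT_comp.
have -> := @tonelli_unshear (fun z : R * R => h (z.1 + z.2) * (f z.1 * g z.2)) mH.
  2: by move=> z; rewrite !mulr_ge0.
have [N [mN N0 HN]] := ae_convolE f1 g1.
apply: ae_eq_integral => //.
- apply/measurable_EFinP; apply: measurable_funM => //.
  exact: measurable_convol.
- have mS : measurable_fun setT (fun z : R * R => h (z.1 + (z.2 - z.1)) * (f z.1 * g (z.2 - z.1))).
    apply: measurable_funM; first by apply: (measurableT_comp mh); mfun.
    exact: measurable_convol_kernel.
  apply: (plane_measurable_int1 mS) => z; by rewrite !mulr_ge0.
- exists N; split => // x /= Hx; apply: HN => /= Lx; apply: Hx => _.
  rewrite EFinM EFin_Rint// -ge0_integralZl//.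
  + by apply: eq_integral => y _; rewrite -EFinM subrKC.
  + by apply/measurable_EFinP; exact: (L1_measurable Lx).
  + by move=> y _; rewrite lee_fin mulr_ge0.
  + by rewrite lee_fin.
Qed.

Lemma L1_convol_comp f g h : L1 mu f -> L1 mu g -> measurable_fun setT h ->
  (forall x, 0 <= f x) -> (forall x, 0 <= g x) -> L1 mu (fun x => h x * convol f g x) ->
  L1 mu2 (fun z => h (z.1 + z.2) * (f z.1 * g z.2)).
Proof.
move=> f1 g1 mh f0 g0 hfg1.
have mf := L1_line_measurable f1; have mg := L1_line_measurable g1.
have mH : measurable_fun setT (fun z : R * R => h (z.1 + z.2) * (f z.1 * g z.2)).
  apply: measurable_funM; first by apply: (measurableT_comp mh); mfun.
  by apply: measurable_funM; exact: measurableT_comp.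
apply: (L1_plane12 mH).
have mn : measurable_fun setT (fun x => `|h x|) by exact: measurableT_comp.
have := ge0_integral_convol f1 g1 mn f0 g0 (fun x => normr_ge0 (h x)).
have := L1_lty hfg1.
under eq_integral do rewrite normrM (ger0_norm (convol_ge0 _ f0 g0)).
move=> /[swap] ->; apply: le_lt_trans; apply: ge0_le_integral => //.
- by move=> x _; apply: integral_ge0.
- have mS : measurable_fun setT (fun z : R * R => `|h (z.1 + z.2) * (f z.1 * g z.2)|).
    exact: measurableT_comp.
  exact: (plane_measurable_int2 mS (fun z => normr_ge0 _)).
- have mS : measurable_fun setT (fun z : R * R => `|h (z.1 + z.2)| * (f z.1 * g z.2)).
    apply: measurable_funM; last by apply: measurable_funM; exact: measurableT_comp.
    by apply: (measurableT_comp mn); mfun.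
  by apply: (plane_measurable_int2 mS) => z; rewrite !mulr_ge0.
- move=> x _; rewrite le_eqVlt; apply/orP; left; apply/eqP; apply: eq_integral => y _ /=.
  by rewrite normrM [X in _ * X]ger0_norm// mulr_ge0.
Qed.

Lemma Rint_convol_comp f g h : L1 mu f -> L1 mu g -> measurable_fun setT h ->
  (forall x, 0 <= f x) -> (forall x, 0 <= g x) -> L1 mu (fun x => h x * convol f g x) ->
  \int[mu]_x (h x * convol f g x) = \int[mu2]_z (h (z.1 + z.2) * (f z.1 * g z.2)).
Proof.
move=> f1 g1 mh f0 g0 hfg1.
rewrite (Rint_unshear (L1_convol_comp f1 g1 mh f0 g0 hfg1)) /=.
have [N [mN N0 HN]] := ae_convolE f1 g1.
apply: ae_eq_Rint.
- exact: L1_measurable hfg1.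
- exact: L1_measurable (L1_fubini2 (L1_unshear (L1_convol_comp f1 g1 mh f0 g0 hfg1))).
- exists N; split => // x /= Hx; apply: HN => /= Lx; apply: Hx.
  by rewrite -RintZ//; apply: eq_Rint => y; rewrite subrKC.
Qed.

Lemma convolC f g : measurable_fun setT f -> measurable_fun setT g ->
  (forall x, 0 <= f x) -> (forall x, 0 <= g x) -> convol f g = convol g f.
Proof.
move=> mf mg f0 g0; apply/funext => x; congr fine.
rewrite -(@ge0_integral_reflect R x (fun y => (f y * g (x - y)%R)%:E)).
- by apply: eq_integral => y _; rewrite subKr mulrC.
- by apply/measurable_EFinP; apply: measurable_funM => //; apply: (measurableT_comp mg); mfun.
- by move=> y; rewrite lee_fin mulr_ge0.
Qed.

End convolution.

(** * Measures given by a density, and domination by Lebesgue measure *)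

Section density_measure.
Context d (T : measurableType d) (R : realType) (m : {measure set T -> \bar R}).
Variable s : T -> R.
Hypotheses (ms : measurable_fun setT s) (s0 : forall x, 0 <= s x).

Definition density_measure0 (A : set T) : \bar R := (\int[m]_(x in A) (s x)%:E)%E.

Let dm0 : density_measure0 set0 = 0%E.
Proof. exact: integral_set0. Qed.

Let dm_ge0 A : (0 <= density_measure0 A)%E.
Proof. by apply: integral_ge0 => x _; rewrite lee_fin. Qed.

Let dm_sigma : semi_sigma_additive density_measure0.
Proof.
move=> /= F mF tF mUF; rewrite /density_measure0; apply: cvg_toP.
  apply: ereal_nondecreasing_is_cvgn => i j ij.
  apply: lee_sum_nneg_natr => // k _ _.
  by apply: integral_ge0 => /= x _; rewrite lee_fin.
rewrite ge0_integral_bigcup//=.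
- by apply: measurable_funTS; exact/measurable_EFinP.
- by move=> x _; rewrite lee_fin.
Qed.

Definition density_measure : {measure set T -> \bar R} :=
  HB.pack density_measure0 (isMeasure.Build _ _ _ density_measure0 dm0 dm_ge0 dm_sigma).

Lemma density_measureE A : density_measure A = (\int[m]_(x in A) (s x)%:E)%E.
Proof. by []. Qed.

Import HBNNSimple.

(** Both sides are limits along an increasing sequence of simple functions, and on a level set the
    equality is the definition of the measure. Negative values [r] only meet empty level sets. *)
Lemma integral_density_measure (h : T -> \bar R) : measurable_fun setT h ->
  (forall x, (0 <= h x)%E) ->
  (\int[density_measure]_x h x = \int[m]_x (h x * (s x)%:E))%E.
Proof.
move=> mh h0; pose h_ := nnsfun_approx measurableT mh.
have h_h x : (fun n => (h_ n x)%:E) @ \oo --> h x.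
  by apply: cvg_nnsfun_approx.
transitivity (limn (fun n => \int[density_measure]_x (h_ n x)%:E))%E.
  rewrite -monotone_convergence//.
  - by apply: eq_integral => x _; apply/esym/cvg_lim => //; exact: h_h.
  - by move=> n; exact/measurable_EFinP.
  - by move=> n x _; rewrite lee_fin.
  - by move=> x _ i j ij; rewrite lee_fin; exact/lefP/nd_nnsfun_approx.
transitivity (limn (fun n => \int[m]_x ((h_ n x)%:E * (s x)%:E)))%E; last first.
  rewrite -monotone_convergence//.
  - apply: eq_integral => x _; apply/cvg_lim => //.
    by apply: cvgeZr => //; exact: h_h.
  - by move=> n; apply/measurable_EFinP; exact: measurable_funM.
  - by move=> n x _; rewrite mule_ge0// lee_fin.
  - move=> x _ i j ij; rewrite lee_wpmul2r ?lee_fin//.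
    exact/lefP/nd_nnsfun_approx.
congr (limn _); apply/funext => n.
under eq_integral do rewrite fimfunE -fsumEFin//.
rewrite ge0_integral_fsum//; last 2 first.
- by move=> r; exact/measurable_EFinP/measurable_funM.
- by move=> r x _; rewrite nnfun_muleindic_ge0.
under [RHS]eq_integral.
  move=> x xD; rewrite fimfunE -fsumEFin// muleC ge0_mule_fsumr; last first.
    by move=> r; rewrite EFinM nnfun_muleindic_ge0.
  over.
rewrite ge0_integral_fsum//; last 2 first.
- by move=> r; apply/measurable_EFinP; do 2 apply: measurable_funM => //.
- by move=> r x _; rewrite mule_ge0 ?lee_fin// -lee_fin EFinM nnfun_muleindic_ge0.
apply: eq_fsbigr => r _.
rewrite integralZl_indic_nnsfun// integral_indic// setIT density_measureE.
have [r0|r0] := ltP r 0.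
  rewrite preimage_nnfun0// integral_set0 mule0; apply/esym.
  by apply: integral0_eq => x _; rewrite indic0 mulr0 mule0.
rewrite [X in (_ * X)%E]integral_mkcond/= -ge0_integralZl//.
- apply: eq_integral => x _; rewrite patchE indicE.
  by case: ifPn => _; rewrite ?mulr1 ?mulr0 ?mule0// muleC.
- apply/(measurable_restrictT _ _).1 => //; apply: measurable_funTS; exact/measurable_EFinP.
- by move=> x _; rewrite patchE; case: ifPn => _; rewrite lee_fin.
Qed.

End density_measure.

Section lebesgue_domination.
Variable R : realType.
Local Notation mu := (@lebesgue_measure R).

(** Lebesgue measure is the infimum of the total length over countable covers by half-open
    intervals, so countable subadditivity of [m] on any such cover gives the bound. It turns an
    estimate on intervals into one between integrals. *)
Lemma measure_le_lebesgue (m : {measure set (measurableTypeR R) -> \bar R}) :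
  (forall a b : R, a < b -> (m `]a, b]%classic <= (b - a)%:E)%E) ->
  forall A : set (measurableTypeR R), measurable A -> (m A <= mu A)%E.
Proof.
move=> mab A mA.
rewrite /lebesgue_measure/= /lebesgue_stieltjes_measure /measure_extension/=.
apply: le_ereal_inf_tmp => _ [F [Fo AF] <-].
apply: (@le_trans _ _ (\sum_(k <oo) m (F k))%E).
  apply: measure_sigma_subadditive => // n.
  by have /ocitvP[->|[x _ ->]] := Fo n.
apply: lee_nneseries => // k _.
have /ocitvP[->|[x x12 ->]] := Fo k; first by rewrite measure0.
by rewrite (@wlength_itv_bnd R idfun _ _ false false (ltW x12)); exact: mab.
Qed.

End lebesgue_domination.

(** * Monotone transport of the normal law *)

Section distribution_function.
Variable R : realType.
Local Notation mu := (@lebesgue_measure R).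
Variable p : R -> R.
Hypotheses (mp : measurable_fun setT p) (p0 : forall x, 0 <= p x)
  (p1 : (\int[mu]_x (p x)%:E = 1)%E).

Definition dfun (q : R -> R) (x : R) : R := \int[mu]_(y in `]-oo, x]) q y.

Let P (A : set R) : \bar R := (\int[mu]_(y in A) (p y)%:E)%E.

Let P_fin A : measurable A -> P A \is a fin_num.
Proof.
move=> mA; rewrite ge0_fin_numE; last by apply: integral_ge0 => x _; rewrite lee_fin.
apply: (@le_lt_trans _ _ 1%E); last by rewrite ltry.
rewrite -p1; apply: ge0_subset_integral => //; first exact/measurable_EFinP.
by move=> x _; rewrite lee_fin.
Qed.

Let PU A B : measurable A -> measurable B -> [disjoint A & B] ->
  (P (A `|` B) = P A + P B)%E.
Proof.
move=> mA mB AB; rewrite /P ge0_integral_setU//.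
- by apply: measurable_funTS; exact/measurable_EFinP.
- by move=> x _; rewrite lee_fin.
Qed.

Lemma dfunE x : (dfun p x)%:E = (\int[mu]_(y in `]-oo, x]) (p y)%:E)%E.
Proof. by rewrite fineK//; exact: P_fin. Qed.

Lemma dfun_ge0 x : 0 <= dfun p x.
Proof. by apply: Rintegral_ge0. Qed.

Lemma dfun_tail x : (\int[mu]_(y in `]x, +oo[) (p y)%:E = (1 - dfun p x)%:E)%E.
Proof.
have : (P `]-oo, x] + P `]x, +oo[ = 1)%E.
  rewrite -PU//; first by rewrite -p1 -setCitvl setUv.
  by rewrite -setCitvl; apply/disj_setPS; rewrite setICr.
by rewrite EFinB dfunE => <-; rewrite addeAC subee ?add0e//; exact: P_fin.
Qed.

Lemma dfun_le1 x : dfun p x <= 1.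
Proof.
rewrite -subr_ge0 -lee_fin -dfun_tail; apply: integral_ge0 => y _.
by rewrite lee_fin.
Qed.

Lemma dfun_itv a b : a <= b ->
  (\int[mu]_(y in `]a, b]) (p y)%:E = (dfun p b - dfun p a)%:E)%E.
Proof.
move=> ab; have : (P `]-oo, a] + P `]a, b] = P `]-oo, b])%E.
  rewrite -PU//.
    by rewrite -itv_bndbnd_setU// bnd_simp.
  apply/disj_setPS => y /= []; rewrite !in_itv/= => ya /andP[ay _].
  by rewrite ltNge ya in ay.
rewrite EFinB !dfunE /P => <-; rewrite addeAC subee ?add0e//; exact: P_fin.
Qed.

Lemma dfun_nondecreasing : {homo dfun p : x y / x <= y}.
Proof.
move=> a b ab; rewrite -subr_ge0 -lee_fin -dfun_itv//; apply: integral_ge0 => y _.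
by rewrite lee_fin.
Qed.

(** Continuity from below of the law with density [p]. The four estimates after it take [F] to be
    rays exhausting the line or an open ray. *)
Let increasing_sets (F : (set R)^nat) (e : R) : 0 < e ->
  (forall n, measurable (F n)) -> {homo F : n m / (n <= m)%N >-> (n <= m)%O} ->
  exists n, fine (P (\bigcup_n F n)) - e < fine (P (F n)).
Proof.
move=> e0 mF Fnd.
have mU : measurable (\bigcup_n F n) by exact: bigcup_measurable.
have /fine_cvgP[_ /cvgrPdist_lt/(_ e e0)[N _ /(_ N (leqnn N))]] :
    (P \o F) x @[x --> \oo] --> (fine (P (\bigcup_n F n)))%:E.
  rewrite fineK; last exact: P_fin.
  apply: ge0_nondecreasing_set_cvg_integral => //.
  - by move=> n; apply: measurable_funTS; exact/measurable_EFinP.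
  - by move=> n x _; rewrite lee_fin.
move=> /= H; exists N; rewrite ltrBlDr -ltrBlDl (le_lt_trans (ler_norm _))//.
Qed.

Lemma dfun_lt_eps e : 0 < e -> exists x, dfun p x < e.
Proof.
move=> e0; have [//||n] := @increasing_sets (fun n => `](- n%:R), +oo[%classic) e e0.
  move=> n m nm; apply/subsetPset => x /=; rewrite !in_itv/= !andbT; apply: le_lt_trans.
  by rewrite lerN2 ler_nat.
rewrite (_ : \bigcup_n _ = setT); last first.
  apply/seteqP; split => // x _; exists (Num.truncn `|x|).+1 => //=.
  rewrite in_itv/= andbT ltrNl (le_lt_trans _ (truncnS_gt _))//.
  by rewrite -normrN ler_norm.
rewrite /P p1 dfun_tail /= => H; exists (- n%:R); lra.
Qed.

Lemma dfun_gt_eps e : 0 < e -> exists x, 1 - e < dfun p x.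
Proof.
move=> e0; have [//||n] := @increasing_sets (fun n => `]-oo, n%:R]%classic) e e0.
  move=> n m nm; apply/subsetPset => x /=; rewrite !in_itv/= => /le_trans; apply.
  by rewrite ler_nat.
rewrite (_ : \bigcup_n _ = setT); last first.
  apply/seteqP; split => // x _; exists (Num.truncn `|x|).+1 => //=.
  rewrite in_itv/= ltW// (le_lt_trans _ (truncnS_gt _))//; exact: ler_norm.
by rewrite /P p1 -dfunE /= => H; exists n%:R.
Qed.

Lemma dfun_right x e : 0 < e -> exists2 y, x < y & dfun p y < dfun p x + e.
Proof.
move=> e0; have [//||n] := @increasing_sets (fun n => `]x + n.+1%:R^-1, +oo[%classic) e e0.
  move=> n m nm; apply/subsetPset => z /=; rewrite !in_itv/= !andbT; apply: le_lt_trans.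
  by rewrite lerD2l lef_pV2 ?posrE// ler_nat.
rewrite (_ : \bigcup_n _ = `]x, +oo[%classic); last first.
  apply/seteqP; split => z /=.
    move=> [k _] /=; rewrite !in_itv/= !andbT; apply: le_lt_trans.
    by rewrite lerDl invr_ge0.
  rewrite in_itv/= andbT => xz; exists (Num.truncn (z - x)^-1) => //=.
  rewrite in_itv/= andbT -ltrBrDl invf_plt ?posrE ?subr_gt0//; exact: truncnS_gt.
rewrite /P !dfun_tail /= => H; exists (x + n.+1%:R^-1); last lra.
by rewrite ltrDl invr_gt0.
Qed.

Lemma dfun_left x e : 0 < e -> exists2 y, y < x & dfun p x - e < dfun p y.
Proof.
move=> e0; have [//||n] := @increasing_sets (fun n => `]-oo, x - n.+1%:R^-1]%classic) e e0.
  move=> n m nm; apply/subsetPset => z /=; rewrite !in_itv/= => /le_trans; apply.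
  by rewrite lerD2l lerN2 lef_pV2 ?posrE// ler_nat.
rewrite (_ : \bigcup_n _ = `]-oo, x[%classic); last first.
  apply/seteqP; split => z /=.
    move=> [k _] /=; rewrite !in_itv/= => /le_lt_trans; apply.
    by rewrite ltrBlDr ltrDl invr_gt0.
  rewrite in_itv/= => zx; exists (Num.truncn (x - z)^-1) => //=.
  rewrite in_itv/= lerBrDr -lerBrDl ltW// invf_plt ?posrE ?subr_gt0//; exact: truncnS_gt.
(* A law with a density has no atoms, so the open ray may be closed; this is what makes [dfun p]
   continuous from the left. *)
rewrite /P integral_itv_bndo_bndc; last by apply: measurable_funTS; exact/measurable_EFinP.
rewrite -!dfunE /= => H; exists (x - n.+1%:R^-1) => //.
by rewrite ltrBlDr ltrDl invr_gt0.
Qed.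

Lemma dfun_continuous : continuous (dfun p).
Proof.
move=> x; apply/cvgrPdist_lt => e e0.
have [y xy Hy] := dfun_right x e0; have [z zx Hz] := dfun_left x e0.
near=> t.
have zt : z <= t by apply: ltW; near: t; exact: lt_nbhsr.
have ty : t <= y by apply: ltW; near: t; exact: lt_nbhsl.
have := dfun_nondecreasing zt; have := dfun_nondecreasing ty.
by rewrite ltr_norml => *; apply/andP; split; lra.
Unshelve. all: by end_near. Qed.

End distribution_function.

(** Half-open intervals are differences of rays and form a generating family stable under
    intersection; finiteness of [m1] on rays makes the subtractions meaningful. *)
Lemma eq_measure_rays (R : realType) (m1 m2 : {measure set (measurableTypeR R) -> \bar R}) :
  (forall a : R, (m1 `]-oo, a]%classic < +oo)%E) ->
  (forall a : R, m1 `]-oo, a]%classic = m2 `]-oo, a]%classic) ->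
  forall A : set (measurableTypeR R), measurable A -> m1 A = m2 A.
Proof.
move=> m1oo m12; pose g n : set (measurableTypeR R) := `](- n%:R), n%:R]%classic.
have gE (m : {measure set (measurableTypeR R) -> \bar R}) (a b : R) :
    (m `]-oo, b]%classic < +oo)%E ->
    (m (`]-oo, b]%classic `\` `]-oo, a]%classic) =
      m `]-oo, b]%classic - m (`]-oo, b]%classic `&` `]-oo, a]%classic))%E.
  by move=> moo; rewrite measureD.
apply: (@measure_unique _ R (measurableTypeR R) (@ocitv R) g) => //.
- exact: ocitvI.
- by move=> n; exact: is_ocitv.
- rewrite -subTset => x _; exists (Num.truncn `|x|).+1 => //; rewrite /g/=.
  have := truncnS_gt `|x|; have := ler_norm x; have := ler_norm (- x); rewrite normrN in_itv/=.
  by move=> *; apply/andP; split; lra.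
- move=> A [[a b] _ <-]; rewrite [_.1]/= [_.2]/=.
  have -> : `]a, b]%classic = `]-oo, b] `\` `]-oo, a].
    by rewrite -[RHS]setCK setCD setCitvl setUC -[LHS]setCK setCitv.
  rewrite !gE -?m12//.
  have -> : `]-oo, b] `&` `]-oo, a] = `]-oo, Num.min a b]%classic.
    by apply/seteqP; split => z /=; rewrite !in_itv/= le_min andbC => /andP.
  by rewrite -m12.
- move=> n; apply: le_lt_trans (m1oo n%:R); apply: le_measure.
  + by rewrite inE /g; exact: measurable_itv.
  + by rewrite inE; exact: measurable_itv.
  + by move=> z; rewrite /g /= !in_itv/= => /andP[].
Qed.

Section transport.
Variable R : realType.
Local Notation mu := (@lebesgue_measure R).
Variable f : R -> R.
Hypotheses (mf : measurable_fun setT f) (f0 : forall x, 0 <= f x)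
  (f1 : (\int[mu]_x (f x)%:E = 1)%E).
Local Notation phi := (normal_pdf (0 : R) 1).
Local Notation Phi := (dfun phi).
Local Notation F := (dfun f).

Let mphi : measurable_fun setT phi. Proof. exact: measurable_normal_pdf. Qed.
Let phi0 x : 0 <= phi x. Proof. exact: normal_pdf_ge0. Qed.
Let phi1 : (\int[mu]_x (phi x)%:E = 1)%E. Proof. exact: integral_normal_pdf. Qed.

Lemma std_normalE x : phi x = normal_peak 1 * expR (- x ^+ 2 / 2).
Proof.
rewrite normal_pdfE ?oner_eq0// /normal_fun subr0.
by congr (_ * expR (_ / _)); rewrite expr1n.
Qed.

Lemma Phi_lt x y : x < y -> Phi x < Phi y.
Proof.
move=> xy; rewrite -subr_gt0 -lte_fin -(dfun_itv mphi phi0 phi1 (ltW xy)).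
pose M := Num.max `|x| `|y|.
pose c := normal_peak 1 * expR (- M ^+ 2 / 2).
have c0 : 0 < c by rewrite mulr_gt0 ?expR_gt0// normal_peak_gt0// oner_eq0.
apply: (@lt_le_trans _ _ (\int[mu]_(z in `]x, y]) c%:E)%E).
  by rewrite integral_cst//= lebesgue_measure_itv/= lte_fin xy -EFinD -EFinM lte_fin mulr_gt0// subr_gt0.
apply: ge0_le_integral => //.
- by move=> z _; rewrite lee_fin ltW.
- by apply: measurable_funTS; exact/measurable_EFinP.
- move=> z /=; rewrite in_itv/= => /andP[xz zy]; rewrite lee_fin std_normalE ler_pM2l; last first.
    by rewrite normal_peak_gt0// oner_eq0.
  rewrite ler_expR ler_pM2r// lerN2 -(real_normK (num_real z)) lerXn2r ?nnegrE//.
    by rewrite /M le_max normr_ge0.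
  have := ler_norm y; have := ler_norm (- x); rewrite normrN => nx ny.
  by rewrite ler_norml /M; case: (leP `|x| `|y|) => xy'; apply/andP; split; lra.
Qed.

Lemma Phi_gt0 x : 0 < Phi x.
Proof.
apply: le_lt_trans (_ : Phi (x - 1) < Phi x); first exact: dfun_ge0.
by apply: Phi_lt; lra.
Qed.

Lemma Phi_lt1 x : Phi x < 1.
Proof.
apply: lt_le_trans (_ : Phi x < Phi (x + 1)) (dfun_le1 mphi phi0 phi1 _).
by apply: Phi_lt; lra.
Qed.

(** [Phi] carries the normal law to the uniform one: by continuity and strict monotonicity the level
    set is a ray ending where [Phi] equals [c]. The values 0 and 1 are never attained and give the
    empty set and the whole line. *)
Lemma Phi_level c : 0 <= c <= 1 -> (\int[mu]_(x in [set x | (Phi x <= c)%R]) (phi x)%:E = c%:E)%E.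
Proof.
move=> /andP[c0 c1]; have [c00|cn0] := eqVneq c 0.
  rewrite (_ : [set x | _] = set0) ?integral_set0 ?c00// -subset0 => x /=.
  by rewrite leNgt Phi_gt0.
have [c11|cn1] := eqVneq c 1.
  rewrite (_ : [set x | _] = setT) ?phi1 ?c11//; apply/seteqP; split => // x _ /=.
  by rewrite ltW// Phi_lt1.
have {}c0 : 0 < c by rewrite lt_def cn0. 
have {}c1 : 0 < 1 - c by rewrite subr_gt0 lt_def eq_sym cn1.
have [a Ha] := dfun_lt_eps mphi phi0 phi1 c0.
have [b Hb] := dfun_gt_eps mphi phi0 phi1 c1.
have ab : a <= b.
  by rewrite leNgt; apply/negP => /ltW/(dfun_nondecreasing mphi phi0 phi1); lra.
have Fab := dfun_nondecreasing mphi phi0 phi1 ab.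
have [||x _ xc] := @IVT R Phi a b c ab.
- exact/continuous_subspaceT/(dfun_continuous mphi phi0 phi1).
- by rewrite (min_idPl Fab) (max_idPr Fab); apply/andP; split; lra.
rewrite -xc (dfunE mphi phi0 phi1); congr (integral _ _ _).
apply/seteqP; split => z /=; rewrite in_itv/=.
  by move=> Hz; rewrite leNgt; apply/negP => /Phi_lt; rewrite ltNge Hz.
exact: (dfun_nondecreasing mphi phi0 phi1).
Qed.

(** The quantile function of [f] evaluated at [Phi x]. Where [F] is flat the infimum selects the
    left end, so [f] may vanish on intervals. *)
Definition transport x : R := inf [set z | Phi x <= F z].
Local Notation T := transport.

(** A Galois connection from which the other properties of [T] are drawn. Right continuity of [F]
    puts the infimum itself in the set, and [0 < Phi x < 1] makes the set nonempty and bounded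
    below. *)
Lemma transport_leE x a : (T x <= a) = (Phi x <= F a).
Proof.
have ne : [set z | Phi x <= F z] !=set0.
  have [z Hz] := dfun_gt_eps mf f0 f1 (e := 1 - Phi x) ltac:(by rewrite subr_gt0 Phi_lt1).
  by exists z => /=; lra.
apply/idP/idP => [|H].
  apply: contraLR; rewrite -!ltNge => Fa.
  have [y ay Hy] := dfun_right mf f0 f1 a (e := Phi x - F a) ltac:(by rewrite subr_gt0).
  apply: (lt_le_trans ay); apply: lb_le_inf => // z /= Hz.
  by rewrite leNgt; apply/negP => /ltW/(dfun_nondecreasing mf f0 f1); lra.
apply: ge_inf => //.
have [z Hz] := dfun_lt_eps mf f0 f1 (Phi_gt0 x).
exists z => y /= Hy.
by rewrite leNgt; apply/negP => /ltW/(dfun_nondecreasing mf f0 f1); lra.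
Qed.

(** [F] cannot jump over the value [Phi x]: an excess at [T x] would, by left continuity, persist at
    some smaller [y], against the minimality of [T x]. *)
Lemma dfun_transport x : F (T x) = Phi x.
Proof.
apply/eqP; rewrite eq_le -transport_leE lexx andbT leNgt; apply/negP => H.
have [y yx Hy] := dfun_left mf f0 f1 (T x) (e := F (T x) - Phi x) ltac:(by rewrite subr_gt0).
have : T x <= y by rewrite transport_leE; lra.
by rewrite leNgt yx.
Qed.

Lemma transport_homo : {homo T : x y / x <= y}.
Proof.
move=> x y xy; rewrite transport_leE dfun_transport.
exact: (dfun_nondecreasing mphi phi0 phi1).
Qed.

Lemma transport_lt x y : x < y -> T x < T y.
Proof.
move=> xy; rewrite lt_def transport_homo ?(ltW xy)// andbT; apply/eqP => E.
by have := Phi_lt xy; rewrite -!dfun_transport E ltxx.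
Qed.

Lemma measurable_transport : measurable_fun setT T.
Proof. exact: nondecreasing_measurable transport_homo. Qed.

Let mT : measurable_fun setT (T : measurableTypeR R -> measurableTypeR R).
Proof. exact: measurable_transport. Qed.

Let Pf : {measure set (measurableTypeR R) -> \bar R} := density_measure mu mf f0.
Let Pphi : {measure set (measurableTypeR R) -> \bar R} := density_measure mu mphi phi0.

Let push_ray (m : {measure set (measurableTypeR R) -> \bar R}) : 
  (forall A, m A = pushforward Pphi (T : measurableTypeR R -> measurableTypeR R) A) ->
  forall a, m `]-oo, a]%classic = (F a)%:E.
Proof.
move=> Em a; rewrite Em /pushforward.
rewrite -[RHS](@Phi_level (F a)); last first.
  by apply/andP; split; [exact: dfun_ge0|exact: (dfun_le1 mf f0 f1)].
rewrite /Pphi density_measureE; congr (integral _ _ _).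
by apply/seteqP; split => x /=; rewrite in_itv/= transport_leE.
Qed.

(** By [transport_leE] the preimage of a ray under [T] is a level set of [Phi], whose normal mass is
    given by [Phi_level]. The image law therefore agrees with [f] on rays, hence on all measurable
    sets. *)
Lemma integral_transport (h : R -> \bar R) : measurable_fun setT h ->
  (forall x, (0 <= h x)%E) ->
  (\int[mu]_x (h (T x) * (phi x)%:E) = \int[mu]_x (h x * (f x)%:E))%E.
Proof.
move=> mh h0.
have mhT : measurable_fun setT (h \o T) by exact: measurableT_comp.
transitivity (\int[Pphi]_x h (T x))%E.
  exact: (esym (integral_density_measure mu mphi phi0 mhT (fun x => h0 _))).
transitivity (\int[Pf]_x h x)%E; last exact: (integral_density_measure mu mf f0 mh h0).
pose T' : measurableTypeR R -> measurableTypeR R := T.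
have E := @ge0_integral_pushforward _ _ (measurableTypeR R) (measurableTypeR R) R T' mT Pphi setT h measurableT mh (fun x _ => h0 x).
rewrite [in RHS]preimage_setT in E.
transitivity (\int[pushforward Pphi T']_x h x)%E; first exact: (esym E).
apply: (@eq_measure_integral _ (measurableTypeR R) R setT Pf _ h) => A mA _.
have H a := @push_ray (pushforward Pphi T') (fun A => erefl _) a.
apply: (@eq_measure_rays R (pushforward Pphi T') Pf) => // a; first by rewrite H ltry.
by rewrite H (dfunE mf f0 f1).
Qed.

End transport.

Lemma integral_shift_set (R : realType) (w : R) (h : R -> \bar R) (A : set R) :
  measurable_fun setT h -> (forall x, (0 <= h x)%E) -> measurable A ->
  (\int[@lebesgue_measure R]_(y in A) h (y + w)%R =
   \int[@lebesgue_measure R]_(y in [set x | A (x - w)%R]) h y)%E.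
Proof.
move=> mh h0 mA; rewrite integral_mkcond [RHS]integral_mkcond.
have mA' : measurable [set x | A (x - w)].
  have msub : measurable_fun setT (fun x : R => x - w) by mfun.
  by have := msub measurableT A mA; rewrite setTI.
rewrite -(@ge0_integral_shift R w (h \_ [set x | A (x - w)])).
- apply: eq_integral => y _; rewrite !patchE.
  by congr (if _ then _ else _); apply/idP/idP; rewrite !inE/= addrK.
- by apply/(measurable_restrictT _ _).1 => //; exact: measurable_funTS.
- by move=> x; rewrite patchE; case: ifPn.
Qed.

(** Positive and negative parts extend a change of variables from nonnegative to integrable
    functions. Both measure spaces are left abstract so that it serves for [T x] on the line and for
    [T x + T y] on the plane. *)
Lemma L1_transfer d1 d2 (T1 : measurableType d1) (T2 : measurableType d2) (R : realType)
    (m1 : {measure set T1 -> \bar R}) (m2 : {measure set T2 -> \bar R})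
    (X1 a1 : T1 -> R) (X2 a2 : T2 -> R) (h : R -> R) :
  measurable_fun setT X2 -> measurable_fun setT a2 -> measurable_fun setT h ->
  (forall x, 0 <= a1 x) -> (forall x, 0 <= a2 x) ->
  (forall k : R -> R, measurable_fun setT k -> (forall x, 0 <= k x) ->
    (\int[m1]_x (k (X1 x) * a1 x)%:E = \int[m2]_x (k (X2 x) * a2 x)%:E)%E) ->
  L1 m1 (fun x => h (X1 x) * a1 x) ->
  L1 m2 (fun x => h (X2 x) * a2 x) /\
  \int[m1]_x (h (X1 x) * a1 x) = \int[m2]_x (h (X2 x) * a2 x).
Proof.
move=> mX2 ma2 mh a10 a20 E h1.
have mk (k : R -> R) : measurable_fun setT k -> measurable_fun setT (fun x => k (X2 x) * a2 x).
  by move=> ?; apply: measurable_funM => //; exact: measurableT_comp.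
have pos (k : R -> R) : measurable_fun setT k -> (forall x, 0 <= k x) ->
    L1 m1 (fun x => k (X1 x) * a1 x) ->
    L1 m2 (fun x => k (X2 x) * a2 x) /\
    \int[m1]_x (k (X1 x) * a1 x) = \int[m2]_x (k (X2 x) * a2 x).
  move=> k_meas k0 k1; split; last by rewrite /Rintegral E.
  apply: L1_ge0; [exact: mk|by move=> x; rewrite mulr_ge0|].
  by rewrite -E// -EFin_Rint// ltry.
pose p x := (`|h x| + h x) / 2; pose q x := (`|h x| - h x) / 2.
have mp : measurable_fun setT p by rewrite /p; mfun2.
have mq : measurable_fun setT q by rewrite /q; mfun2.
have p0 x : 0 <= p x by rewrite /p divr_ge0// -[X in _ + X]opprK subr_ge0 -normrN ler_norm.
have q0 x : 0 <= q x by rewrite /q divr_ge0// subr_ge0 ler_norm.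
have hE x : h x = p x - q x by rewrite /p /q; field.
have n1 := L1_norm h1.
have p1 : L1 m1 (fun x => p (X1 x) * a1 x).
  apply: eq_L1 (L1Zr 2^-1 (L1D n1 h1)) => x /=.
  by rewrite normrM (ger0_norm (a10 x)) /p; field.
have q1 : L1 m1 (fun x => q (X1 x) * a1 x).
  apply: eq_L1 (L1Zr 2^-1 (L1B n1 h1)) => x /=.
  by rewrite normrM (ger0_norm (a10 x)) /q; field.
have [p2 Ep] := pos _ mp p0 p1; have [q2 Eq] := pos _ mq q0 q1.
split.
  by apply: eq_L1 (L1B p2 q2) => x /=; rewrite hE mulrBl.
transitivity (\int[m1]_x (p (X1 x) * a1 x - q (X1 x) * a1 x)).
  by apply: eq_Rint => x; rewrite hE mulrBl.
rewrite RintB// Ep Eq -RintB//.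
by apply: eq_Rint => x; rewrite hE mulrBl.
Qed.

Section sum_transport.
#[local] Opaque transport normal_pdf convol dfun.
Variable R : realType.
Local Notation mu := (@lebesgue_measure R).
Local Notation mu2 := (mu \x mu)%E.
Variable f : R -> R.
Hypotheses (mf : measurable_fun setT f) (f0 : forall x, 0 <= f x)
  (f1 : (\int[mu]_x (f x)%:E = 1)%E).
Local Notation phi := (normal_pdf (0 : R) 1).
Local Notation T := (transport f).

Let mphi : measurable_fun setT phi. Proof. exact: measurable_normal_pdf. Qed.
Let phi0 x : 0 <= phi x. Proof. exact: normal_pdf_ge0. Qed.
Let phi1 : (\int[mu]_x (phi x)%:E = 1)%E. Proof. exact: integral_normal_pdf. Qed.
Let mT : measurable_fun setT T. Proof. exact: measurable_transport. Qed.

(* Plays the role of the derivative of the transport map. *)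
Definition dtransport x : R := phi x / f (T x).
Local Notation t := dtransport.

Lemma dtransport_ge0 x : 0 <= t x.
Proof. by rewrite divr_ge0. Qed.

Lemma measurable_dtransport : measurable_fun setT t.
Proof.
apply: measurable_funM => //; apply: (measurableT_comp (@measurable_invr R)).
exact: measurableT_comp.
Qed.

(** The left side is the integral of [h / f] composed with [T] against [phi], and it transports to
    the integral of [h / f] against [f]. Since [0^-1 = 0], the integrand becomes 0 where [f]
    vanishes and [h] elsewhere, whence an inequality. *)
Lemma integral_dtransport (h : R -> \bar R) : measurable_fun setT h ->
  (forall x, (0 <= h x)%E) ->
  (\int[mu]_x (h (T x) * (t x)%:E) <= \int[mu]_x h x)%E.
Proof.
move=> mh h0; pose k x := (h x * ((f x)^-1)%:E)%E.
have mi : measurable_fun setT (fun x => ((f x)^-1)%:E).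
  by apply/measurable_EFinP; apply: (measurableT_comp (@measurable_invr R)).
have mk : measurable_fun setT k by exact: emeasurable_funM.
have k0 x : (0 <= k x)%E by rewrite mule_ge0// lee_fin invr_ge0.
have -> : (\int[mu]_x (h (T x) * (t x)%:E) = \int[mu]_x (k (T x) * (phi x)%:E))%E.
  by apply: eq_integral => x _; rewrite /k -muleA -EFinM mulrC.
rewrite integral_transport//; apply: ge0_le_integral => //.
- by move=> x _; rewrite mule_ge0// lee_fin.
- by apply: emeasurable_funM => //; exact/measurable_EFinP.
- move=> x _; rewrite /k -muleA -EFinM.
  have [->|fx0] := eqVneq (f x) 0; first by rewrite mulr0 mule0.
  by rewrite mulVf// mule1.
Qed.

(** With the indicator of [[c, d]] for [h], the mass of [t] on a set is at most the length of any
    interval containing its image, as for the derivative of a monotone function. *)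
Lemma integral_dtransport_osc (A : set R) (c d : R) : measurable A ->
  (forall x, A x -> c <= T x <= d) -> c <= d ->
  (\int[mu]_(x in A) (t x)%:E <= (d - c)%:E)%E.
Proof.
move=> mA Acd cd; pose h x : \bar R := (\1_(`[c, d]%classic) x)%:E.
have mh : measurable_fun setT h by apply/measurable_EFinP; exact: measurable_indic.
have h0 x : (0 <= h x)%E by rewrite lee_fin.
apply: (@le_trans _ _ (\int[mu]_x h x)%E); last first.
  rewrite /h integral_indic//= setIT lebesgue_measure_itv/= lte_fin.
  by case: ifPn => // _; rewrite lee_fin subr_ge0.
apply: le_trans (integral_dtransport mh h0); rewrite integral_mkcond.
have mt := measurable_dtransport.
apply: ge0_le_integral => //.
- by move=> x _; rewrite patchE; case: ifPn => // _; rewrite lee_fin dtransport_ge0.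
- apply/(measurable_restrictT _ _).1 => //; apply: measurable_funTS; exact/measurable_EFinP.
- apply: emeasurable_funM; last exact/measurable_EFinP.
  exact: (measurableT_comp mh).
- move=> x _; rewrite patchE; case: ifPn => [|_]; last by rewrite mule_ge0// lee_fin dtransport_ge0.
  rewrite inE => Ax; rewrite /h indicE mem_set ?mul1e//=.
  by rewrite in_itv/= Acd.
Qed.

Let S w y := T (y + w) + T y.
Let s w y := t (y + w) + t y.

Let mS w : measurable_fun setT (S w).
Proof. by apply: measurable_funD; [apply: (measurableT_comp mT); mfun|exact: mT]. Qed.

Let ms w : measurable_fun setT (s w).
Proof.
apply: measurable_funD; last exact: measurable_dtransport.
by apply: (measurableT_comp measurable_dtransport); mfun.
Qed.

Let s0 w y : 0 <= s w y.
Proof. by rewrite addr_ge0// dtransport_ge0. Qed.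

(** For [y] and [y'] in [A], the mixed sum [T y + T (y' + w)] lies between the values of
    [T (y + w) + T y] at the smaller and at the larger of the two points, because both summands
    increase. Suprema and infima of the two summands over [A] can thus be taken separately, and the
    oscillations add up to at most [b - a]. *)
Lemma integral_sum_osc w (a b : R) (A : set R) : a <= b -> measurable A ->
  (forall y, A y -> a < T (y + w) + T y <= b) ->
  (\int[mu]_(y in A) (t (y + w) + t y)%:E <= (b - a)%:E)%E.
Proof.
move=> ab mA SA.
have mt := measurable_dtransport.
have [->|/set0P[y0 Ay0]] := eqVneq A set0.
  by rewrite integral_set0 lee_fin subr_ge0.
have mA' : measurable [set x | A (x - w)].
  have msub : measurable_fun setT (fun x : R => x - w) by mfun.
  by have := msub measurableT A mA; rewrite setTI.
pose U := T @` A; pose V := (fun y => T (y + w)) @` A.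
have le_b y y' : A y -> A y' -> T y + T (y' + w) <= b.
  move=> /SA/andP[_ yb] /SA/andP[_ y'b]; have [yy|/ltW yy] := leP y y'.
    by apply: le_trans y'b; rewrite addrC lerD2l (transport_homo mf f0 f1).
  by apply: le_trans yb; rewrite addrC lerD2r (transport_homo mf f0 f1)// lerD2r.
have ge_a y y' : A y -> A y' -> a <= T y + T (y' + w).
  move=> /SA/andP[/ltW ya _] /SA/andP[/ltW y'a _]; have [yy|/ltW yy] := leP y y'.
    by apply: (le_trans ya); rewrite addrC lerD2l (transport_homo mf f0 f1)// lerD2r.
  by apply: (le_trans y'a); rewrite addrC lerD2r (transport_homo mf f0 f1).
have U0 : U !=set0 by exists (T y0), y0.
have V0 : V !=set0 by exists (T (y0 + w)), y0.
have Uub : has_ubound U.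
  by exists (b - T (y0 + w)) => _ [y Ay <-]; rewrite lerBrDr le_b.
have Ulb : has_lbound U.
  by exists (a - T (y0 + w)) => _ [y Ay <-]; rewrite lerBlDr ge_a.
have Vub : has_ubound V.
  by exists (b - T y0) => _ [y Ay <-]; rewrite lerBrDl le_b.
have Vlb : has_lbound V.
  by exists (a - T y0) => _ [y Ay <-]; rewrite lerBlDl ge_a.
have sup_b : sup U + sup V <= b.
  rewrite -lerBrDl; apply: ge_sup => // _ [y Ay <-].
  rewrite lerBrDl -lerBrDr; apply: ge_sup => // _ [y' Ay' <-].
  by rewrite lerBrDr le_b.
have inf_a : a <= inf U + inf V.
  rewrite -lerBlDl; apply: lb_le_inf => // _ [y Ay <-].
  rewrite lerBlDl -lerBlDr; apply: lb_le_inf => // _ [y' Ay' <-].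
  by rewrite lerBlDr ge_a.
have mt' : measurable_fun setT (fun y : R => (t (y + w))%:E).
  by apply/measurable_EFinP; apply: (measurableT_comp mt); mfun.
have -> : (\int[mu]_(y in A) (t (y + w) + t y)%:E =
           \int[mu]_(y in A) (t (y + w))%:E + \int[mu]_(y in A) (t y)%:E)%E.
  apply: (ge0_integralD mu mA (f1 := fun y => (t (y + w))%:E) (f2 := fun y => (t y)%:E)).
  - by move=> y _; rewrite lee_fin dtransport_ge0.
  - exact: measurable_funTS mt'.
  - by move=> y _; rewrite lee_fin dtransport_ge0.
  - by apply: measurable_funTS; exact/measurable_EFinP.
have UA : (\int[mu]_(y in A) (t y)%:E <= (sup U - inf U)%:E)%E.
  apply: integral_dtransport_osc => //.
    by move=> y Ay; rewrite ub_le_sup ?ge_inf//; exists y.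
  by apply: (@le_trans _ _ (T y0)); [apply: ge_inf|apply: ub_le_sup] => //; exists y0.
have VA : (\int[mu]_(y in A) (t (y + w))%:E <= (sup V - inf V)%:E)%E.
  have E := @integral_shift_set R w (EFin \o t) A ((measurable_EFinP _ _).2 mt) (fun y => dtransport_ge0 y) mA.
  apply: (@le_trans _ _ (\int[mu]_(y in [set x | A (x - w)%R]) (t y)%:E)%E).
    by rewrite le_eqVlt; apply/orP; left; apply/eqP; exact: E.
  apply: (integral_dtransport_osc mA').
    move=> y Ay; have Vy : V (T y) by exists (y - w); [exact: Ay|rewrite subrK].
    by rewrite ub_le_sup ?ge_inf.
  have Vy0 : V (T (y0 + w)) by exists y0.
  exact: (le_trans (ge_inf Vlb Vy0) (ub_le_sup Vub Vy0)).
apply: (le_trans (leeD VA UA)); rewrite -EFinD lee_fin addrACA -opprD.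
by apply: lerB; rewrite addrC.
Qed.

Lemma integral_sum_itv w (a b : R) : a < b ->
  (\int[mu]_(y in [set y | (a < S w y <= b)%R]) (s w y)%:E <= (b - a)%:E)%E.
Proof.
move=> ab; apply: (integral_sum_osc (ltW ab)) => //.
rewrite (_ : [set y | _] = S w @^-1` `]a, b]); last by apply/seteqP; split => y /=; rewrite in_itv.
by rewrite -[X in measurable X]setTI; exact: mS.
Qed.

Let mS' w : measurable_fun setT (S w : measurableTypeR R -> measurableTypeR R).
Proof. exact: mS. Qed.

(** By the interval estimate, the image under [S w] of the measure with density [s w] is at most
    Lebesgue measure on half-open intervals, hence on measurable sets, hence for integrals. *)
Lemma integral_sum_transport w (h : R -> \bar R) : measurable_fun setT h ->
  (forall x, (0 <= h x)%E) ->
  (\int[mu]_y (h (T (y + w) + T y)%R * (t (y + w) + t y)%:E) <= \int[mu]_x h x)%E.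
Proof.
move=> mh h0.
pose P : {measure set (measurableTypeR R) -> \bar R} := density_measure mu (ms w) (s0 w).
have mhS : measurable_fun setT (h \o S w) by exact: measurableT_comp.
have E1 := integral_density_measure mu (ms w) (s0 w) mhS (fun x => h0 _).
pose S' : measurableTypeR R -> measurableTypeR R := S w.
have E := @ge0_integral_pushforward _ _ (measurableTypeR R) (measurableTypeR R) R S' (mS' w) P setT h measurableT mh (fun x _ => h0 x).
rewrite [in RHS]preimage_setT in E.
apply: (@le_trans _ _ (\int[pushforward P S']_x h x)%E).
  by rewrite le_eqVlt; apply/orP; left; apply/eqP; exact: (etrans (esym E1) (esym E)).
apply: (@ge0_le_measure_integral _ (measurableTypeR R) R (pushforward P S') mu) => //.
  exact: mS'.
have /(_ (mS' w)) dom := @measure_le_lebesgue R (pushforward P S').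
move=> mm; apply: dom => a b ab.
apply: le_trans (integral_sum_itv w ab).
rewrite /pushforward/= le_eqVlt; apply/orP; left; apply/eqP; congr (integral _ _ _).
Qed.

End sum_transport.

(** * The entropy power inequality *)

Section almost_everywhere_and.
Context d (T : measurableType d) (R : realType) (m : {measure set T -> \bar R}).

Lemma ae_and (P Q : T -> Prop) : {ae m, forall x, P x} -> {ae m, forall x, Q x} ->
  {ae m, forall x, P x /\ Q x}.
Proof. by move=> HP HQ; apply: filterS2 HP HQ. Qed.

Lemma ae_imp (P Q : T -> Prop) : (forall x, P x -> Q x) -> {ae m, forall x, P x} ->
  {ae m, forall x, Q x}.
Proof. by move=> PQ; exact: filterS. Qed.

End almost_everywhere_and.

(** * Logarithms and Gaussian densities *)

Section logarithm.
Variable R : realType.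
Implicit Type x : R.

Lemma ln_le_sub1 x : 0 < x -> ln x <= x - 1.
Proof.
move=> x0; have := @le_ln1Dx R (x - 1); rewrite [1 + _]addrC subrK; apply.
by rewrite ltrBrDl subrr.
Qed.

Lemma ln_sub1_eq x : 0 < x -> x - 1 <= ln x -> x = 1.
Proof.
move=> x0 H; have [//|x1] := eqVneq x 1.
have l0 : ln x != 0 by rewrite ln_eq0.
by have := expR_gt1Dx l0; rewrite lnK ?posrE// => H2; lra.
Qed.

End logarithm.

Section gaussian_moments.
Variable R : realType.
Local Notation mu := (@lebesgue_measure R).

Lemma L1_normal (m s : R) : L1 mu (normal_pdf m s).
Proof. exact: integrable_normal_pdf. Qed.

Lemma Rint_normal (m s : R) : \int[mu]_x normal_pdf m s x = 1.
Proof. by apply: EFin_inj; rewrite EFin_Rint ?integral_normal_pdf//; exact: L1_normal. Qed.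

Lemma normal_pdf_expE (m s x : R) : s != 0 ->
  normal_pdf m s x = normal_peak s * expR (- (x - m) ^+ 2 / (s ^+ 2 * 2)).
Proof. by move=> s0; rewrite normal_pdfE// /normal_fun mulr_natr. Qed.

Lemma normal_pdf_gt0 (m s x : R) : s != 0 -> 0 < normal_pdf m s x.
Proof. by move=> s0; rewrite normal_pdf_expE// mulr_gt0 ?expR_gt0// normal_peak_gt0. Qed.

Lemma ln_normal_pdf (m s x : R) : s != 0 ->
  ln (normal_pdf m s x) = ln (normal_peak s) - (x - m) ^+ 2 / (s ^+ 2 * 2).
Proof.
move=> s0; rewrite normal_pdf_expE// lnM ?posrE ?expR_gt0 ?normal_peak_gt0//.
by rewrite expRK mulNr.
Qed.

Lemma pow_le_expR (k : nat) (c x : R) : 0 < c ->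
  x ^+ (2 * k) <= k`!%:R * c^-1 ^+ k * expR (c * x ^+ 2).
Proof.
move=> c0; case: k => [|k].
  rewrite muln0 !expr0 fact0 !mul1r -[leLHS]expR0 ler_expR.
  by rewrite mulr_ge0 ?sqr_ge0// ltW.
have y0 : 0 <= c * x ^+ 2 by rewrite mulr_ge0 ?sqr_ge0// ltW.
have := expR_ge1Dxn k y0 => /(le_trans _) H.
have {}H : (c * x ^+ 2) ^+ k.+1 / k.+1`!%:R <= expR (c * x ^+ 2).
  by apply: H; rewrite lerDr.
rewrite ler_pdivrMr ?ltr0n ?fact_gt0// in H.
rewrite exprMn -exprM mulrC in H.
rewrite -(@ler_pM2r _ (c ^+ k.+1)) ?exprn_gt0//; apply: (le_trans H).
rewrite exprVn (_ : _ * c ^+ k.+1 = expR (c * x ^+ 2) * k.+1`!%:R)//.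
by rewrite mulrAC mulfVK ?expf_neq0 ?gt_eqF// mulrC.
Qed.

Lemma L1_pow_normal (k : nat) (s : R) : 0 < s ->
  L1 mu (fun x => x ^+ (2 * k) * normal_pdf 0 s x).
Proof.
(* Doubling the variance gives up half of the Gaussian exponent, which pays for the power of [x];
   [c] is the coefficient released. *)
move=> s0; pose s' := s * Num.sqrt 2.
have s'0 : 0 < s' by rewrite mulr_gt0// sqrtr_gt0.
pose c := (s ^+ 2 * 4)^-1.
have c0 : 0 < c by rewrite invr_gt0 mulr_gt0// exprn_gt0.
pose C := k`!%:R * c^-1 ^+ k * normal_peak s / normal_peak s'.
apply: L1_le (L1Z C (L1_normal 0 s')).
  by apply: measurable_funM; [mfun|exact: measurable_normal_pdf].
move=> x; rewrite ger0_norm; last by rewrite mulr_ge0 ?normal_pdf_ge0// exprM exprn_ge0// sqr_ge0.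
rewrite !normal_pdf_expE ?gt_eqF// !subr0.
have p'0 := normal_peak_gt0 (lt0r_neq0 s'0).
have -> : C * (normal_peak s' * expR (- x ^+ 2 / (s' ^+ 2 * 2))) =
    normal_peak s * (k`!%:R * c^-1 ^+ k * (expR (c * x ^+ 2) * expR (- x ^+ 2 / (s ^+ 2 * 2)))).
  rewrite -expRD (_ : c * x ^+ 2 + _ = - x ^+ 2 / (s' ^+ 2 * 2)); last first.
    rewrite /c /s' exprMn sqr_sqrtr//; field.
    by rewrite gt_eqF.
  by rewrite /C; field; rewrite gt_eqF.
rewrite mulrCA ler_pM2l ?normal_peak_gt0 ?gt_eqF// mulrA ler_pM2r ?expR_gt0//.
exact: pow_le_expR.
Qed.

Lemma L1_id_normal (s : R) : 0 < s -> L1 mu (fun x => x * normal_pdf 0 s x).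
Proof.
move=> s0; apply: L1_le (L1D (L1_normal 0 s) (L1_pow_normal 1 s0)).
  by apply: measurable_funM; [exact: measurable_id|exact: measurable_normal_pdf].
move=> x; rewrite normrM (ger0_norm (normal_pdf_ge0 _ _ _)) muln1 -[X in _ <= X + _]mul1r -mulrDl.
apply: ler_wpM2r; first exact: normal_pdf_ge0.
rewrite -(real_normK (num_real x)); have := sqr_ge0 (`|x| - 1); have := normr_ge0 x.
by move: (`|x|) => u *; nra.
Qed.

Lemma normal_pdf_sym (s x : R) : s != 0 -> normal_pdf 0 s (- x) = normal_pdf 0 s x.
Proof. by move=> s0; rewrite !normal_pdf_expE// !subr0 sqrrN. Qed.

Lemma Rint_id_normal (s : R) : 0 < s -> \int[mu]_x (x * normal_pdf 0 s x) = 0.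
Proof.
move=> s0; have H := Rint_reflect 0 (L1_id_normal s0).
have : \int[mu]_x (x * normal_pdf 0 s x) = - \int[mu]_x (x * normal_pdf 0 s x).
  rewrite -[LHS]H -RintN; last exact: L1_id_normal.
  by apply: eq_Rint => x; rewrite sub0r normal_pdf_sym ?gt_eqF// mulNr.
by move: (\int[mu]_x _) => I HI; lra.
Qed.


End gaussian_moments.

Section gaussian_rotation.
Variable R : realType.
Local Notation phi := (normal_pdf (0 : R) 1).
Local Notation r2 := (Num.sqrt (2 : R)).
Local Notation psi := (normal_pdf (0 : R) r2).

Let r20 : 0 < r2. Proof. by rewrite sqrtr_gt0. Qed.

Lemma normal_peak_sqrt2 : normal_peak r2 = normal_peak 1 / r2.
Proof.
rewrite /normal_peak sqr_sqrtr// expr1n mul1r -mulrnAr sqrtrM//.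
by rewrite invfM mulrC.
Qed.

(** The sum and the difference of two independent standard normals are independent of variance 2;
    the factor 2 is the Jacobian of [(x, y) |-> (x + y, y - x)]. *)
Lemma normal_rotation (x y : R) : phi x * phi y = 2 * psi (x + y) * psi (y - x).
Proof.
rewrite !normal_pdf_expE ?oner_eq0 ?(gt_eqF r20)// !subr0 sqr_sqrtr// expr1n mul1r.
rewrite normal_peak_sqrt2.
have -> : 2 * (normal_peak 1 / r2 * expR (- (x + y) ^+ 2 / (2 * 2))) * (normal_peak 1 / r2 * expR (- (y - x) ^+ 2 / (2 * 2))) =
   (2 / (r2 ^+ 2)) * (normal_peak 1 * normal_peak 1) * (expR (- (x + y) ^+ 2 / (2 * 2)) * expR (- (y - x) ^+ 2 / (2 * 2))).
  by field; rewrite gt_eqF.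
rewrite sqr_sqrtr// divff// mul1r -expRD mulrACA -expRD; congr (_ * expR _).
by field.
Qed.

Lemma am_gm_ln (u v : R) : 0 < u -> 0 < v ->
  0 <= ln (u + v) - ln 2 - 2^-1 * ln u - 2^-1 * ln v.
Proof.
move=> u0 v0; have uv0 : 0 < u + v by rewrite addr_gt0.
have : ln (u * v) <= ln (((u + v) / 2) ^+ 2).
  rewrite ler_ln ?posrE ?mulr_gt0 ?exprn_gt0 ?divr_gt0//.
  by have := sqr_ge0 (u - v); nra.
rewrite lnM ?posrE// lnXn ?divr_gt0// ln_div ?posrE//.
by move: (ln _) (ln _) (ln _) (ln _) => a b c d; lra.
Qed.

Lemma ln_sqrt2 : ln r2 = 2^-1 * ln 2.
Proof.
have : ln (r2 ^+ 2) = ln 2 by rewrite sqr_sqrtr.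
by rewrite lnXn// mulr2n; move: (ln r2) (ln 2) => a b; lra.
Qed.

(** [c] stands for the density of the sum at [T x + T y], [a] and [b] for [f] at [T x] and [T y].
    With [q] the quotient of [K] by [phi x * phi y], dividing [d] by the same product leaves
    [q - 1 - ln q] plus the arithmetic-geometric defect of [phi x / a] and [phi y / b]. The squares
    in the Gaussian exponents cancel down to the cross term [x * y / 2], and [q - 1 <= ln q] forces
    [q = 1]. *)
Lemma epi_pointwise (x y c a b : R) : 0 < c -> 0 < a -> 0 < b ->
  let K := c * (phi x / a + phi y / b) * psi (y - x) in
  let d := K - phi x * phi y -
    (ln c * (phi x * phi y) - 2^-1 * ((ln a * phi x) * phi y)
     - 2^-1 * (phi x * (ln b * phi y)) + 2^-1 * ((x * phi x) * (y * phi y))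
     + (2^-1 * ln 2) * (phi x * phi y)) in
  0 <= d /\ (d <= 0 -> K = phi x * phi y).
Proof.
move=> c0 a0 b0 K d.
have px : 0 < phi x by apply: normal_pdf_gt0; exact: oner_neq0.
have py : 0 < phi y by apply: normal_pdf_gt0; exact: oner_neq0.
have ps : 0 < psi (x + y) by apply: normal_pdf_gt0; rewrite gt_eqF.
have lpk : ln (normal_peak r2) = ln (normal_peak 1) - 2^-1 * ln 2.
  rewrite -ln_sqrt2 -ln_div ?posrE ?normal_peak_gt0 ?oner_eq0//; congr ln.
  by rewrite normal_peak_sqrt2.
have lp u : ln (phi u) = ln (normal_peak 1) - u ^+ 2 / 2.
  by rewrite ln_normal_pdf ?oner_eq0// subr0 expr1n mul1r.
have ls : ln (psi (x + y)) = ln (normal_peak 1) - 2^-1 * ln 2 - (x + y) ^+ 2 / 4.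
  rewrite ln_normal_pdf ?(gt_eqF r20)// subr0 sqr_sqrtr// lpk.
  by congr (_ - _ / _); rewrite -natrM.
pose u := phi x / a; pose v := phi y / b.
have u0 : 0 < u by rewrite divr_gt0.
have v0 : 0 < v by rewrite divr_gt0.
have uv0 : 0 < u + v by rewrite addr_gt0.
have lu : ln u = ln (normal_peak 1) - x ^+ 2 / 2 - ln a by rewrite ln_div ?posrE// lp.
have lv : ln v = ln (normal_peak 1) - y ^+ 2 / 2 - ln b by rewrite ln_div ?posrE// lp.
pose q := c * (u + v) / (2 * psi (x + y)).
have q0 : 0 < q by rewrite divr_gt0// mulr_gt0.
have rE : K = q * (phi x * phi y).
  rewrite /K normal_rotation /q -/u -/v; field.
  by rewrite gt_eqF.
have e0 := am_gm_ln u0 v0.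
have lq : ln q = ln c + ln (u + v) - ln 2 - ln (psi (x + y)).
  rewrite /q ln_div ?posrE ?mulr_gt0// lnM ?posrE// [ln (2 * _)]lnM ?posrE//.
  by rewrite opprD addrA.
have dE : d = (phi x * phi y) * (q - 1 - ln q + (ln (u + v) - ln 2 - 2^-1 * ln u - 2^-1 * ln v)).
  rewrite /d rE lq lu lv ls.
  by move: (ln c) (ln (u + v)) (ln 2) (ln a) (ln b) (ln (normal_peak 1)) (phi x) (phi y) (q) => *; field.
have pp : 0 < phi x * phi y by rewrite mulr_gt0.
have lnq := ln_le_sub1 q0.
rewrite dE; split.
  apply: mulr_ge0; first exact: ltW.
  by apply: addr_ge0 => //; rewrite subr_ge0.
rewrite pmulr_rle0// => H; rewrite rE (@ln_sub1_eq _ q)// ?mul1r//.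
by move: H e0; move: (ln q) (ln _ - _ - _ - _) => L E; lra.
Qed.

End gaussian_rotation.

Section epi.
#[local] Opaque transport dtransport normal_pdf convol dfun.
Variable R : realType.
Local Notation mu := (@lebesgue_measure R).
Local Notation mu2 := (mu \x mu)%E.
Variable f : R -> R.
Hypotheses (mf : measurable_fun setT f) (f0 : forall x, 0 <= f x)
  (f1 : (\int[mu]_x (f x)%:E = 1)%E).
Local Notation phi := (normal_pdf (0 : R) 1).
Local Notation T := (transport f).
Local Notation t := (dtransport f).
Local Notation g := (convol f f).

Let mphi : measurable_fun setT phi. Proof. exact: measurable_normal_pdf. Qed.
Let phi0 x : 0 <= phi x. Proof. exact: normal_pdf_ge0. Qed.
Let phi_gt0 x : 0 < phi x. Proof. by apply: normal_pdf_gt0; exact: oner_neq0. Qed.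
Let mT : measurable_fun setT T. Proof. exact: measurable_transport. Qed.
Let mt : measurable_fun setT t. Proof. exact: measurable_dtransport. Qed.
Let t0 x : 0 <= t x. Proof. exact: dtransport_ge0. Qed.
Let f_L1 : L1 mu f. Proof. by apply: L1_ge0 => //; rewrite f1 ltry. Qed.
Let g0 x : 0 <= g x. Proof. exact: convol_ge0. Qed.
Let mg : measurable_fun setT g. Proof. exact: measurable_convol. Qed.
Let g1 : (\int[mu]_x (g x)%:E = 1)%E.
Proof.
rewrite -EFin_Rint; last exact: L1_convol.
by rewrite Rint_convol// /Rintegral f1 mulr1.
Qed.

Lemma transport_weight1 (k : R -> R) : measurable_fun setT k -> (forall x, 0 <= k x) ->
  (\int[mu]_x (k x * f x)%:E = \int[mu]_x (k (T x) * phi x)%:E)%E.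
Proof.
move=> mk k0; apply/esym.
apply: (@integral_transport R f mf f0 f1 (EFin \o k)) => //.
exact/measurable_EFinP.
Qed.

Let mT2 : measurable_fun setT (fun z : R * R => T z.1 + T z.2).
Proof. by apply: measurable_funD; exact: measurableT_comp. Qed.

Let mphi2 : measurable_fun setT (fun z : R * R => phi z.1 * phi z.2).
Proof. by apply: measurable_funM; exact: measurableT_comp. Qed.

Lemma transport_weight2 (k : R -> R) : measurable_fun setT k -> (forall x, 0 <= k x) ->
  (\int[mu]_x (k x * g x)%:E =
   \int[mu]_x \int[mu]_y (k (T x + T y)%R * (phi x * phi y))%:E)%E.
Proof.
move=> mk k0; rewrite (ge0_integral_convol f_L1 f_L1 mk f0 f0 k0).
have mH : measurable_fun setT (fun z : R * R => k (z.1 + T z.2) * (f z.1 * phi z.2)).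
  apply: measurable_funM.
    by apply: (measurableT_comp mk); apply: measurable_funD => //; exact: measurableT_comp.
  by apply: measurable_funM; exact: measurableT_comp.
have mH2 : measurable_fun setT (fun z : R * R => k (T z.1 + T z.2) * (phi z.1 * phi z.2)).
  by apply: measurable_funM => //; exact: measurableT_comp.
have mkx (x : R) : measurable_fun setT (fun y : R => k (x + y) * f x).
  by apply: measurable_funM; [apply: (measurableT_comp mk); mfun|exact: measurable_cst].
have mky (y : R) : measurable_fun setT (fun x : R => k (x + T y) * phi y).
  by apply: measurable_funM; [apply: (measurableT_comp mk); mfun|exact: measurable_cst].
transitivity (\int[mu]_x \int[mu]_y (k (x + T y)%R * (f x * phi y))%:E)%E.
  apply: eq_integral => x _.
  transitivity (\int[mu]_y ((k (x + y)%R * f x) * f y)%:E)%E.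
    by apply: eq_integral => y _; rewrite mulrA.
  rewrite (transport_weight1 (mkx x)) => [|y]; last by rewrite mulr_ge0.
  by apply: eq_integral => y _; rewrite mulrA.
have -> := tonelli mH (fun z => mulr_ge0 (k0 _) (mulr_ge0 (f0 _) (phi0 _))).
have -> := tonelli mH2 (fun z => mulr_ge0 (k0 _) (mulr_ge0 (phi0 _) (phi0 _))).
apply: eq_integral => y _.
transitivity (\int[mu]_x ((k (x + T y)%R * phi y) * f x)%:E)%E.
  by apply: eq_integral => x _ /=; rewrite -mulrA [phi _ * _]mulrC.
rewrite (transport_weight1 (mky y)) => [|x]; last by rewrite mulr_ge0.
by apply: eq_integral => x _ /=; rewrite -mulrA [phi _ * _]mulrC.
Qed.

Lemma transport_L1 (h : R -> R) : measurable_fun setT h -> L1 mu (fun x => h x * f x) ->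
  L1 mu (fun x => h (T x) * phi x) /\
  \int[mu]_x (h x * f x) = \int[mu]_x (h (T x) * phi x).
Proof.
move=> mh; apply: (@L1_transfer _ _ _ _ R mu mu id f T phi h) => //.
exact: transport_weight1.
Qed.

Lemma transport_L12 (h : R -> R) : measurable_fun setT h -> L1 mu (fun x => h x * g x) ->
  L1 mu2 (fun z => h (T z.1 + T z.2) * (phi z.1 * phi z.2)) /\
  \int[mu]_x (h x * g x) = \int[mu2]_z (h (T z.1 + T z.2) * (phi z.1 * phi z.2)).
Proof.
move=> mh; apply: (@L1_transfer _ _ _ _ R mu mu2 id g (fun z => T z.1 + T z.2) (fun z => phi z.1 * phi z.2) h).
- exact: mT2.
- exact: mphi2.
- exact: mh.
- exact: g0.
- by move=> z; rewrite mulr_ge0.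
- move=> k mk k0; rewrite transport_weight2//.
  have mH2 : measurable_fun setT (fun z : R * R => k (T z.1 + T z.2) * (phi z.1 * phi z.2)).
    by apply: measurable_funM => //; exact: measurableT_comp.
  by have := plane_tonelli1 mH2 (fun z => mulr_ge0 (k0 _) (mulr_ge0 (phi0 _) (phi0 _))).
Qed.

(** The law [f] gives no mass to its own zero set, and [T] carries the normal law to [f]; as [phi]
    is positive, the preimage of the zero set is null. *)
Lemma ae_transport1 : {ae mu2, forall z, 0 < f (T z.1)}.
Proof.
pose N := f @^-1` [set 0]; pose k : R -> R := \1_N.
have mN : measurable N by rewrite -[X in measurable X]setTI; exact: mf.
have mk : measurable_fun setT k by exact: measurable_indic.
have kf x : k x * f x = 0.
  by rewrite /k indicE; case: (boolP (x \in N)) => [|_]; rewrite ?mul0r// inE => ->; rewrite mulr0.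
have [k1] : L1 mu (fun x => k (T x) * phi x) /\ \int[mu]_x (k x * f x) = \int[mu]_x (k (T x) * phi x).
  by apply: (transport_L1 mk); apply: eq_L1 (L1_0 mu) => x; rewrite kf.
rewrite (eq_Rint mu kf) => /esym Ek.
have L2 := L1_prodM k1 (L1_normal 0 1).
have E2 := Rint_prodM k1 (L1_normal 0 1).
apply: filterS (Rint_eq0 L2 _ _).
- move=> z /= /eqP; rewrite !mulf_eq0 !(gt_eqF (phi_gt0 _)) !orbF /k indicE => H.
  rewrite lt_def f0 andbT; apply/eqP => fz.
  by move: H; rewrite mem_set//= oner_eq0.
- by apply: aeW => z; rewrite !mulr_ge0.
- by rewrite E2 Ek (_ : \int[mu]_x (fun=> 0) x = 0) ?mul0r// /Rintegral integral0.
Qed.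

Lemma ae_transport2 : {ae mu2, forall z, 0 < f (T z.2)}.
Proof.
pose N := f @^-1` [set 0]; pose k : R -> R := \1_N.
have mN : measurable N by rewrite -[X in measurable X]setTI; exact: mf.
have mk : measurable_fun setT k by exact: measurable_indic.
have kf x : k x * f x = 0.
  by rewrite /k indicE; case: (boolP (x \in N)) => [|_]; rewrite ?mul0r// inE => ->; rewrite mulr0.
have [k1] : L1 mu (fun x => k (T x) * phi x) /\ \int[mu]_x (k x * f x) = \int[mu]_x (k (T x) * phi x).
  by apply: (transport_L1 mk); apply: eq_L1 (L1_0 mu) => x; rewrite kf.
rewrite (eq_Rint mu kf) => /esym Ek.
have L2 := L1_prodM (L1_normal 0 1) k1.
have E2 := Rint_prodM (L1_normal 0 1) k1.
apply: filterS (Rint_eq0 L2 _ _).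
- move=> z /= /eqP; rewrite !mulf_eq0 !(gt_eqF (phi_gt0 _)) !orbF /k indicE => H.
  rewrite lt_def f0 andbT; apply/eqP => fz.
  by move: H; rewrite mem_set//= oner_eq0.
- by apply: aeW => z; rewrite !mulr_ge0.
- by rewrite E2 Ek (_ : \int[mu]_x (fun=> 0) x = 0) ?mulr0// /Rintegral integral0.
Qed.

Lemma ae_transport12 : {ae mu2, forall z, 0 < g (T z.1 + T z.2)}.
Proof.
pose N := g @^-1` [set 0]; pose k : R -> R := \1_N.
have mN : measurable N by rewrite -[X in measurable X]setTI; exact: mg.
have mk : measurable_fun setT k by exact: measurable_indic.
have kf x : k x * g x = 0.
  by rewrite /k indicE; case: (boolP (x \in N)) => [|_]; rewrite ?mul0r// inE => ->; rewrite mulr0.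
have k1 : L1 mu (fun x => k x * g x) by apply: eq_L1 (L1_0 mu) => x; rewrite kf.
have {k1}[k1 Ek] := transport_L12 mk k1.
apply: filterS (Rint_eq0 k1 _ _).
- move=> z /= /eqP; rewrite !mulf_eq0 !(gt_eqF (phi_gt0 _)) !orbF /k indicE => H.
  rewrite lt_def g0 andbT; apply/eqP => fz.
  by move: H; rewrite mem_set//= oner_eq0.
- by apply: aeW => z; rewrite !mulr_ge0.
- by rewrite -Ek (eq_Rint mu kf) /Rintegral integral0.
Qed.

Local Notation r2 := (Num.sqrt (2 : R)).
Local Notation psi := (normal_pdf (0 : R) r2).
Let r20 : 0 < r2. Proof. by rewrite sqrtr_gt0. Qed.
Let psi_gt0 x : 0 < psi x. Proof. by apply: normal_pdf_gt0; rewrite gt_eqF. Qed.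

(** The formal pull-back of the product density of [g] and [psi] under
    [(x, y) |-> (T x + T y, y - x)]; [t z.1 + t z.2] plays the Jacobian. *)
Definition sum_density_ratio (z : R * R) : R :=
  g (T z.1 + T z.2) * (t z.1 + t z.2) * psi (z.2 - z.1).

Let mK : measurable_fun setT sum_density_ratio.
Proof.
apply: measurable_funM; last by apply: (measurableT_comp (measurable_normal_pdf _ _)); mfun.
apply: measurable_funM; first exact: (measurableT_comp mg).
by apply: measurable_funD; exact: measurableT_comp.
Qed.

Let K0 z : 0 <= sum_density_ratio z.
Proof. by rewrite !mulr_ge0// ?addr_ge0// ltW. Qed.

(** In the coordinates [x] and [w = y - x] the factor [psi w] is constant on each slice, where
    [integral_sum_transport] bounds the rest by the mass of [g]; finally [psi] has mass 1. *)
Lemma L1_sum_density_ratio : L1 mu2 sum_density_ratio /\ \int[mu2]_z sum_density_ratio z <= 1.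
Proof.
have pt (w x : R) : sum_density_ratio (x, x + w) = psi w * (g (T (x + w) + T x) * (t (x + w) + t x)).
  rewrite /sum_density_ratio/= (_ : x + w - x = w); last by rewrite addrC addKr.
  by rewrite mulrC [T x + _]addrC [t x + _]addrC.
have le1 : (\int[mu]_x \int[mu]_y (sum_density_ratio (x, y))%:E <= 1)%E.
  rewrite (tonelli_shear mK K0) -[leRHS](@integral_normal_pdf R 0 r2).
  have mKs : measurable_fun setT (fun z : R * R => sum_density_ratio (z.1, z.1 + z.2)).
    by apply: (measurableT_comp mK); apply: measurable_fun_pair => //; mfun.
  apply: ge0_le_integral => //.
  - by move=> w _; apply: integral_ge0 => x _; rewrite lee_fin.
  - exact: (plane_measurable_int1 mKs (fun z => K0 _)).
  - by apply/measurable_EFinP; exact: measurable_normal_pdf.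
  - move=> w _.
    have E : (\int[mu]_x (sum_density_ratio (x, x + w)%R)%:E =
        \int[mu]_x ((psi w)%:E * ((g (T (x + w) + T x))%:E * (t (x + w) + t x)%:E)))%E.
      by apply: eq_integral => x _; rewrite -!EFinM; congr EFin; exact: pt.
    rewrite E ge0_integralZl_EFin; last 4 first.
    + exact: measurableT.
    + by move=> x _; rewrite mule_ge0// lee_fin// addr_ge0.
    + rewrite -[X in measurable_fun _ X]/(fun x : R => ((g (T (x + w) + T x))%:E * (t (x + w) + t x)%:E)%E).
      apply/measurable_EFinP; apply: measurable_funM.
        apply: (measurableT_comp mg); apply: measurable_funD; last exact: mT.
        by apply: (measurableT_comp mT); mfun.
      by apply: measurable_funD; [apply: (measurableT_comp mt); mfun|exact: mt].
    + exact: normal_pdf_ge0.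
    rewrite -[leRHS]mule1 -g1; apply: lee_wpmul2l; first by rewrite lee_fin normal_pdf_ge0.
    apply: (@integral_sum_transport R f mf f0 f1 w (EFin \o g)); first exact/measurable_EFinP.
    by move=> x; rewrite lee_fin.
have K1 : L1 mu2 sum_density_ratio.
  apply: (L1_plane12 mK).
  under eq_integral do under eq_integral do rewrite (ger0_norm (K0 _)).
  by apply: (le_lt_trans le1); rewrite ltry.
split => //; rewrite -lee_fin EFin_Rint//.
by have := plane_tonelli1 mK K0 => <-.
Qed.


Hypotheses (fent : entropy_finite f) (gent : entropy_finite g).

Let fent1 : L1 mu (fun x => ln (f x) * f x).
Proof. by apply: eq_L1 fent => x; rewrite mulrC. Qed.

Let gent1 : L1 mu (fun x => ln (g x) * g x).
Proof. by apply: eq_L1 gent => x; rewrite mulrC. Qed.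

Let mlf : measurable_fun setT (fun x => ln (f x)).
Proof. exact: (measurableT_comp (@measurable_ln R)). Qed.

Let mlg : measurable_fun setT (fun x => ln (g x)).
Proof. exact: (measurableT_comp (@measurable_ln R)). Qed.

Let entropyE (h : R -> R) : entropy h = - \int[mu]_x (ln (h x) * h x).
Proof. by congr (- _); apply: eq_Rint => x; rewrite mulrC. Qed.

(* The integrand of the deficit: [ratio - 1 - ln ratio] plus the defect of the
   arithmetic-geometric inequality, both weighted by the Gaussian. *)
Definition epi_defect (z : R * R) : R :=
  sum_density_ratio z - phi z.1 * phi z.2 -
  (ln (g (T z.1 + T z.2)) * (phi z.1 * phi z.2)
   - 2^-1 * ((ln (f (T z.1)) * phi z.1) * phi z.2)
   - 2^-1 * (phi z.1 * (ln (f (T z.2)) * phi z.2))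
   + 2^-1 * ((z.1 * phi z.1) * (z.2 * phi z.2))
   + (2^-1 * ln 2) * (phi z.1 * phi z.2)).

Let A1 := (transport_L12 mlg gent1).1.
Let A2 := L1_prodM (transport_L1 mlf fent1).1 (L1_normal 0 1).
Let A3 := L1_prodM (L1_normal 0 1) (transport_L1 mlf fent1).1.
Let A4 := L1_prodM (L1_id_normal (@ltr01 R)) (L1_id_normal (@ltr01 R)).
Let A5 := L1_prodM (L1_normal (0 : R) 1) (L1_normal (0 : R) 1).

Lemma L1_epi_defect : L1 mu2 epi_defect.
Proof.
apply: L1B; first by apply: L1B; [exact: L1_sum_density_ratio.1|exact: A5].
apply: L1D; last exact: (L1Z _ A5).
apply: L1D; last exact: (L1Z _ A4).
apply: L1B; last exact: (L1Z _ A3).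
by apply: L1B; [exact: A1|exact: (L1Z _ A2)].
Qed.

(** The only inequality is that [sum_density_ratio] has integral at most 1. The cross term drops out
    because the normal law is centred, and the logarithmic terms become entropies by transport. *)
Lemma Rint_epi_defect :
  \int[mu2]_z epi_defect z <= entropy g - entropy f - 2^-1 * ln 2.
Proof.
have [K1 Kle] := L1_sum_density_ratio.
rewrite /epi_defect RintB; last 2 first.
- by apply: L1B; [exact: K1|exact: A5].
- apply: L1D; last exact: (L1Z _ A5).
  apply: L1D; last exact: (L1Z _ A4).
  apply: L1B; last exact: (L1Z _ A3).
  by apply: L1B; [exact: A1|exact: (L1Z _ A2)].
rewrite (RintB K1 A5).
rewrite (RintD (L1D (L1B (L1B A1 (L1Z 2^-1 A2)) (L1Z 2^-1 A3)) (L1Z 2^-1 A4)) (L1Z (2^-1 * ln 2) A5)).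
rewrite (RintD (L1B (L1B A1 (L1Z 2^-1 A2)) (L1Z 2^-1 A3)) (L1Z 2^-1 A4)).
rewrite (RintB (L1B A1 (L1Z 2^-1 A2)) (L1Z 2^-1 A3)) (RintB A1 (L1Z 2^-1 A2)).
rewrite (RintZ _ A2) (RintZ _ A3) (RintZ _ A4) (RintZ _ A5).
rewrite (Rint_prodM (transport_L1 mlf fent1).1 (L1_normal 0 1)).
rewrite (Rint_prodM (L1_normal 0 1) (transport_L1 mlf fent1).1).
rewrite (Rint_prodM (L1_id_normal (@ltr01 R)) (L1_id_normal (@ltr01 R))).
rewrite (Rint_prodM (L1_normal (0 : R) 1) (L1_normal (0 : R) 1)).
rewrite !Rint_normal Rint_id_normal// -(transport_L12 mlg gent1).2 -(transport_L1 mlf fent1).2.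
rewrite !entropyE; move: Kle.
move: (\int[mu2]_z _) (\int[mu]_x _) (\int[mu]_x _) => a b c ale; lra.
Qed.

Lemma ae_epi_defect : {ae mu2, forall z,
  0 <= epi_defect z /\ (epi_defect z <= 0 -> sum_density_ratio z = phi z.1 * phi z.2)}.
Proof.
apply: ae_imp (ae_and ae_transport1 (ae_and ae_transport2 ae_transport12)).
move=> [x y] /= [fx [fy gxy]].
have [H1 H2] := epi_pointwise x y gxy fx fy.
by split; [exact: H1|exact: H2].
Qed.

Theorem entropy_power_inequality : entropy f + 2^-1 * ln 2 <= entropy g.
Proof.
have d0 : {ae mu2, forall z, 0 <= epi_defect z} by apply: ae_imp ae_epi_defect => z [].
have := Rint_ae_ge0 L1_epi_defect d0; have := Rint_epi_defect.
by move: (\int[mu2]_z _) (entropy g) (entropy f) (ln 2) => a b c d; lra.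
Qed.

Lemma epi_equality : entropy g <= entropy f + 2^-1 * ln 2 ->
  {ae mu2, forall z, sum_density_ratio z = phi z.1 * phi z.2}.
Proof.
move=> gf; have d0 : {ae mu2, forall z, 0 <= epi_defect z} by apply: ae_imp ae_epi_defect => z [].
have i0 : \int[mu2]_z epi_defect z <= 0.
  have := Rint_epi_defect; move: gf.
  by move: (\int[mu2]_z _) (entropy g) (entropy f) (ln 2) => a b c d; lra.
apply: ae_imp (ae_and ae_epi_defect (Rint_eq0 L1_epi_defect d0 i0)).
by move=> z [[_ H] d00]; apply: H; rewrite d00.
Qed.

End epi.

(** * The equality case *)

Lemma ratio_between (R : realType) (l u : R) : 0 <= l -> l < u ->
  exists m n : nat, [/\ (0 < m)%N, (0 < n)%N, l < m%:R / n%:R & m%:R / n%:R < u].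
Proof.
move=> l0 lu; have [q] := rat_in_itvoo lu; rewrite in_itv/= => /andP[q1 q2].
have q0 : 0 < q by rewrite -(@ltr0q R) (le_lt_trans l0).
have qE : ratr q = `|numq q|%:R / `|denq q|%:R :> R.
  by rewrite /ratr !natr_absz !gtr0_norm ?denq_gt0 ?numq_gt0.
exists `|numq q|%N, `|denq q|%N; rewrite -qE; split => //.
  by rewrite absz_gt0 numq_eq0 gt_eqF.
by rewrite absz_gt0 denq_eq0.
Qed.

Section affine.
Variable R : realType.
Variable T : R -> R.
Hypothesis TP : forall a b c d : R, a + b < c + d -> T a + T b < T c + T d.

Let inc (h x : R) := T (x + h) - T x.

(** This is the hypothesis on sums rewritten: a longer step has a larger increment whatever the two
    base points. *)
Let inc_lt h h' x y : h < h' -> inc h x < inc h' y.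
Proof.
move=> hh; rewrite /inc ltrBlDr addrAC ltrBrDr -[ltRHS]addrC.
by apply: TP; lra.
Qed.

Let inc_telescope (n : nat) h x : T (x + n%:R * h) - T x = \sum_(k < n) inc h (x + k%:R * h).
Proof.
elim: n => [|n IH]; first by rewrite mul0r addr0 subrr big_ord0.
rewrite big_ord_recr/= -IH /inc -[n.+1]addn1 natrD mulrDl mul1r addrA.
by ring.
Qed.

(** From [l / m < 1 / n]: a step [l] cut into [m] parts is compared, part by part, with the unit
    step cut into [n] parts. *)
Let inc_ub (m n : nat) l x : (0 < n)%N -> l < m%:R / n%:R ->
  inc l x <= (T 1 - T 0) * (m%:R / n%:R).
Proof.
move=> n0 lmn; have n0' : 0 < n%:R :> R by rewrite ltr0n.
have [m0|m0] := posnP m.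
  rewrite m0 mul0r mulr0 in lmn *.
  have := @inc_lt l 0 x 0 lmn; rewrite /inc addr0 subrr => /ltW; exact.
have m0' : 0 < m%:R :> R by rewrite ltr0n.
have lm : l / m%:R < 1 / n%:R by rewrite ltr_pdivrMr// mul1r mulrC.
have -> : inc l x = \sum_(k < m) inc (l / m%:R) (x + k%:R * (l / m%:R)).
  by rewrite -inc_telescope mulrC divfK ?gt_eqF.
have E1 : T 1 - T 0 = \sum_(k < n) inc (1 / n%:R) (0 + k%:R * (1 / n%:R)).
  by rewrite -inc_telescope add0r mulrC divfK ?gt_eqF.
have le0 y : inc (l / m%:R) y <= (T 1 - T 0) / n%:R.
  rewrite ler_pdivlMr// E1 mulr_natr -[X in _ *+ X <= _]card_ord -sumr_const.
  by apply: ler_sum => k _; apply: ltW; exact: inc_lt.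
apply: (@le_trans _ _ (\sum_(k < m) ((T 1 - T 0) / n%:R))).
  by apply: ler_sum => k _; exact: le0.
by rewrite sumr_const card_ord -[_ *+ m]mulr_natr le_eqVlt; apply/orP; left; apply/eqP; field; exact: lt0r_neq0.
Qed.

Let inc_lb (m n : nat) l x : (0 < n)%N -> (0 < m)%N -> m%:R / n%:R < l ->
  (T 1 - T 0) * (m%:R / n%:R) <= inc l x.
Proof.
move=> n0 m0 lmn; have n0' : 0 < n%:R :> R by rewrite ltr0n.
have m0' : 0 < m%:R :> R by rewrite ltr0n.
have lm : 1 / n%:R < l / m%:R by rewrite ltr_pdivlMr// mul1r mulrC.
have -> : inc l x = \sum_(k < m) inc (l / m%:R) (x + k%:R * (l / m%:R)).
  by rewrite -inc_telescope mulrC divfK ?gt_eqF.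
have E1 : T 1 - T 0 = \sum_(k < n) inc (1 / n%:R) (0 + k%:R * (1 / n%:R)).
  by rewrite -inc_telescope add0r mulrC divfK ?gt_eqF.
have le0 y : (T 1 - T 0) / n%:R <= inc (l / m%:R) y.
  rewrite ler_pdivrMr// E1 mulr_natr -[X in _ <= _ *+ X]card_ord -sumr_const.
  by apply: ler_sum => k _; apply: ltW; exact: inc_lt.
apply: (@le_trans _ _ (\sum_(k < m) ((T 1 - T 0) / n%:R))).
  by rewrite sumr_const card_ord -[_ *+ m]mulr_natr le_eqVlt; apply/orP; left; apply/eqP; field; exact: lt0r_neq0.
by apply: ler_sum => k _; exact: le0.
Qed.

Let c0 : 0 < T 1 - T 0.
Proof. by have := @inc_lt 0 1 0 0 ltr01; rewrite /inc addr0 subrr add0r. Qed.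

(** If the increment exceeded or missed the linear value, a fraction strictly between [l] and the
    rescaled increment would contradict one of the two rational bounds. *)
Let incE l x : 0 < l -> inc l x = (T 1 - T 0) * l.
Proof.
move=> l0; set c := T 1 - T 0; have cE : c != 0 by rewrite gt_eqF// c0.
apply/eqP; rewrite eq_le; apply/andP; split; rewrite leNgt; apply/negP => H.
- have H' : l < inc l x / c by rewrite ltr_pdivlMr ?c0// mulrC.
  have [m [n [m0 n0 lq qu]]] := ratio_between (ltW l0) H'.
  have := inc_ub x n0 lq.
  by rewrite -/c leNgt; apply/negP/negPn; rewrite mulrC -ltr_pdivlMr ?c0.
- have H' : inc l x / c < l by rewrite ltr_pdivrMr ?c0// mulrC.
  have H2 : Num.max 0 (inc l x / c) < l by rewrite gt_max l0 H'.
  have M0 : 0 <= Num.max 0 (inc l x / c) by rewrite le_max lexx.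
  have [m [n [m0 n0]]] := ratio_between M0 H2.
  rewrite gt_max => /andP[_ lq] qu.
  have := inc_lb x n0 m0 qu.
  by rewrite -/c leNgt; apply/negP/negPn; rewrite mulrC -ltr_pdivrMr ?c0.
Qed.

Lemma additive_order_affine : 0 < T 1 - T 0 /\ forall x, T x = T 0 + (T 1 - T 0) * x.
Proof.
split; first exact: c0.
move=> x; have [x0|x0|<-] := ltgtP 0 x.
- by have := incE 0 x0; rewrite /inc add0r => <-; rewrite addrC subrK.
- have nx : 0 < - x by rewrite oppr_gt0.
  have := incE x nx; rewrite /inc subrr => H.
  by rewrite -[x in RHS]opprK mulrN -H opprB addrC subrK.
- by rewrite mulr0 addr0.
Qed.

End affine.

Lemma ge0_integral_eq0_ae d (T : measurableType d) (R : realType)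
    (m : {measure set T -> \bar R}) (h : T -> \bar R) :
  measurable_fun setT h -> (forall x, (0 <= h x)%E) ->
  (\int[m]_x h x = 0)%E -> {ae m, forall x, h x = 0%E}.
Proof.
move=> mh h0 E; have H := ae_eq_integral_abs m measurableT mh.
have : ae_eq m setT h (cst 0%E).
  by apply/H; rewrite -[RHS]E; apply: eq_integral => x _; rewrite gee0_abs.
by apply: filterS => x /(_ I).
Qed.

Lemma integral_indicM d (T : measurableType d) (R : realType)
    (m : {measure set T -> \bar R}) (A : set T) (h : T -> R) :
  (\int[m]_(x in A) (h x)%:E = \int[m]_x (\1_A x * h x)%:E)%E.
Proof.
rewrite integral_mkcond; apply: eq_integral => x _.
by rewrite patchE indicE; case: ifP => _; rewrite ?mul1r ?mul0r.
Qed.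

Section shear_ae.
Variable R : realType.
Local Notation mu := (@lebesgue_measure R).
Local Notation mu2 := (mu \x mu)%E.

(** Tonelli in sheared coordinates, applied to the indicator of a null set containing the
    exceptions. *)
Lemma ae_shear (P : R * R -> Prop) : {ae mu2, forall z, P z} ->
  {ae mu, forall w, {ae mu, forall x, P (x, x + w)}}.
Proof.
move=> [N [mN N0 PN]].
have mN' : measurable (N : set (R * R)) by exact: mN.
have mI : measurable_fun setT (\1_N : R * R -> R) by exact: measurable_indic.
have mI' : measurable_fun setT (fun z : R * R => \1_N (z.1, z.1 + z.2) : R).
  by apply: (measurableT_comp mI); apply: measurable_fun_pair => //; mfun.
have I0 z : 0 <= \1_N z :> R by [].
have E : (\int[mu]_w \int[mu]_x (\1_N (x, x + w)%R)%:E = 0)%E.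
  rewrite -(tonelli_shear mI I0) (plane_tonelli1 mI I0).
  by rewrite integral_indic// setIT.
have mF : measurable_fun (setT : set R) (fun w : R => \int[mu]_x (\1_N (x, x + w)%R)%:E)%E.
  exact: plane_measurable_int1 mI' (fun z => I0 _).
have {}E : {ae mu, forall w, (\int[mu]_x (\1_N (x, x + w)%R)%:E = 0)%E}.
  apply: (@ge0_integral_eq0_ae _ (measurableTypeR R) R mu _ mF _ E) => w.
  by apply: integral_ge0 => x _; rewrite lee_fin.
apply: ae_imp E => w Ew.
have mIw : measurable_fun setT (fun x : R => \1_N (x, x + w) : R).
  by apply: (measurableT_comp mI); apply: measurable_fun_pair => //; mfun.
have mIw' : measurable_fun setT (fun x : R => (\1_N (x, x + w) : R)%:E) by exact/measurable_EFinP.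
have := @ge0_integral_eq0_ae _ (measurableTypeR R) R mu _ mIw' (fun x => I0 _) Ew.
apply: ae_imp => x [] /= /eqP; rewrite indicE; case: (boolP (_ \in N)) => [_|+ _]; first by rewrite oner_eq0.
by rewrite notin_setE => Nx; apply: contrapT => nP; apply: Nx; apply: PN.
Qed.


Lemma ae_dense (P : R -> Prop) (a b : R) : a < b -> {ae mu, forall x, P x} ->
  exists2 x, a < x < b & P x.
Proof.
move=> ab [N [mN N0 PN]]; apply: contrapT => H.
have sub : (`]a, b[%classic : set R) `<=` N.
  move=> x; rewrite /= in_itv/= => xab; apply: PN => /= Px; apply: H; by exists x.
have : (mu (`]a, b[%classic : set R) <= mu N)%E.
  by apply: le_measure => //; rewrite inE//; exact: measurable_itv.
by rewrite N0 lebesgue_measure_itv/= lte_fin ab lee_fin leNgt subr_gt0 ab.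
Qed.

Lemma integral_ray_affine (q : R -> R) (a c x0 : R) : 0 < c ->
  measurable_fun setT q -> (forall x, 0 <= q x) ->
  (\int[mu]_(x in `]-oo, x0]) (c * q (c * x + a)%R)%:E =
   \int[mu]_(y in `]-oo, (c * x0 + a)%R]) (q y)%:E)%E.
Proof.
move=> c0 mq q0.
pose B : set R := `]-oo, (c * x0 + a)%R]%classic.
have mB : measurable B by exact: measurable_itv.
have memB (y : R) : (c * y + a \in B) = (y \in (`]-oo, x0]%classic : set R)).
  by apply/idP/idP; rewrite !in_setE /B/= !in_itv/= lerD2r ler_pM2l.
pose h (y : R) := (\1_B y * q y)%:E.
have mh : measurable_fun setT h.
  by apply/measurable_EFinP; apply: measurable_funM => //; exact: measurable_indic.
have h0 y : (0 <= h y)%E by rewrite lee_fin mulr_ge0.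
rewrite integral_indicM [RHS]integral_indicM.
rewrite -(@ge0_integral_affine _ a c h (lt0r_neq0 c0) mh h0) gtr0_norm//.
rewrite -ge0_integralZl//.
- apply: eq_integral => y _; rewrite /h !indicE/=.
  rewrite memB.
  by rewrite -EFinM mulrCA.
- by apply: (measurableT_comp mh); mfun.
- by rewrite lee_fin ltW.
Qed.

Lemma dfun_affine (q : R -> R) (a c x0 : R) : 0 < c ->
  measurable_fun setT q -> (forall x, 0 <= q x) ->
  dfun (fun x => c * q (c * x + a)) x0 = dfun q (c * x0 + a).
Proof. by move=> c0 mq q0; rewrite /dfun /Rintegral integral_ray_affine. Qed.

Lemma normal_peakE (s : R) : 0 < s -> normal_peak s = normal_peak 1 / s.
Proof.
move=> s0; rewrite /normal_peak expr1n mul1r -mulrnAr sqrtrM ?sqr_ge0//.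
by rewrite sqrtr_sqr gtr0_norm// invfM mulrC.
Qed.

Lemma normal_pdf_affine (m s x : R) : 0 < s ->
  s * normal_pdf m s (s * x + m) = normal_pdf 0 1 x.
Proof.
move=> s0; have s0' := lt0r_neq0 s0.
rewrite !normal_pdf_expE ?oner_eq0// mulrA; congr (_ * expR _); last first.
  by rewrite addrK subr0; field.
by rewrite normal_peakE// mulrC divfK.
Qed.

Lemma dfun_normal (m s x : R) : 0 < s ->
  dfun (normal_pdf m s) (s * x + m) = dfun (normal_pdf 0 1) x.
Proof.
move=> s0; rewrite -dfun_affine//; last 2 first.
- exact: measurable_normal_pdf.
- exact: normal_pdf_ge0.
by congr dfun; apply/funext => y; rewrite normal_pdf_affine.
Qed.

Lemma eq_dfun_ae (p q : R -> R) : measurable_fun setT p -> measurable_fun setT q ->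
  (forall x, 0 <= p x) -> (forall x, 0 <= q x) ->
  (\int[mu]_x (p x)%:E = 1)%E -> (\int[mu]_x (q x)%:E = 1)%E -> dfun p = dfun q ->
  {ae mu, forall x, p x = q x}.
Proof.
move=> mp mq p0 q0 p1 q1 pq.
pose Mp : {measure set (measurableTypeR R) -> \bar R} := density_measure mu mp p0.
pose Mq : {measure set (measurableTypeR R) -> \bar R} := density_measure mu mq q0.
have E := @eq_measure_rays R Mp Mq.
have Ep a : Mp `]-oo, a]%classic = (dfun p a)%:E by rewrite dfunE.
have Eq a : Mq `]-oo, a]%classic = (dfun q a)%:E by rewrite dfunE.
have {}E : forall A : set (measurableTypeR R), measurable A -> Mp A = Mq A.
  by apply: E => a; rewrite Ep ?ltry// Eq pq.
have pL1 : L1 mu p by apply: L1_ge0 => //; rewrite p1 ltry.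
have H := @integral_ae_eq _ (measurableTypeR R) R mu setT measurableT (EFin \o q) (EFin \o p) pL1 ((measurable_EFinP _ _).2 mq).
have : ae_eq mu setT (EFin \o p) (EFin \o q) by apply: H => A _ mA; exact: E.
by apply: ae_imp => x /(_ I) [].
Qed.

End shear_ae.

Section equality.
Variable R : realType.
Local Notation mu := (@lebesgue_measure R).
Local Notation mu2 := (mu \x mu)%E.
Variable f : R -> R.
Hypotheses (mf : measurable_fun setT f) (f0 : forall x, 0 <= f x).
Hypothesis f1 : (\int[mu]_x (f x)%:E = 1)%E.
Hypotheses (fent : entropy_finite f) (gent : entropy_finite (convol f f)).
Local Notation phi := (normal_pdf (0 : R) 1).
Local Notation r2 := (Num.sqrt (2 : R)).
Local Notation psi := (normal_pdf (0 : R) r2).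
Local Notation T := (transport f).
Local Notation t := (dtransport f).
Local Notation g := (convol f f).
#[local] Opaque transport dtransport normal_pdf convol dfun.

Let r20 : 0 < r2. Proof. by rewrite sqrtr_gt0. Qed.
Let psi_gt0 x : 0 < psi x. Proof. by apply: normal_pdf_gt0; rewrite gt_eqF. Qed.
Let mpsi : measurable_fun setT psi. Proof. exact: measurable_normal_pdf. Qed.
Let psi0 x : 0 <= psi x. Proof. exact: normal_pdf_ge0. Qed.
Let psi1 : (\int[mu]_x (psi x)%:E = 1)%E. Proof. exact: integral_normal_pdf. Qed.
Let f_L1 : L1 mu f. Proof. by apply: L1_ge0 => //; rewrite f1 ltry. Qed.
Let g0 x : 0 <= g x. Proof. exact: convol_ge0. Qed.
Let mg : measurable_fun setT g. Proof. exact: measurable_convol. Qed.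
Let g1 : (\int[mu]_x (g x)%:E = 1)%E.
Proof.
have := Rint_convol f_L1 f_L1.
have -> : \int[mu]_x f x = 1 by rewrite /Rintegral f1.
rewrite mulr1 => E; rewrite -(EFin_Rint (L1_convol f_L1 f_L1)); by rewrite E.
Qed.

(** The slice [y = x + w] is good when the equality case holds at almost every point of it; the
    common factor [psi w] has been divided out. *)
Let good w := {ae mu, forall x, g (T (x + w) + T x) * (t (x + w) + t x) = 2 * psi (2 * x + w)}.

(** On a good slice the integrand of [integral_sum_transport], taken at [g] restricted to [B], is an
    explicit normal density. *)
Let sum_transport_set w (B : set R) : good w -> measurable B ->
  (\int[mu]_(x in [set x | B (T (x + w) + T x)%R]) (2 * psi (2 * x + w)%R)%:E <=
   \int[mu]_(x in B) (g x)%:E)%E.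
Proof.
move=> gw mB.
have mT : measurable_fun setT T by exact: measurable_transport.
have mt : measurable_fun setT t by exact: measurable_dtransport.
have mTw : measurable_fun setT (fun x : R => T (x + w)) by apply: (measurableT_comp mT); mfun.
have mtw : measurable_fun setT (fun x : R => t (x + w)) by apply: (measurableT_comp mt); mfun.
have mS : measurable_fun setT (fun x : R => T (x + w) + T x) by exact: (measurable_funD mTw mT).
have ms : measurable_fun setT (fun x : R => t (x + w) + t x) by exact: (measurable_funD mtw mt).
have mq : measurable_fun setT (fun x : R => 2 * psi (2 * x + w)).
  by apply: measurable_funM => //; apply: (measurableT_comp mpsi); mfun.
have mB' : measurable [set x : R | B (T (x + w) + T x)].
  by rewrite -[X in measurable X]setTI; exact: mS.
have mIB : measurable_fun setT (\1_[set x : R | B (T (x + w) + T x)] : R -> R).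
  exact: measurable_indic.
have mBg : measurable_fun setT (fun y : R => \1_B y * g y).
  by apply: measurable_funM => //; exact: measurable_indic.
have H := integral_sum_transport mf f0 f1 w ((measurable_EFinP _ _).2 mBg).
rewrite integral_indicM [leRHS]integral_indicM; apply: le_trans (H _); last by move=> x; rewrite lee_fin mulr_ge0.
rewrite le_eqVlt; apply/orP; left; apply/eqP.
apply: (@ae_eq_integral _ (measurableTypeR R) R mu setT _ _ measurableT).
- exact: ((measurable_EFinP _ _).2 (measurable_funM mIB mq)).
- exact: (emeasurable_funM (measurableT_comp ((measurable_EFinP _ _).2 mBg) mS) ((measurable_EFinP _ _).2 ms)).
- apply: ae_imp gw => x E _.
  by rewrite /= -EFinM -mulrA E !indicE; congr (_%:R * _)%:E; apply/idP/idP; rewrite !inE.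
Qed.

(** The set estimate holds for the ray up to [a] and for its complement, and both laws have mass 1,
    so both estimates are equalities. On good slices the distribution function of [g] at [T x + T y]
    thus depends on [x + y] alone. *)
Let dfun_sum w x : good w -> dfun g (T (x + w) + T x) = dfun psi (2 * x + w).
Proof.
move=> gw; set a := T (x + w) + T x.
have Slt (y z : R) : y < z -> T (y + w) + T y < T (z + w) + T z.
  by move=> yz; apply: ltrD; apply: transport_lt => //; rewrite ltrD2r.
have Sle (y : R) : (T (y + w) + T y <= a) = (y <= x).
  case: (ltgtP y x) => [/Slt/ltW //|/Slt H|->]; last exact: lexx.
  by apply/negbTE; rewrite -ltNge.
have H1 := @sum_transport_set w `]-oo, a]%classic gw (measurable_itv _).
have H2 := @sum_transport_set w `]a, +oo[%classic gw (measurable_itv _).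
have mq : measurable_fun setT (fun x : R => 2 * psi (2 * x + w)).
  apply: measurable_funM => //; apply: (measurableT_comp mpsi); mfun.
have q0 (y : R) : 0 <= 2 * psi (2 * y + w) by rewrite mulr_ge0.
have q1 : (\int[mu]_x (2 * psi (2 * x + w)%R)%:E = 1)%E.
  have /= := @ge0_integral_affine _ w 2 _ (lt0r_neq0 _) ((measurable_EFinP _ _).2 mpsi) (fun x => psi0 x).
  move=> /(_ (ltr0n _ 2)); rewrite psi1 => <-; rewrite ger0_norm// -ge0_integralZl//.
  - by apply: measurableT_comp => //; apply: (measurableT_comp mpsi); mfun.
  - by move=> y _; exact: psi0.
have E1 : [set y | (`]-oo, a]%classic : set R) (T (y + w) + T y)] = `]-oo, x]%classic.
  by apply/seteqP; split => y /=; rewrite !in_itv/= Sle.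
have E2 : [set y | (`]a, +oo[%classic : set R) (T (y + w) + T y)] = `]x, +oo[%classic.
  by apply/seteqP; split => y /=; rewrite !in_itv/= !andbT !ltNge Sle.
move: H1 H2; rewrite E1 E2 !dfun_tail// -!dfunE// !lee_fin.
rewrite (@dfun_affine _ psi w 2 x)// => H1 H2; apply/eqP; rewrite eq_le H1 andbT.
by move: H2; rewrite lerD2l lerN2.
Qed.

Let sum_density_ratio_shear (w x : R) : sum_density_ratio f (x, x + w) = phi x * phi (x + w) ->
  g (T (x + w) + T x) * (t (x + w) + t x) = 2 * psi (2 * x + w).
Proof.
rewrite /sum_density_ratio/= normal_rotation [x + w - x]addrC addKr => /mulIf H.
rewrite [T _ + _]addrC [t _ + _]addrC H ?gt_eqF//; congr (_ * psi _).
by rewrite mulr2n; ring.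
Qed.

Let dfun_psi_lt (x y : R) : x < y -> dfun psi x < dfun psi y.
Proof.
move=> xy; have E z : z = r2 * (z / r2) + 0 by rewrite addr0 mulrC divfK// gt_eqF.
by rewrite (E x) (E y) !dfun_normal//; apply: Phi_lt; rewrite ltr_pM2r// invr_gt0.
Qed.

Lemma epi_equality_normal : entropy g <= entropy f + 2^-1 * ln 2 ->
  exists m s : R, 0 < s /\ {ae mu, forall x, f x = normal_pdf m s x}.
Proof.
move=> eq.
have sandwich (p q r s u v : R) : q <= u -> u + p < v + r -> v <= s -> p + q < r + s.
  by lra.
have gw : {ae mu, forall w, good w}.
  have := ae_shear (epi_equality mf f0 f1 fent gent eq).
  by apply: ae_imp => w; apply: ae_imp => x; exact: sum_density_ratio_shear.
have TP a b c d : a + b < c + d -> T a + T b < T c + T d.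
  move=> abcd.
  (* Good slices are only dense. [w] is taken just above [b - a] and [w'] just below [d - c], each
     within half the gap, so [2 * a + w < 2 * c + w'] still holds, and monotonicity of [T] absorbs
     the displacement. *)
  pose e := (c + d - a - b) / 2; have e0 : 0 < e by rewrite /e; lra.
  have lt1 : b - a < b - a + e by rewrite ltrDl.
  have lt2 : d - c - e < d - c by rewrite ltrBlDr ltrDl.
  have [w /andP[w1 w2] gw1] := ae_dense lt1 gw.
  have [w' /andP[w1' w2'] gw2] := ae_dense lt2 gw.
  have L : dfun psi (2 * a + w) < dfun psi (2 * c + w').
    by apply: dfun_psi_lt; move: e0 w2 w1'; rewrite /e; lra.
  rewrite -(dfun_sum a gw1) -(dfun_sum c gw2) in L.
  have L2 : T (a + w) + T a < T (c + w') + T c.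
    by rewrite ltNge; apply/negP => /(dfun_nondecreasing mg g0 g1); rewrite leNgt L.
  have L3 : T b <= T (a + w) by apply: transport_homo => //; rewrite -lerBlDl ltW.
  have L4 : T (c + w') <= T d by apply: transport_homo => //; rewrite -lerBrDl ltW.
  exact: sandwich L3 L2 L4.
have [c0 TE] := additive_order_affine TP.
exists (T 0), (T 1 - T 0); split => //.
apply: eq_dfun_ae => //.
- exact: measurable_normal_pdf.
- by move=> x; exact: normal_pdf_ge0.
- exact: integral_normal_pdf.
apply/funext => y; pose x := (y - T 0) / (T 1 - T 0).
have -> : y = (T 1 - T 0) * x + T 0 by rewrite /x mulrC divfK ?subrK// lt0r_neq0.
by rewrite dfun_normal// [X in dfun f X]addrC -TE dfun_transport.
Qed.

End equality.

(** * Normal laws under convolution, and the doubling constant *)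

Section gaussian_sum.
Variable R : realType.
Local Notation mu := (@lebesgue_measure R).
Local Notation r2 := (Num.sqrt (2 : R)).

Lemma normal_pdf_standardize (m s x : R) : 0 < s ->
  normal_pdf m s x = s^-1 * normal_pdf 0 1 (s^-1 * x - m / s).
Proof.
move=> s0; rewrite -(normal_pdf_affine m (s^-1 * x - m / s) s0) mulKf ?gt_eqF//.
by congr normal_pdf; field; rewrite gt_eqF.
Qed.

(** Given the sum [x] of two independent copies, one summand is normal with mean [x / 2] and
    standard deviation [s / r2]. *)
Lemma normal_pdf_split (m s x y : R) : 0 < s ->
  normal_pdf m s y * normal_pdf m s (x - y) =
  normal_pdf (2 * m) (s * r2) x * normal_pdf (x / 2) (s / r2) y.
Proof.
move=> s0; have r20 : 0 < r2 by rewrite sqrtr_gt0.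
have r2E : r2 ^+ 2 = 2 by rewrite sqr_sqrtr.
have s1 : 0 < s * r2 by rewrite mulr_gt0.
have s2 : 0 < s / r2 by rewrite divr_gt0.
rewrite !normal_pdf_expE ?lt0r_neq0// (normal_peakE s0) (normal_peakE s1) (normal_peakE s2).
rewrite mulrACA [RHS]mulrACA -!expRD; congr (_ * expR _).
  by field; rewrite ?lt0r_neq0.
rewrite !exprMn exprVn r2E; field.
by rewrite lt0r_neq0.
Qed.

Lemma convol_normal (m s : R) : 0 < s ->
  convol (normal_pdf m s) (normal_pdf m s) = normal_pdf (2 * m) (s * r2).
Proof.
move=> s0; apply/funext => x; rewrite /convol.
have -> : \int[mu]_y (normal_pdf m s y * normal_pdf m s (x - y)) =
  \int[mu]_y (normal_pdf (2 * m) (s * r2) x * normal_pdf (x / 2) (s / r2) y).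
  by apply: (eq_Rint mu) => y; exact: normal_pdf_split.
by rewrite RintZ; [rewrite Rint_normal mulr1|exact: L1_normal].
Qed.

Lemma L1_std_normal_ln : L1 mu (fun x : R => normal_pdf 0 1 x * ln (normal_pdf 0 1 x)).
Proof.
have H := L1B (L1Z (ln (normal_peak (1 : R))) (L1_normal (0 : R) 1))
  (L1Z 2^-1 (L1_pow_normal 1 (@ltr01 R))).
apply: eq_L1 H => x /=.
by rewrite ln_normal_pdf ?oner_eq0// subr0 expr1n mul1r muln1; ring.
Qed.

Lemma L1_normal_ln (m s : R) : 0 < s ->
  L1 mu (fun x : R => normal_pdf m s x * ln (normal_pdf m s x)).
Proof.
move=> s0.
have si : s^-1 != 0 by rewrite invr_neq0// gt_eqF.
have H1 := L1Z s^-1 (L1_affine (- (m / s)) si L1_std_normal_ln).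
have H2 := L1Z (ln s) (L1_normal m s).
have := L1B H1 H2; apply: eq_L1 => x /=.
rewrite (normal_pdf_standardize m x s0) lnM ?posrE ?invr_gt0//; last first.
  by apply: normal_pdf_gt0; exact: oner_neq0.
by rewrite lnV ?posrE//; ring.
Qed.

Lemma entropy_normal (m s : R) : 0 < s ->
  entropy (normal_pdf m s) = ln s + entropy (normal_pdf (0 : R) 1).
Proof.
move=> s0; rewrite /entropy -(Rint_affine m (lt0r_neq0 s0) (L1_normal_ln m s0)).
have H : L1 mu (fun x : R => normal_pdf m s (s * x + m) * ln (normal_pdf m s (s * x + m))).
  exact: (L1_affine m (lt0r_neq0 s0) (L1_normal_ln m s0)).
rewrite gtr0_norm// -RintZ//.
have -> : \int[mu]_x (s * (normal_pdf m s (s * x + m) * ln (normal_pdf m s (s * x + m)))) =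
   \int[mu]_x (normal_pdf 0 1 x * ln (normal_pdf 0 1 x) - ln s * normal_pdf 0 1 x).
  apply: (eq_Rint mu) => x; rewrite mulrA normal_pdf_affine//.
  have -> : normal_pdf m s (s * x + m) = s^-1 * normal_pdf 0 1 x.
    by rewrite -(normal_pdf_affine m x s0) mulKf ?gt_eqF.
  rewrite lnM ?posrE ?invr_gt0//; last by apply: normal_pdf_gt0; exact: oner_neq0.
  by rewrite lnV ?posrE//; ring.
rewrite RintB; [|exact: L1_std_normal_ln|exact: L1Z (L1_normal _ _)].
by rewrite RintZ; [rewrite Rint_normal mulr1 opprB|exact: L1_normal].
Qed.

Lemma entropy_ae (p q : R -> R) : measurable_fun setT p -> measurable_fun setT q ->
  {ae mu, forall x, p x = q x} -> entropy p = entropy q.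
Proof.
move=> mp mq pq; rewrite /entropy; congr (- _).
have ml (r : R -> R) : measurable_fun setT r -> measurable_fun setT (fun x => r x * ln (r x)).
  by move=> mr; apply: measurable_funM => //; exact: (measurableT_comp (@measurable_ln R) mr).
apply: ae_eq_Rint; [exact: ml|exact: ml|].
by apply: ae_imp pq => x ->.
Qed.

Lemma convol_ae (p q : R -> R) : measurable_fun setT p -> measurable_fun setT q ->
  (forall x, 0 <= p x) -> (forall x, 0 <= q x) ->
  {ae mu, forall x, p x = q x} -> convol p p = convol q q.
Proof.
move=> mp mq p0 q0 pq.
have H (r : R -> R) : measurable_fun setT r -> convol p r = convol q r.
  move=> mr; apply/funext => x; apply: ae_eq_Rint.
  - by apply: measurable_funM => //; apply: (measurableT_comp mr); mfun.
  - by apply: measurable_funM => //; apply: (measurableT_comp mr); mfun.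
  - by apply: ae_imp pq => y ->.
by rewrite H// convolC// H.
Qed.

End gaussian_sum.

Section doubling.
Variable R : realType.
Local Notation mu := (@lebesgue_measure R).
Variable f : R -> R.
Hypothesis fd : is_density f.
Hypotheses (fent : entropy_finite f) (gent : entropy_finite (convol f f)).

Let sqrt2E : Num.sqrt (2 : R) = expR (2^-1 * ln 2).
Proof. by rewrite -ln_sqrt2 lnK// posrE sqrtr_gt0. Qed.

Lemma doubling_ge : Num.sqrt 2 <= doubling f.
Proof.
have [mf [f0 f1]] := fd.
rewrite sqrt2E /doubling ler_expR lerBrDl.
exact: entropy_power_inequality.
Qed.

Lemma doubling_eq : doubling f = Num.sqrt 2 <-> is_gaussian f.
Proof.
have [mf [f0 f1]] := fd.
rewrite sqrt2E /doubling; split => [/expR_inj E|[m [s [s0 fE]]]].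
  by apply: epi_equality_normal => //; rewrite -E addrC subrK.
have mn : measurable_fun setT (normal_pdf m s) by exact: measurable_normal_pdf.
have n0 x : 0 <= normal_pdf m s x by exact: normal_pdf_ge0.
rewrite (convol_ae mf mn f0 n0 fE) (entropy_ae mf mn fE) convol_normal//.
have r20 : 0 < Num.sqrt (2 : R) by rewrite sqrtr_gt0.
rewrite (entropy_normal _ s0) entropy_normal ?mulr_gt0// lnM ?posrE// ln_sqrt2.
by congr expR; rewrite opprD addrACA subrr addr0 addrAC subrr add0r.
Qed.

End doubling.

(** * Tails and primitives *)

Lemma L1_dominated_cvg d (T : measurableType d) (R : realType)
    (m : {measure set T -> \bar R}) (h_ : nat -> T -> R) (h b : T -> R) :
  (forall n, measurable_fun setT (h_ n)) -> measurable_fun setT h -> L1 m b ->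
  (forall n x, `|h_ n x| <= b x) -> (forall x, h_ ^~ x @ \oo --> h x) ->
  L1 m h /\ (fun n => \int[m]_x h_ n x) @ \oo --> \int[m]_x h x.
Proof.
move=> mh_ mh Lb hb hh.
have [] := @dominated_convergence _ _ _ m setT measurableT (fun n x => (h_ n x)%:E)
  (EFin \o h) (EFin \o b).
- by move=> n; exact/measurable_EFinP.
- exact/measurable_EFinP.
- by apply/aeW => x _; apply: cvg_EFin; [exact: nearW|exact: hh].
- exact: Lb.
- by apply/aeW => x n _; rewrite /= lee_fin.
move=> Lh _ C; split => //; rewrite /Rintegral; apply: fine_cvg.
by rewrite -/(Rintegral m setT h) (EFin_Rint Lh).
Qed.

Lemma Rint0 d (T : measurableType d) (R : realType) (m : {measure set T -> \bar R}) :
  \int[m]_x (0 : R) = 0.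
Proof. by rewrite /Rintegral integral0. Qed.

Section tail.
Variable R : realType.
Local Notation mu := (@lebesgue_measure R).
Local Notation mu2 := (mu \x mu)%E.
Implicit Types (a h u : R -> R) (y z : R).

Definition step y z : R := (y < z)%R%:R.

Lemma step_ge0 y z : 0 <= step y z. Proof. exact: ler0n. Qed.

Lemma step_le1 y z : step y z <= 1. Proof. by rewrite lern1 leq_b1. Qed.

Lemma norm_step y z : `|step y z| <= 1.
Proof. by rewrite ger0_norm ?step_ge0// step_le1. Qed.

Lemma measurable_step d (T : measurableType d) (a b : T -> R) :
  measurable_fun setT a -> measurable_fun setT b ->
  measurable_fun setT (fun x => step (a x) (b x)).
Proof.
move=> ma mb; rewrite (_ : (fun x => _) = (fun x => if a x < b x then 1 else 0)).
  by apply: measurable_fun_ifT; [exact: measurable_fun_ltr| exact: measurable_cst..].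
by apply/funext => x; rewrite /step; case: ifP.
Qed.

Lemma step_opp y z : step (- y) (- z) = step z y.
Proof. by rewrite /step ltrN2. Qed.

Definition tail h y : R := \int[mu]_z (step y z * h z).

Lemma measurable_step1 y : measurable_fun setT (fun z : R => step y z).
Proof. by apply: measurable_step; [exact: measurable_cst|exact: measurable_id]. Qed.

Lemma measurable_step2 y : measurable_fun setT (fun z : R => step z y).
Proof. by apply: measurable_step; [exact: measurable_id|exact: measurable_cst]. Qed.

Lemma L1_step h y : L1 mu h -> L1 mu (fun z => step y z * h z).
Proof.
move=> Lh; have mh := L1_line_measurable Lh.
apply: L1_le (L1_norm Lh).
  exact: (measurable_funM (measurable_step1 y) mh).
by move=> x; rewrite normrM ler_piMl// norm_step.
Qed.

Lemma L1_stepl h y : L1 mu h -> L1 mu (fun z => step z y * h z).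
Proof.
move=> Lh; have mh := L1_line_measurable Lh.
apply: L1_le (L1_norm Lh).
  exact: (measurable_funM (measurable_step2 y) mh).
by move=> x; rewrite normrM ler_piMl// norm_step.
Qed.

Lemma tailD h1 h2 y : L1 mu h1 -> L1 mu h2 ->
  tail (fun z => h1 z + h2 z) y = tail h1 y + tail h2 y.
Proof.
move=> L1h L2h; rewrite /tail -RintD; [|exact: L1_step..].
by apply: (eq_Rint mu) => z; rewrite mulrDr.
Qed.

Lemma tailZ (k : R) h y : L1 mu h -> tail (fun z => k * h z) y = k * tail h y.
Proof.
move=> Lh; rewrite /tail -RintZ; [|exact: L1_step].
by apply: (eq_Rint mu) => z; rewrite mulrCA.
Qed.

Lemma norm_tail h y : L1 mu h -> `|tail h y| <= \int[mu]_z `|h z|.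
Proof.
move=> Lh; have L := L1_step y Lh.
apply: (le_trans (le_normr_Rintegral measurableT L)).
apply: Rint_le (L1_norm L) (L1_norm Lh) _ => z.
by rewrite normrM ler_piMl// norm_step.
Qed.

Lemma ge0_measurable_tail h : measurable_fun setT h -> (forall x, 0 <= h x) ->
  measurable_fun setT (tail h).
Proof.
move=> mh h0.
have mH : measurable_fun setT (fun w : R * R => step w.1 w.2 * h w.2).
  apply: measurable_funM; first by apply: measurable_step; mfun.
  by apply: (measurableT_comp mh); mfun.
by have := plane_measurable_Rint2 mH (fun w => mulr_ge0 (step_ge0 _ _) (h0 _)).
Qed.

Lemma measurable_tail h : L1 mu h -> measurable_fun setT (tail h).
Proof.
move=> Lh; have mh := L1_line_measurable Lh; have Ln := L1_norm Lh.
have mn := L1_line_measurable Ln.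
have hp x : 0 <= `|h x| + h x by rewrite -lerBlDr sub0r; have := ler_norm (- h x); rewrite normrN.
have := measurable_funB (ge0_measurable_tail (measurable_funD mn mh) hp)
  (ge0_measurable_tail mn (fun x => normr_ge0 _)).
rewrite (_ : _ \- _ = tail h)//; apply/funext => y /=.
by rewrite tailD// addrAC subrr add0r.
Qed.

Lemma primitive_tail a y : L1 mu a ->
  \int[mu]_z (step z y * a z) = tail (fun z => a (- z)) (- y).
Proof.
move=> La; rewrite -(Rint_reflect 0 (L1_stepl y La)); apply: (eq_Rint mu) => z.
by rewrite sub0r -step_opp opprK.
Qed.

Let L1_opp a : L1 mu a -> L1 mu (fun z => a (- z)).
Proof. by move=> La; apply: eq_L1 (L1_reflect 0 La) => z; rewrite sub0r. Qed.

Lemma measurable_primitive a : L1 mu a ->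
  measurable_fun setT (fun y => \int[mu]_z (step z y * a z)).
Proof.
move=> La; rewrite (_ : (fun y => _) = tail (fun z => a (- z)) \o -%R).
  by apply: measurableT_comp (measurable_tail (L1_opp La)) _; exact: oppr_measurable.
by apply/funext => y; rewrite primitive_tail.
Qed.

Lemma norm_primitive a y : L1 mu a ->
  `|\int[mu]_z (step z y * a z)| <= \int[mu]_z `|a z|.
Proof.
move=> La; rewrite primitive_tail// (le_trans (norm_tail _ (L1_opp La)))//.
rewrite -[leRHS](Rint_reflect 0 (L1_norm La)) le_eqVlt; apply/orP; left; apply/eqP.
by apply: (eq_Rint mu) => z; rewrite sub0r.
Qed.

Lemma L1_tail_dual a h : L1 mu a -> L1 mu h ->
  L1 mu2 (fun w => step w.1 w.2 * (a w.1 * h w.2)).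
Proof.
move=> La Lh; have P := L1_prodM La Lh; have mP := L1_plane_measurable P.
apply: L1_le (L1_norm P) => [|w]; last by rewrite normrM ler_piMl// norm_step.
apply: measurable_funM mP.
by apply: measurable_step; [exact: measurable_fst|exact: measurable_snd].
Qed.

(* Integration by parts for the primitive of [a] and the tail of [h], as Fubini on [z < y]. *)
Lemma tail_dual a h : L1 mu a -> L1 mu h ->
  \int[mu]_y ((\int[mu]_z (step z y * a z)) * h y) = \int[mu]_z (a z * tail h z).
Proof.
move=> La Lh; have P := L1_tail_dual La Lh.
transitivity (\int[mu2]_w (step w.1 w.2 * (a w.1 * h w.2))).
  rewrite Rint_fubini2//; apply: (eq_Rint mu) => y /=.
  rewrite -RintZr; last exact: L1_stepl.
  by apply: (eq_Rint mu) => z; rewrite mulrA.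
rewrite Rint_fubini1//; apply: (eq_Rint mu) => y /=.
rewrite /tail -RintZ; last exact: L1_step.
by apply: (eq_Rint mu) => z; rewrite mulrCA.
Qed.

Lemma step_diff m z : m <= z ->
  (fun y => step y z - step y m) = \1_(`[m, z[%classic : set R).
Proof.
move=> mz; apply/funext => y; rewrite indicE /step.
have -> : (y \in (`[m, z[%classic : set R)) = (m <= y < z).
  by apply/idP/idP; rewrite in_setE/= in_itv.
case: (ltP y z) => yz; case: (ltP y m) => ym; rewrite ?subrr ?subr0//=.
by move: (le_lt_trans yz ym); rewrite ltNge mz.
Qed.

Lemma step_diff_int m z : L1 mu (fun y => step y z - step y m) /\
  (\int[mu]_y (`|step y z - step y m|)%:E = `|z - m|%:E)%E /\
  \int[mu]_y (step y z - step y m) = z - m.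
Proof.
wlog mz : m z / m <= z.
  move=> H; have [|/ltW zm] := leP m z; first exact: H.
  have [H1 [H2 H3]] := H z m zm; split; last split.
  - by apply: eq_L1 (L1N H1) => y; rewrite opprB.
  - rewrite distrC -H2; apply: eq_integral => y _; by rewrite distrC.
  - rewrite -opprB -H3 -RintN//; apply: (eq_Rint mu) => y; by rewrite opprB.
have E : (\int[mu]_y (\1_(`[m, z[%classic : set R) y)%:E = (z - m)%:E)%E.
  rewrite integral_indic; [|exact: measurableT|exact: measurable_itv].
  rewrite setIT /= lebesgue_measure_itv/= lte_fin.
  by move: mz; rewrite le_eqVlt => /orP[/eqP ->|->//]; rewrite ltxx subrr.
rewrite (step_diff mz); split; last split.
- apply: L1_ge0; [exact: measurable_indic|by []|by rewrite E ltry].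
- rewrite ger0_norm ?subr_ge0// -E; apply: eq_integral => y _.
  have := step_diff mz => /(congr1 (fun f => f y)) ->; by rewrite ger0_norm.
- have /(congr1 fine) := E; by [].
Qed.

(** As [h] has integral 0, [step y z] may be replaced by [step y z - step y m], which in [y] has
    integral [z - m] and absolute integral [|z - m|]. Fubini then applies. *)
Lemma tail_moment h m : L1 mu h -> L1 mu (fun z => (z - m) * h z) -> \int[mu]_z h z = 0 ->
  L1 mu (tail h) /\ \int[mu]_y tail h y = \int[mu]_z ((z - m) * h z).
Proof.
move=> Lh Lm h0; have mh := L1_line_measurable Lh.
pose H (w : R * R) := (step w.1 w.2 - step w.1 m) * h w.2.
have mH : measurable_fun setT H.
  apply: measurable_funM; last by apply: (measurableT_comp mh); mfun.
  by apply: measurable_funB; apply: measurable_step; mfun.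
have LH : L1 mu2 H.
  apply: L1_plane21 => //.
  rewrite (_ : (\int[mu]_y _)%E = (\int[mu]_z (`|(z - m) * h z|)%:E)%E).
    exact: L1_lty.
  apply: eq_integral => z _; rewrite /H/=.
  have [La [E _]] := step_diff_int m z.
  transitivity (\int[mu]_y (`|h z|%:E * `|step y z - step y m|%:E))%E.
    by apply: eq_integral => y _; rewrite normrM mulrC EFinM.
  rewrite ge0_integralZl//.
  - by rewrite E -EFinM normrM mulrC.
  - exact: (measurable_EFinP _ _).2 (L1_measurable (L1_norm La)).
have tE y : tail h y = \int[mu]_z H (y, z).
  rewrite /H/= (_ : (\int[mu]_z _) = \int[mu]_z (step y z * h z - step y m * h z)).
    by rewrite RintB; [rewrite RintZ// h0 mulr0 subr0|exact: L1_step|exact: L1Z].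
  by apply: (eq_Rint mu) => z; rewrite mulrBl.
split; first by apply: eq_L1 (L1_fubini1 LH) => y; rewrite tE.
transitivity (\int[mu]_y \int[mu]_z H (y, z)); first by apply: (eq_Rint mu) => y.
rewrite -Rint_fubini1// Rint_fubini2//; apply: (eq_Rint mu) => z.
have [La [_ E]] := step_diff_int m z.
by rewrite -E -RintZr.
Qed.

Lemma tail_small h (e : R) : 0 < e -> L1 mu h -> exists n : nat, tail (fun z => `|h z|) n%:R < e.
Proof.
move=> e0 Lh; have Ln := L1_norm Lh; have mn := L1_line_measurable Ln.
have C z : (fun n : nat => step n%:R z * `|h z|) @ \oo --> (0 : R).
  apply: cvg_near_cst; near=> n.
  rewrite /step ltNge (_ : z <= n%:R) ?mul0r//.
  by rewrite (le_trans (ltW (Num.Theory.truncnS_gt z)))// ler_nat; near: n; exact: nbhs_infty_ge.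
have [] := @L1_dominated_cvg _ _ _ mu (fun n z => step n%:R z * `|h z|) (fun=> 0) (fun z => `|h z|).
- by move=> n; exact: (measurable_funM (measurable_step1 n%:R) mn).
- exact: measurable_cst.
- exact: Ln.
- by move=> n z; rewrite ger0_norm ?mulr_ge0 ?step_ge0// ler_piMl// step_le1.
- exact: C.
move=> _; rewrite Rint0 => /cvgrPdist_lt /(_ _ e0) [n _ /(_ n (leqnn n))] /=.
by rewrite sub0r normrN => H; exists n; rewrite (le_lt_trans (ler_norm _)).
Unshelve. all: by end_near. Qed.

Section primitive.
Variables u du : R -> R.
Hypothesis udu : forall x : R, is_derive x 1 u (du x).
Hypothesis cdu : continuous du.

Lemma FTC2_step (a b : R) : a <= b -> \int[mu]_z ((step a z - step b z) * du z) = u b - u a.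
Proof.
rewrite le_eqVlt => /orP[/eqP ->|ab].
  rewrite subrr -(Rint0 mu); apply: (eq_Rint mu) => z; by rewrite subrr mul0r.
have cu x : u @ x --> u x.
  by apply/differentiable_continuous/derivable1_diffP; exact: (@ex_derive _ _ _ _ _ _ _ (udu x)).
have := @continuous_FTC2 R du u a b ab.
move=> /(_ (continuous_subspaceT cdu)) FTC.
have {FTC} : (\int[mu]_(x in `[a, b]) (du x)%:E = (u b)%:E - (u a)%:E)%E.
  apply: FTC.
  - split; [by move=> x _; exact: ex_derive|exact: cvg_at_right_filter|exact: cvg_at_left_filter].
  - by move=> x _; rewrite derive1E (@derive_val _ _ _ _ _ _ _ (udu x)).
rewrite (_ : u b - u a = fine ((u b)%:E - (u a)%:E)%E)// => <-.
rewrite /Rintegral; congr fine.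
rewrite -(@integral_itv_obnd_cbnd _ a (BRight b) (EFin \o du)); last first.
  apply: measurable_funTS; apply/measurable_EFinP; exact: continuous_measurable_fun.
rewrite [RHS](@integral_indicM _ _ _ mu _ du).
apply: eq_integral => z _; congr EFin; congr (_ * _).
rewrite indicE (_ : (z \in _) = (a < z <= b)).
  rewrite /step; case: (ltP a z) => az; case: (leP z b) => zb; rewrite ?subr0 ?subrr//=.
  by have := lt_le_trans (lt_trans ab zb) az; rewrite ltxx.
by apply/idP/idP; rewrite in_setE/= in_itv.
Qed.

Hypotheses (Lu : L1 mu u) (Ldu : L1 mu du).

(** The fundamental theorem makes [u + tail du] a constant [A], and [tail du] is small far out. If
    [A] were nonzero, [u] would stay away from 0 on a unit interval beyond [M], against the
    smallness of the tail of [|u|]. *)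
Lemma tail_primitive (y : R) : tail du y = - u y.
Proof.
have A_cst (a b : R) : a <= b -> u a + tail du a = u b + tail du b.
  move=> ab; have := FTC2_step ab.
  have -> : \int[mu]_z ((step a z - step b z) * du z) = tail du a - tail du b.
    rewrite /tail -RintB; [|exact: L1_step..].
    by apply: (eq_Rint mu) => z; rewrite mulrBl.
  by move=> E; apply/eqP; rewrite -subr_eq0 opprD addrACA E addrC subrKA subrr.
set A := u y + tail du y.
suff A0 : A = 0 by apply/eqP; rewrite -addr_eq0 addrC; exact/eqP.
apply/eqP/negPn/negP => A0; pose e := `|A| / 2.
have e0 : 0 < e by rewrite divr_gt0// normr_gt0.
have AE (b : R) : y <= b -> u b + tail du b = A by move=> yb; rewrite /A (A_cst _ _ yb).
have [n1 H1] := tail_small e0 Lu; have [n2 H2] := tail_small e0 Ldu.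
pose M := Num.max y (Num.max n1%:R n2%:R).
have tail_le (h : R -> R) (c d : R) : L1 mu h -> c <= d -> tail (fun z => `|h z|) d <= tail (fun z => `|h z|) c.
  move=> Lh cd; apply: Rint_le; [exact: L1_step (L1_norm Lh)..|move=> z].
  by rewrite ler_wpM2r// ler_nat; case: (ltP d z) => // dz; rewrite (le_lt_trans cd dz).
have I1 : \int[mu]_z (step z (M + 1 + 1) - step z (M + 1)) = 1.
  by rewrite (step_diff_int (M + 1) (M + 1 + 1)).2.2 addrAC subrr add0r.
have LI := (step_diff_int (M + 1) (M + 1 + 1)).1.
have le_M : M + 1 <= M + 1 + 1 by rewrite lerDl.
have : `|A| * 1 <= tail (fun z => `|u z|) M + e * 1.
  rewrite -I1 -!RintZ// -RintD; [|exact: L1_step (L1_norm Lu)|exact: L1Z].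
  apply: Rint_le; [exact: L1Z|apply: L1D; [exact: L1_step (L1_norm Lu)|exact: L1Z]|].
  move=> z; have := step_diff le_M => /(congr1 (fun f => f z)) ->; rewrite indicE.
  have S0 : 0 <= step M z * `|u z| by rewrite mulr_ge0// step_ge0.
  case: (boolP (z \in _)) => [|_]; last by rewrite !mulr0 addr0.
  rewrite in_setE/= in_itv/= => /andP[Mz _]; rewrite !mulr1.
  have Mz' : M < z by apply: lt_le_trans Mz; rewrite ltrDl.
  rewrite /step Mz' mul1r.
  rewrite -(AE z); last by apply: le_trans (ltW Mz'); rewrite /M le_max lexx.
  apply: (le_trans (ler_normD _ _)); rewrite lerD2l.
  apply: (@le_trans _ _ (tail (fun z => `|du z|) z)).
    apply: (le_trans (le_normr_Rintegral measurableT (L1_step z Ldu))).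
    rewrite le_eqVlt; apply/orP; left; apply/eqP; apply: (eq_Rint mu) => x.
    by rewrite normrM ger0_norm ?step_ge0.
  apply: ltW; apply: le_lt_trans H2; apply: tail_le => //.
  by apply: le_trans (ltW Mz'); rewrite /M !le_max lexx !orbT.
rewrite !mulr1 leNgt; apply/negP/negPn.
have : tail (fun z => `|u z|) M < e.
  by apply: le_lt_trans H1; apply: tail_le => //; rewrite /M !le_max lexx orbT.
by rewrite -(ltrD2r e) => /lt_le_trans; apply; rewrite /e -splitr.
Qed.

End primitive.

(** [tail_primitive] at 0, for [u] and for its reflection, gives [- u 0] and [u 0] for the two
    half-line integrals. *)
Lemma Rint_derive u du : (forall x : R, is_derive x 1 u (du x)) -> continuous du ->
  L1 mu u -> L1 mu du -> \int[mu]_z du z = 0.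
Proof.
move=> udu cdu Lu Ldu; have T1 := tail_primitive udu cdu Lu Ldu 0.
have T2 : tail (fun z => - du (- z)) 0 = - u (- 0).
  apply: (@tail_primitive (fun z => u (- z))).
  - move=> x; have H := udu (- x).
    have D := @is_derive1_comp R u (fun z : R => - z) x _ _ H (is_deriveN (is_derive_id x 1)).
    by apply: is_derive_eq D _; rewrite mulrN1.
  - move=> x; apply: cvgN; apply: continuous_comp; [exact: opp_continuous|exact: cdu].
  - by apply: eq_L1 (L1_reflect 0 Lu) => z; rewrite sub0r.
  - by apply: eq_L1 (L1N (L1_reflect 0 Ldu)) => z; rewrite sub0r.
have E : tail (fun z => - du (- z)) 0 = - \int[mu]_z (step z 0 * du z).
  rewrite -(Rint_reflect 0 (L1_stepl 0 Ldu)) -RintN; last first.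
    exact: (L1_reflect 0 (L1_stepl 0 Ldu)).
  by apply: (eq_Rint mu) => z; rewrite sub0r mulrN -{2}(oppr0 R) step_opp.
have : \int[mu]_z du z = \int[mu]_z (step 0 z * du z + step z 0 * du z).
  apply: ae_eq_Rint; [exact: (L1_measurable Ldu)| |].
    apply: (@L1_measurable _ _ _ mu); apply: L1D; [exact: L1_step|exact: L1_stepl].
  exists [set 0]; split; [exact: measurable_set1|exact: lebesgue_measure_set1|].
  move=> z /= H; apply: contrapT => /eqP z0; apply: H; rewrite /step.
  by case: ltgtP z0 => //= _ _; rewrite ?mul1r ?mul0r ?addr0 ?add0r.
rewrite RintD; [|exact: L1_step|exact: L1_stepl] => ->.
move/eqP: T2; rewrite E eqr_opp oppr0 => /eqP ->.
by rewrite -[X in X + _]/(tail du 0) T1 addNr.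
Qed.

End tail.

(** * Differentiating convolutions *)

Section bounded_convolution.
Variable R : realType.
Local Notation mu := (@lebesgue_measure R).
Local Notation mu2 := (mu \x mu)%E.

Lemma L1_bounded_convol (a b : R -> R) (B s : R) : L1 mu a -> measurable_fun setT b ->
  (forall x, `|b x| <= B) -> L1 mu (fun x => a x * b (s - x)).
Proof.
move=> La mb bB; apply: L1_le (L1Zr B (L1_norm La)) => [|x].
  apply: (measurable_funM (L1_line_measurable La)).
  by apply: (measurableT_comp mb); mfun.
by rewrite normrM ler_wpM2l.
Qed.

Lemma Rint_convol_sym (a b : R -> R) (s : R) : L1 mu (fun x => a x * b (s - x)) ->
  \int[mu]_x (b x * a (s - x)) = \int[mu]_x (a x * b (s - x)).
Proof.
move=> L; rewrite -[RHS](Rint_reflect s L); apply: (eq_Rint mu) => x.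
by rewrite subKr mulrC.
Qed.

Lemma L1_convol_sym (a b : R -> R) (s : R) : L1 mu (fun x => a x * b (s - x)) ->
  L1 mu (fun x => b x * a (s - x)).
Proof. by move=> L; apply: eq_L1 (L1_reflect s L) => x; rewrite subKr mulrC. Qed.

Lemma convol_bounded (a b : R -> R) (B s : R) : L1 mu a -> measurable_fun setT b ->
  (forall x, `|b x| <= B) -> `|convol a b s| <= B * \int[mu]_x `|a x|.
Proof.
move=> La mb bB; have L := L1_bounded_convol s La mb bB.
apply: (le_trans (le_normr_Rintegral measurableT L)); rewrite -RintZ; last exact: L1_norm.
apply: Rint_le (L1_norm L) (L1Z B (L1_norm La)) _ => x.
by rewrite normrM mulrC ler_wpM2r.
Qed.

Lemma is_derive_under_integral (F dF : R -> R -> R) (G : R -> R) (a u v : R) : u < a < v ->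
  (forall x, u < x < v -> L1 mu (F x)) ->
  (forall x y, u < x < v -> is_derive x 1 (F ^~ y) (dF x y)) ->
  (forall y, 0 <= G y) -> L1 mu G -> (forall x y, u < x < v -> `|dF x y| <= G y) ->
  is_derive a 1 (fun x => \int[mu]_y F x y) (\int[mu]_y dF a y).
Proof.
move=> auv LF dFE G0 LG dFG.
have uvE (x : R) : (`]u, v[%classic : set R) x <-> u < x < v by rewrite /= in_itv.
have d1E x y : u < x < v -> partial1of2 F x y = dF x y.
  by move=> xuv; rewrite partial1of2E (@derive_val _ _ _ _ _ _ _ (dFE x y xuv)).
have H1 : forall x y, (`]u, v[%classic : set R) x -> (setT : set (measurableTypeR R)) y -> derivable (F ^~ y) x 1.
  by move=> x y /uvE xuv _; exact: (@ex_derive _ _ _ _ _ _ _ (dFE x y xuv)).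
have H2 : forall x y, (`]u, v[%classic : set R) x -> (setT : set (measurableTypeR R)) y -> `|partial1of2 F x y| <= G y.
  by move=> x y /uvE xuv _; rewrite d1E// dFG.
have H3 : forall x, (`]u, v[%classic : set R) x -> mu.-integrable setT (EFin \o F x).
  by move=> x /uvE xuv; exact: LF.
have Ia : (`]u, v[%classic : set R) a by apply/uvE.
have D := @derivable_under_integral R _ (measurableTypeR R) mu F setT measurableT a u v Ia H3 H1 G G0 LG H2.
have V := @differentiation_under_integral R _ (measurableTypeR R) mu F setT measurableT a u v Ia H3 H1 G G0 LG H2.
apply: DeriveDef; first exact: D.
rewrite -derive1E V; apply: (eq_Rint mu) => y; exact: d1E.
Qed.

Lemma is_derive_convol (f q dq : R -> R) (B C y : R) : L1 mu f ->
  measurable_fun setT q -> (forall x, `|q x| <= B) ->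
  (forall x : R, is_derive x 1 q (dq x)) -> (forall x, `|dq x| <= C) ->
  is_derive y 1 (convol f q) (convol f dq y).
Proof.
move=> Lf mq qB dqE dqC; rewrite /convol.
apply: (@is_derive_under_integral (fun y x => f x * q (y - x)) (fun y x => f x * dq (y - x))
  (fun x => C * `|f x|) y (y - 1) (y + 1)).
- by apply/andP; split; rewrite ?ltrBlDr ltrDl.
- by move=> x _; exact: (L1_bounded_convol x Lf mq qB).
- move=> x z _.
  have D1 : is_derive x (1 : R) (fun w : R => w - z) 1.
    by apply: is_derive_eq; rewrite subr0.
  have D2 := @is_derive1_comp R q (fun w : R => w - z) x _ _ (dqE (x - z)) D1.
  have D3 := @is_deriveZ R _ _ (q \o (fun w : R => w - z)) (f z) x 1 _ D2.
  by apply: is_derive_eq D3 _; rewrite mulr1.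
- by move=> z; rewrite mulr_ge0// (le_trans _ (dqC 0)).
- exact: (L1Z C (L1_norm Lf)).
- by move=> x z _; rewrite normrM mulrC ler_wpM2r.
Qed.

Lemma continuous_convol (f q : R -> R) (B : R) : L1 mu f ->
  continuous q -> (forall x, `|q x| <= B) -> continuous (convol f q).
Proof.
move=> Lf cq qB y.
have mq : measurable_fun setT q by exact: continuous_measurable_fun.
have := @continuity_under_integral R _ (measurableTypeR R) mu (fun y x => f x * q (y - x))
  setT measurableT (y - 1) (y + 1).
have yI : y \in (`](y - 1), (y + 1)[%classic : set R).
  by rewrite in_setE/= in_itv/= ltrBlDr !ltrDl ltr01.
move=> H; apply: (H _ _ (fun x => B * `|f x|)) => //.
- by move=> x _; exact: (L1_bounded_convol x Lf mq qB).
- apply/aeW => x _ z _; apply: cvgM; first exact: cvg_cst.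
  apply: continuous_comp; last exact: cq.
  by apply: cvgB; [exact: cvg_id|exact: cvg_cst].
- exact: (L1Z B (L1_norm Lf)).
- by move=> x _; apply/aeW => z _; rewrite normrM mulrC ler_wpM2r.
Qed.

End bounded_convolution.

(** * Fisher information of a sum *)

Section weighted.
Context d (T : measurableType d) (R : realType) (mu : {measure set T -> \bar R}).
Implicit Types G h W : T -> R.

Lemma weighted_amgm (x y w : R) : 0 < w -> `|x * y| <= x ^+ 2 * w + y ^+ 2 / w.
Proof.
move=> w0; have w0' := lt0r_neq0 w0.
have X0 : 0 <= x ^+ 2 * w by rewrite mulr_ge0 ?sqr_ge0// ltW.
have Y0 : 0 <= y ^+ 2 / w by rewrite divr_ge0 ?sqr_ge0// ltW.
have S : 0 <= (x * w - y) ^+ 2 / w by rewrite divr_ge0 ?sqr_ge0// ltW.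
have S' : 0 <= (x * w + y) ^+ 2 / w by rewrite divr_ge0 ?sqr_ge0// ltW.
have E : (x * w - y) ^+ 2 / w = x ^+ 2 * w + y ^+ 2 / w - 2 * (x * y) by field.
have E' : (x * w + y) ^+ 2 / w = x ^+ 2 * w + y ^+ 2 / w + 2 * (x * y) by field.
move: S S'; rewrite E E' ler_norml => S S'; apply/andP; split; lra.
Qed.

Lemma L1_weighted G h W : measurable_fun setT G -> measurable_fun setT h ->
  (forall x, 0 < W x) ->
  L1 mu (fun x => G x ^+ 2 * W x) -> L1 mu (fun x => h x ^+ 2 / W x) ->
  L1 mu (fun x => G x * h x).
Proof.
move=> mG mh W0 LG Lh; apply: L1_le (L1D LG Lh); first exact: measurable_funM.
by move=> x; exact: weighted_amgm.
Qed.

Lemma weighted_CauchySchwarz G h W : measurable_fun setT G -> measurable_fun setT h ->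
  (forall x, 0 < W x) ->
  L1 mu (fun x => G x ^+ 2 * W x) -> L1 mu (fun x => h x ^+ 2 / W x) ->
  (\int[mu]_x (G x * h x)) ^+ 2 <=
    (\int[mu]_x (G x ^+ 2 * W x)) * (\int[mu]_x (h x ^+ 2 / W x)).
Proof.
move=> mG mh W0 LG Lh; have LGh := L1_weighted mG mh W0 LG Lh.
have key (t : R) : 2 * t * \int[mu]_x (G x * h x) <=
    t ^+ 2 * \int[mu]_x (G x ^+ 2 * W x) + \int[mu]_x (h x ^+ 2 / W x).
  rewrite -!RintZ// -RintD//; last exact: L1Z.
  apply: Rint_le; [exact: L1Z|exact: L1D (L1Z _ _) _|move=> x].
  have w0' := lt0r_neq0 (W0 x).
  have S : 0 <= (t * G x * W x - h x) ^+ 2 / W x by rewrite divr_ge0 ?sqr_ge0// ltW.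
  have E : (t * G x * W x - h x) ^+ 2 / W x =
    t ^+ 2 * (G x ^+ 2 * W x) + h x ^+ 2 / W x - 2 * t * (G x * h x) by field.
  by rewrite E subr_ge0 in S.
have A0 : 0 <= \int[mu]_x (G x ^+ 2 * W x).
  by apply: Rint_ge0 => x; rewrite mulr_ge0 ?sqr_ge0// ltW.
have C0 : 0 <= \int[mu]_x (h x ^+ 2 / W x).
  by apply: Rint_ge0 => x; rewrite divr_ge0 ?sqr_ge0// ltW.
move: (\int[mu]_x (G x * h x)) (\int[mu]_x (G x ^+ 2 * W x))
  (\int[mu]_x (h x ^+ 2 / W x)) A0 C0 key => B A C A0 C0 key.
have [AE|A0'] := eqVneq A 0.
  have [->|B0] := eqVneq B 0; first by rewrite expr0n mulr_ge0.
  (* With [A = 0] the bound reads [2 * t * B <= C] for every [t]; this [t] violates it. *)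
  have := key ((C + 1) / B); rewrite AE mulr0 add0r -mulrA divfK//.
  by rewrite mulr_natl mulr2n; lra.
have A1 : 0 < A by rewrite lt_neqAle eq_sym A0'.
have : A * (2 * (B / A * B)) <= A * ((B / A) ^+ 2 * A + C).
  by apply: ler_wpM2l => //; rewrite mulrA; exact: key.
have -> : A * (2 * (B / A * B)) = 2 * B ^+ 2 by field.
have -> : A * ((B / A) ^+ 2 * A + C) = B ^+ 2 + A * C by field.
by rewrite mulr_natl mulr2n lerD2l.
Qed.

(** Monotone convergence along the cut-offs [c n]: a bound on the truncated integrals uniform in [n]
    yields integrability together with the bound. *)
Lemma L1_exhaust (c : nat -> T -> R) h (B : R) :
  measurable_fun setT h -> (forall x, 0 <= h x) ->
  (forall n, L1 mu (fun x => c n x * h x)) ->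
  (forall n x, 0 <= c n x <= 1) -> (forall n k x, (n <= k)%N -> c n x <= c k x) ->
  (forall x, exists n, c n x = 1) ->
  (forall n, \int[mu]_x (c n x * h x) <= B) -> L1 mu h /\ \int[mu]_x h x <= B.
Proof.
move=> mh h0 Lc c01 c_nd c1 cB.
have C := @cvg_monotone_convergence _ _ _ mu setT measurableT (fun n x => (c n x * h x)%:E).
have hE : (fun x => limn (fun n => (c n x * h x)%:E)) = EFin \o h.
  apply/funext => x; apply: cvg_lim => //; have [n cn] := c1 x.
  apply: cvg_near_cst; exists n => // k /= nk; congr EFin.
  rewrite [c k x](_ : _ = 1) ?mul1r//; apply/eqP; rewrite eq_le (andP (c01 k x)).2/=.
  by rewrite -cn c_nd.
have {}C : (fun n => \int[mu]_x (c n x * h x)%:E)%E @ \oo --> (\int[mu]_x (h x)%:E)%E.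
  rewrite [X in _ --> X](_ : _ = (\int[mu]_x limn (fun n => (c n x * h x)%:E))%E); last first.
    by apply: eq_integral => x _; have /(congr1 (fun f => f x)) := hE.
  apply: C.
  - by move=> n; apply/measurable_EFinP; exact: L1_measurable.
  - by move=> n x _; rewrite lee_fin mulr_ge0//; case/andP: (c01 n x).
  - by move=> x _ n k nk; rewrite lee_fin ler_wpM2r// c_nd.
have hB : (\int[mu]_x (h x)%:E <= B%:E)%E.
  have cv : cvgn (fun n => \int[mu]_x (c n x * h x)%:E)%E by apply/cvg_ex; eexists; exact: C.
  rewrite -(cvg_lim _ C)//; apply: lime_le => //.
  by apply: nearW => n; rewrite -EFin_Rint// lee_fin.
have Lh : L1 mu h by apply: L1_ge0 => //; exact: le_lt_trans hB (ltry _).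
by split => //; rewrite -lee_fin EFin_Rint.
Qed.

End weighted.

Section weighted_line.
Variable R : realType.
Local Notation mu := (@lebesgue_measure R).
Implicit Types G h W : R -> R.

Lemma line_weighted G h W : measurable_fun setT G -> measurable_fun setT h ->
  (forall x, 0 < W x) ->
  L1 mu (fun x => G x ^+ 2 * W x) -> L1 mu (fun x => h x ^+ 2 / W x) ->
  L1 mu (fun x => G x * h x).
Proof. by move=> mG mh; exact: (@L1_weighted _ (measurableTypeR R) R mu _ _ _ mG mh). Qed.

Lemma line_CauchySchwarz G h W : measurable_fun setT G -> measurable_fun setT h ->
  (forall x, 0 < W x) ->
  L1 mu (fun x => G x ^+ 2 * W x) -> L1 mu (fun x => h x ^+ 2 / W x) ->
  (\int[mu]_x (G x * h x)) ^+ 2 <=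
    (\int[mu]_x (G x ^+ 2 * W x)) * (\int[mu]_x (h x ^+ 2 / W x)).
Proof. by move=> mG mh; exact: (@weighted_CauchySchwarz _ (measurableTypeR R) R mu _ _ _ mG mh). Qed.

End weighted_line.

(** [j] and [i] are the Fisher informations of [p] and of the sum, [u] is the inverse variance, [r]
    the ratio of Poincaré constant to variance, and [x] the product of [j] with the integral of
    [n ^+ 2 / p]. Chaining the first three bounds leaves a slack equal to the product in the last
    one. *)
Lemma fisher_sum_algebra (R : realFieldType) (t j u r q i x : R) :
  i <= 4^-1 * q ->
  q <= 2 * ((1 - t) ^+ 2 * j + (2 * t - t ^+ 2) * u) + 4 * t ^+ 2 * x ->
  t ^+ 2 * x <= t ^+ 2 * (r * (j - u)) -> 0 <= t * (j - u) * (1 - t * (1 + 2 * r)) ->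
  2 * i <= (1 - t) * j + t * u.
Proof. lra. Qed.

Section fisher_sum.
Variable R : realType.
Local Notation mu := (@lebesgue_measure R).
Local Notation mu2 := (mu \x mu)%E.
Variables (p dp : R -> R) (m v Rt : R).
Hypotheses (Lp : L1 mu p) (p0 : forall x, 0 < p x) (p1 : \int[mu]_x p x = 1).
Hypothesis Lvar : L1 mu (fun x => (x - m) ^+ 2 * p x).
Hypothesis meanE : \int[mu]_x ((x - m) * p x) = 0.
Hypothesis varE : \int[mu]_x ((x - m) ^+ 2 * p x) = v.
Hypothesis v0 : 0 < v.
Hypotheses (Ldp : L1 mu dp) (tdp : forall y, tail dp y = - p y) (dp0 : \int[mu]_x dp x = 0).
Hypothesis LJ : L1 mu (fun x => dp x ^+ 2 / p x).
Hypothesis Rt0 : 0 <= Rt.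
Hypothesis poinc : forall a : R -> R, L1 mu a -> (exists M : R, forall x, `|a x| <= M) ->
  let g y := \int[mu]_z (step z y * a z) in
  \int[mu]_y ((g y - \int[mu]_z (g z * p z)) ^+ 2 * p y) <= Rt * \int[mu]_y (a y ^+ 2 * p y).

Local Notation J := (\int[mu]_x (dp x ^+ 2 / p x)).

Let mp : measurable_fun setT p. Proof. exact: L1_line_measurable. Qed.
Let mdp : measurable_fun setT dp. Proof. exact: L1_line_measurable. Qed.
Let mxm : measurable_fun setT (fun x : R => x - m). Proof. by mfun. Qed.
Let mpV : measurable_fun setT (fun x : R => (p x)^-1).
Proof. exact: (measurableT_comp (@measurable_invr R)). Qed.

Let p_sq x : p x ^+ 2 / p x = p x.
Proof. by rewrite expr2 mulfK// gt_eqF. Qed.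

Let Lmean : L1 mu (fun x => (x - m) * p x).
Proof.
apply: line_weighted mxm mp p0 Lvar _; apply: eq_L1 Lp => x; by rewrite p_sq.
Qed.

Let Lmdp : L1 mu (fun x => (x - m) * dp x).
Proof. exact: line_weighted mxm mdp p0 Lvar LJ. Qed.

Let mdpE : \int[mu]_x ((x - m) * dp x) = -1.
Proof.
have [_ <-] := tail_moment Ldp Lmdp dp0.
rewrite -p1 -RintN//; apply: (eq_Rint mu) => x; exact: tdp.
Qed.

(** The Cramér-Rao bound: Cauchy-Schwarz between [x - m] and the score, whose covariance is -1 by
    integration by parts. *)
Lemma fisher_ge : 1 <= v * J.
Proof.
have := line_CauchySchwarz mxm mdp p0 Lvar LJ.
by rewrite mdpE varE sqrrN expr1n.
Qed.

Let J0 : 0 < J.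
Proof.
by rewrite -(pmulr_rgt0 _ v0) (lt_le_trans _ fisher_ge).
Qed.

(** The Stein kernel multiplied by [p]. Keeping the factor [p] makes it, like [dp] for the score, an
    integrable function on the line. *)
Let P1 := tail (fun x => (x - m) * p x).

Let P1_moment : L1 mu P1 /\ \int[mu]_x P1 x = v.
Proof.
have [|H1 H2] := @tail_moment _ (fun x => (x - m) * p x) m Lmean _ meanE.
  by apply: eq_L1 Lvar => x; rewrite mulrA expr2.
split => //; rewrite H2 -varE; apply: (eq_Rint mu) => x; by rewrite mulrA expr2.
Qed.

Let mP1 : measurable_fun setT P1. Proof. exact: (measurable_tail Lmean). Qed.

Let score_var (b c : R) : L1 mu (fun x => (b * dp x + c * ((x - m) * p x)) ^+ 2 / p x) /\
  \int[mu]_x ((b * dp x + c * ((x - m) * p x)) ^+ 2 / p x) = b ^+ 2 * J - 2 * b * c + c ^+ 2 * v.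
Proof.
have E x : (b * dp x + c * ((x - m) * p x)) ^+ 2 / p x =
    b ^+ 2 * (dp x ^+ 2 / p x) + ((2 * b * c) * ((x - m) * dp x) + c ^+ 2 * ((x - m) ^+ 2 * p x)).
  by field; rewrite gt_eqF.
have L := L1D (L1Z (2 * b * c) Lmdp) (L1Z (c ^+ 2) Lvar).
split; first by apply: eq_L1 (L1D (L1Z (b ^+ 2) LJ) L) => x; rewrite E.
transitivity (\int[mu]_x (b ^+ 2 * (dp x ^+ 2 / p x) +
    ((2 * b * c) * ((x - m) * dp x) + c ^+ 2 * ((x - m) ^+ 2 * p x)))).
  by apply: (eq_Rint mu) => x; rewrite E.
rewrite RintD//; last exact: (L1Z _ LJ).
rewrite RintD; [|exact: (L1Z _ Lmdp)|exact: (L1Z _ Lvar)].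
rewrite !RintZ// mdpE varE mulrN1; by rewrite addrA.
Qed.

(** [N] is the tail of [h], so for the primitive [g] of [a] the integral of [a * N] is that of
    [g * h], a covariance. Cauchy-Schwarz and the Poincaré inequality with [a = N / p] give
    [Q ^+ 2 <= Rt * Q * D], where [Q] and [D] are the integrals of [N ^+ 2 / p] and [h ^+ 2 / p].
    The cut-off makes [a] admissible and [Q] finite, so that one factor [Q] can be cancelled. *)
Let dual_poincare (c : R) : L1 mu (fun x => (c * P1 x - p x) ^+ 2 / p x) /\
  \int[mu]_x ((c * P1 x - p x) ^+ 2 / p x) <= Rt * (J - 2 * c + c ^+ 2 * v).
Proof.
pose h x := 1 * dp x + c * ((x - m) * p x).
pose N x := c * P1 x - p x.
have Lh : L1 mu h by exact: (L1D (L1Z 1 Ldp) (L1Z c Lmean)).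
have mh := L1_line_measurable Lh.
have tE y : tail h y = N y.
  by rewrite tailD//; [rewrite !tailZ// mul1r tdp addrC|exact: (L1Z 1 Ldp)|exact: (L1Z c Lmean)].
have h0 : \int[mu]_x h x = 0.
  by rewrite RintD//; [rewrite !RintZ// dp0 meanE !mulr0 addr0|exact: (L1Z 1 Ldp)|exact: (L1Z c Lmean)].
have [LV VE] := score_var 1 c; rewrite expr1n !mul1r mulr1 in VE.
have mN : measurable_fun setT N by apply: measurable_funB => //; apply: measurable_funM => //.
have LN : L1 mu N by apply: L1B => //; apply: L1Z; exact: P1_moment.1.
(* The summand 1 keeps [p] above [1 / n], so [|a|] is at most [n * |N|] and integrable; the summand
   [|N x|] makes [a] bounded by [n]. *)
pose cut (n : nat) (x : R) : R := if 1 + `|N x| <= n%:R * p x then 1 else 0.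
have mcut n : measurable_fun setT (cut n).
  apply: measurable_fun_ifT; [|exact: measurable_cst..].
  apply: measurable_fun_ler; last by apply: measurable_funM => //; exact: measurable_cst.
  by apply: measurable_funD; [exact: measurable_cst|exact: (measurableT_comp (@normr_measurable R setT) mN)].
have cut01 n x : 0 <= cut n x <= 1 by rewrite /cut; case: ifP; rewrite ?ler01 ?lexx.
have cut2 n x : cut n x ^+ 2 = cut n x by rewrite /cut; case: ifP; rewrite ?expr1n ?expr0n.
have cut_nd n k x : (n <= k)%N -> cut n x <= cut k x.
  move=> nk; rewrite /cut; case: ifP => H; last by case: ifP.
  by rewrite (le_trans H)// ler_wpM2r ?ler_nat// ltW.
have cut1 x : exists n, cut n x = 1.
  exists (Num.truncn ((1 + `|N x|) / p x)).+1.
  by rewrite /cut -ler_pdivrMr ?p0// ltW// truncnS_gt.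
pose a n x := cut n x * (N x / p x).
have ma n : measurable_fun setT (a n) by apply: measurable_funM => //; exact: measurable_funM.
have a_le n x : `|a n x| <= n%:R.
  rewrite /a /cut; case: ifP => H; last by rewrite mul0r normr0 ler0n.
  by rewrite mul1r normf_div [`|p x|]gtr0_norm// ler_pdivrMr// (le_trans _ H)// lerDr.
have a_le1 n x : `|a n x| <= n%:R * `|N x|.
  rewrite /a /cut; case: ifP => H; last by rewrite mul0r normr0 mulr_ge0// ler0n.
  rewrite mul1r normf_div [`|p x|]gtr0_norm// mulrC ler_wpM2r//.
  by rewrite -[leLHS]mul1r ler_pdivrMr// (le_trans _ H)// lerDl.
have La n : L1 mu (a n).
  by apply: L1_le (L1Z n%:R (L1_norm LN)); [exact: ma|exact: a_le1].
have LaN n : L1 mu (fun x => a n x * N x).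
  apply: L1_le (L1Z n%:R (L1_norm LN)); first exact: (measurable_funM (ma n) mN).
  by move=> x; rewrite normrM ler_wpM2r.
have aNE n x : a n x * N x = cut n x * (N x ^+ 2 / p x) by rewrite /a; ring.
have a2E n x : a n x ^+ 2 * p x = cut n x * (N x ^+ 2 / p x).
  by rewrite /a exprMn cut2; field; rewrite gt_eqF.
have bound n : \int[mu]_x (cut n x * (N x ^+ 2 / p x)) <= Rt * (J - 2 * c + c ^+ 2 * v).
  pose g y := \int[mu]_z (step z y * a n z).
  set Q := \int[mu]_x _.
  have QE : \int[mu]_y (g y * h y) = Q.
    rewrite tail_dual//; apply: (eq_Rint mu) => x; by rewrite tE aNE.
  have P : \int[mu]_y ((g y - \int[mu]_z (g z * p z)) ^+ 2 * p y) <= Rt * Q.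
    have := poinc (La n) (ex_intro _ n%:R (a_le n)).
    rewrite (_ : \int[mu]_y (a n y ^+ 2 * p y) = Q)//.
    by apply: (eq_Rint mu) => x; rewrite a2E.
  pose gb := \int[mu]_z (g z * p z).
  have mg : measurable_fun setT g by exact: measurable_primitive.
  have gB y : `|g y - gb| <= \int[mu]_z `|a n z| + `|gb|.
    by rewrite (le_trans (ler_normB _ _))// lerD2r norm_primitive.
  have mG : measurable_fun setT (fun y => g y - gb) by apply: measurable_funB => //; exact: measurable_cst.
  have LG : L1 mu (fun y => (g y - gb) ^+ 2 * p y).
    apply: L1_le (L1Z ((\int[mu]_z `|a n z| + `|gb|) ^+ 2) Lp) => [|y].
      exact: (measurable_funM (measurable_funX 2 mG) mp).
    rewrite normrM [`|p y|]gtr0_norm// ler_wpM2r ?(ltW (p0 y))//.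
    by rewrite normrX lerXn2r// nnegrE (le_trans _ (gB y)).
  have LGh := line_weighted mG mh p0 LG LV.
  have := line_CauchySchwarz mG mh p0 LG LV.
  have -> : \int[mu]_x ((g x - gb) * h x) = Q.
    rewrite -QE -[LHS]addr0 -[X in _ + X](mulr0 gb) -h0 -RintZ// -RintD//; last exact: L1Z.
    by apply: (eq_Rint mu) => x; rewrite mulrBl subrK.
  rewrite VE => CS.
  have Q0 : 0 <= Q.
    by apply: Rint_ge0 => x; rewrite mulr_ge0 ?(andP (cut01 n x)).1// divr_ge0 ?sqr_ge0// ltW.
  have D0 : 0 <= J - 2 * c + c ^+ 2 * v.
    by rewrite -VE; apply: Rint_ge0 => x; rewrite divr_ge0 ?sqr_ge0// ltW.
  have {CS} : Q ^+ 2 <= Rt * Q * (J - 2 * c + c ^+ 2 * v).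
    by apply: le_trans CS _; rewrite ler_wpM2r.
  move: Q0; rewrite le_eqVlt => /orP[/eqP <-|Q0]; first by rewrite mulr_ge0.
  by rewrite mulrAC expr2 ler_pM2r.
have Z x : 0 <= N x ^+ 2 / p x by rewrite divr_ge0 ?sqr_ge0// ltW.
apply: (@L1_exhaust _ (measurableTypeR R) R mu cut) => //.
- exact: (measurable_funM (measurable_funX 2 mN) mpV).
- by move=> n; apply: eq_L1 (LaN n) => x; rewrite aNE.
Qed.



(** Square integrability of the kernel has to be earned: [P1] is recovered from [J * P1 - p] and
    [p], both of finite weighted norm, and [2 / J ^+ 2] comes from bounding the square of a sum. *)
Let LK : L1 mu (fun x => P1 x ^+ 2 / p x).
Proof.
have [L _] := dual_poincare J.
apply: L1_le (L1Z (2 / J ^+ 2) (L1D L Lp)) => [|x].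
  exact: (measurable_funM (measurable_funX 2 mP1) mpV).
have J0' := lt0r_neq0 J0; have p0' := lt0r_neq0 (p0 x).
rewrite ger0_norm; last by rewrite divr_ge0 ?sqr_ge0// ltW.
have : 0 <= ((J * P1 x - p x) - p x) ^+ 2 / (J ^+ 2 * p x).
  by rewrite divr_ge0 ?sqr_ge0// mulr_ge0 ?sqr_ge0// ltW.
move: J J0' (P1 x) (p x) p0' => j j0 P q q0.
have -> : 2 / j ^+ 2 * ((j * P - q) ^+ 2 / q + q) =
  P ^+ 2 / q + ((j * P - q) - q) ^+ 2 / (j ^+ 2 * q) by field; rewrite j0 q0.
by rewrite lerDl.
Qed.

Let kernel_var (c : R) : L1 mu (fun x => (c * P1 x - p x) ^+ 2 / p x) /\
  \int[mu]_x ((c * P1 x - p x) ^+ 2 / p x) = c ^+ 2 * \int[mu]_x (P1 x ^+ 2 / p x) - 2 * c * v + 1.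
Proof.
have E x : (c * P1 x - p x) ^+ 2 / p x = c ^+ 2 * (P1 x ^+ 2 / p x) - (2 * c) * P1 x + p x.
  by field; rewrite gt_eqF.
have [LP EP] := P1_moment.
have L := L1B (L1Z (c ^+ 2) LK) (L1Z (2 * c) LP).
split; first by apply: eq_L1 (L1D L Lp) => x; rewrite E.
transitivity (\int[mu]_x (c ^+ 2 * (P1 x ^+ 2 / p x) - (2 * c) * P1 x + p x)).
  by apply: (eq_Rint mu) => x; rewrite E.
by rewrite RintD// RintB ?RintZ// ?EP ?p1//; exact: L1Z.
Qed.

(** As with [P1], the density is kept as a factor: this is [K / v - 1] multiplied by [p]. *)
Let n x := P1 x / v - p x.

(** At [c = 1 / v] the duality would only give [Rt * J * (J - 1 / v)], quadratic in [J]. At [c = J]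
    it gives a bound linear in [J], after discarding the square of [J * v - 1]. *)
Let stein_var : J * \int[mu]_x (n x ^+ 2 / p x) <= Rt / v * (J - v^-1).
Proof.
have [_ +] := dual_poincare J; have [_ ->] := kernel_var J.
have -> : \int[mu]_x (n x ^+ 2 / p x) = \int[mu]_x ((v^-1 * P1 x - p x) ^+ 2 / p x).
  by apply: (eq_Rint mu) => x; rewrite /n [P1 x / v]mulrC.
have [_ ->] := kernel_var v^-1.
have := fisher_ge; have := J0; move: J (\int[mu]_x (P1 x ^+ 2 / p x)) => j S j0 vj H.
have v0' := lt0r_neq0 v0.
rewrite -(ler_pM2r j0) -(ler_pM2r v0) -(ler_pM2r v0).
have -> : j * (v^-1 ^+ 2 * S - 2 * v^-1 * v + 1) * j * v * v = j ^+ 2 * S - (j * v) ^+ 2 by field.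
have -> : Rt / v * (j - v^-1) * j * v * v = Rt * (j ^+ 2 * v - j) by field.
have : 0 <= (j * v - 1) ^+ 2 by rewrite sqr_ge0.
move: H; have -> : j - 2 * j + j ^+ 2 * v = j ^+ 2 * v - j by ring.
by move: (Rt * _) (j ^+ 2 * S) => u w; rewrite exprMn sqrrB1 exprMn mulr2n; lra.
Qed.

Let h x := dp x + v^-1 * ((x - m) * p x).

Let Lh : L1 mu h. Proof. exact: (L1D Ldp (L1Z _ Lmean)). Qed.

Let th y : tail h y = n y.
Proof.
by rewrite tailD//; [rewrite tailZ// tdp addrC /n mulrC|exact: (L1Z _ Lmean)].
Qed.

Let Ln : L1 mu n. Proof. exact: (L1B (L1Zr _ P1_moment.1) Lp). Qed.

Let Rint_n : \int[mu]_x n x = 0.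
Proof.
rewrite RintB//; last exact: (L1Zr _ P1_moment.1).
by rewrite RintZr ?P1_moment.1// P1_moment.2 p1 divff ?subrr// lt0r_neq0.
Qed.

Let Lnn : L1 mu (fun x => n x ^+ 2 / p x).
Proof. by apply: eq_L1 (kernel_var v^-1).1 => x; rewrite /n [P1 x / v]mulrC. Qed.

Let p_le y : `|p y| <= \int[mu]_x `|dp x|.
Proof. by rewrite -normrN -tdp norm_tail. Qed.

Let n_le y : `|n y| <= \int[mu]_x `|h x|.
Proof. by rewrite -th norm_tail. Qed.

Let primitive_dp (s y : R) : \int[mu]_z (step z y * dp (s - z)) = - p (s - y).
Proof.
rewrite -tdp /tail -(Rint_reflect s (L1_step (s - y) Ldp)).
by apply: (eq_Rint mu) => z; rewrite /step ltrD2l ltrN2.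
Qed.

(** Integration by parts on the fibre [x + y = s]: [n] is the tail of [h], and the primitive of
    [dp (s - x)] is [- p (s - x)]. *)
Let fiber_identity s : \int[mu]_x (h x * p (s - x)) = - \int[mu]_x (n x * dp (s - x)).
Proof.
have E := tail_dual (L1_reflect s Ldp) Lh.
have -> : \int[mu]_x (n x * dp (s - x)) = \int[mu]_z (dp (s - z) * tail h z).
  by apply: (eq_Rint mu) => z; rewrite th mulrC.
rewrite -E -RintN.
  by apply: (eq_Rint mu) => y; rewrite primitive_dp mulNr opprK mulrC.
apply: eq_L1 (L1N (L1_bounded_convol s Lh mp p_le)) => y.
by rewrite primitive_dp mulNr mulrC.
Qed.

Variable t : R.
Hypotheses (t0 : 0 <= t) (tR : t * (1 + 2 * Rt / v) <= 1).

Let al x := dp x - t * h x.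

(** Divided by [p z.1 * p z.2], this has conditional mean, given the sum, equal to twice the score
    of the sum: the terms with the factor [t], including the one inside [al], cancel on each fibre
    by [fiber_identity]. *)
Let HP (z : R * R) := al z.1 * p z.2 + p z.1 * al z.2 - t * (n z.1 * dp z.2 + dp z.1 * n z.2).

Let mh : measurable_fun setT h. Proof. exact: L1_line_measurable. Qed.
Let mn : measurable_fun setT n. Proof. exact: L1_line_measurable. Qed.
Let Lal : L1 mu al. Proof. exact: (L1B Ldp (L1Z t Lh)). Qed.
Let mal : measurable_fun setT al. Proof. exact: L1_line_measurable. Qed.

Let Rint_h : \int[mu]_x h x = 0.
Proof.
by rewrite RintD//; [rewrite !RintZ// dp0 meanE !mulr0 addr0|exact: (L1Z _ Lmean)].
Qed.

Let Rint_al : \int[mu]_x al x = 0.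
Proof. by rewrite RintB//; [rewrite RintZ// Rint_h dp0 mulr0 subr0|exact: L1Z]. Qed.

Let al_var : L1 mu (fun x => al x ^+ 2 / p x) /\
  \int[mu]_x (al x ^+ 2 / p x) = (1 - t) ^+ 2 * J + (2 * t - t ^+ 2) / v.
Proof.
have E x : al x ^+ 2 / p x = ((1 - t) * dp x + (- (t / v)) * ((x - m) * p x)) ^+ 2 / p x.
  by congr (_ ^+ 2 / _); rewrite /al /h; ring.
have [L V] := score_var (1 - t) (- (t / v)).
split; first by apply: eq_L1 L => x; rewrite E.
transitivity (\int[mu]_x (((1 - t) * dp x + (- (t / v)) * ((x - m) * p x)) ^+ 2 / p x)).
  by apply: (eq_Rint mu) => x.
rewrite V -addrA; congr (_ + _); field.
by rewrite lt0r_neq0.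
Qed.

Let fiber_sum s : L1 mu (fun x => HP (x, s - x)) /\ \int[mu]_x HP (x, s - x) = 2 * convol p dp s.
Proof.
have L1p := L1_bounded_convol s Ldp mp p_le.
have L2p := L1_bounded_convol s Lh mp p_le.
have L3p := L1_bounded_convol s Ldp mn n_le.
have L1q := L1_convol_sym L1p; have L2q := L1_convol_sym L2p; have L3q := L1_convol_sym L3p.
have E x : HP (x, s - x) = (dp x * p (s - x) + p x * dp (s - x))
    + (- t) * ((h x * p (s - x) + p x * h (s - x)) + (n x * dp (s - x) + dp x * n (s - x))).
  by rewrite /HP /al /=; ring.
have L := L1D (L1D L1p L1q) (L1Z (- t) (L1D (L1D L2p L2q) (L1D L3q L3p))).
split; first by apply: eq_L1 L => x; rewrite E.
rewrite (eq_Rint mu E) RintD; [|exact: (L1D L1p L1q)|exact: (L1Z (- t) (L1D (L1D L2p L2q) (L1D L3q L3p)))].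
rewrite RintZ; last exact: (L1D (L1D L2p L2q) (L1D L3q L3p)).
rewrite RintD// RintD; [|exact: (L1D L2p L2q)|exact: (L1D L3q L3p)].
rewrite RintD// RintD//.
rewrite (Rint_convol_sym L1q) (Rint_convol_sym L2p) (Rint_convol_sym L3q) fiber_identity.
rewrite /convol; move: (\int[mu]_x (n x * dp (s - x))) (\int[mu]_x (p x * dp (s - x))) => X Y.
by ring.
Qed.

Let L1_quotient (a b : R -> R) : measurable_fun setT a -> measurable_fun setT b ->
  L1 mu (fun x => a x ^+ 2 / p x) -> L1 mu (fun x => b x ^+ 2 / p x) ->
  L1 mu (fun x => a x * b x / p x).
Proof.
move=> ma mb La Lb.
have := @line_weighted _ (fun x => a x / p x) b p (measurable_funM ma mpV) mb p0 _ Lb.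
move=> H; apply: eq_L1 (H _) => [x|]; first by rewrite mulrAC.
by apply: eq_L1 La => x; field; rewrite lt0r_neq0.
Qed.

Let V0 := \int[mu]_x (n x ^+ 2 / p x).
Let a2 x := al x ^+ 2 / p x.
Let n2 x := n x ^+ 2 / p x.
Let d2 x := dp x ^+ 2 / p x.
Let an x := al x * n x / p x.
Let ad x := al x * dp x / p x.

(** The pieces of the expanded square of [HP]: the square of the part with [al], half a bound for
    the square of the product part, and the cross product of the two. *)
Let U1 (z : R * R) := a2 z.1 * p z.2 + p z.1 * a2 z.2 + 2 * (al z.1 * al z.2).
Let U2 (z : R * R) := n2 z.1 * d2 z.2 + d2 z.1 * n2 z.2.
Let U3 (z : R * R) := an z.1 * dp z.2 + ad z.1 * n z.2 + (n z.1 * ad z.2 + dp z.1 * an z.2).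

Let La2 : L1 mu a2. Proof. exact: al_var.1. Qed.
Let Lan : L1 mu an. Proof. exact: L1_quotient. Qed.
Let Lad : L1 mu ad. Proof. exact: L1_quotient. Qed.

Let U1_int : L1 mu2 U1 /\ \int[mu2]_z U1 z = 2 * \int[mu]_x a2 x.
Proof.
have A := L1_prodM La2 Lp; have B := L1_prodM Lp La2; have C := L1_prodM Lal Lal.
split; first exact: (L1D (L1D A B) (L1Z 2 C)).
rewrite RintD; [|exact: (L1D A B)|exact: (L1Z 2 C)].
rewrite RintD// RintZ// !Rint_prodM// p1 Rint_al.
by move: (\int[mu]_x a2 x) => X; ring.
Qed.

Let U2_int : L1 mu2 U2 /\ \int[mu2]_z U2 z = 2 * (J * V0).
Proof.
have A := L1_prodM Lnn LJ; have B := L1_prodM LJ Lnn.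
split; first exact: (L1D A B).
rewrite RintD// !Rint_prodM// /V0 /d2.
by move: J (\int[mu]_x (n x ^+ 2 / p x)) => X Y; ring.
Qed.

(** Every summand separates the variables and has [n] or [dp] alone in one of them, and both have
    integral 0. *)
Let U3_int : L1 mu2 U3 /\ \int[mu2]_z U3 z = 0.
Proof.
have A := L1_prodM Lan Ldp; have B := L1_prodM Lad Ln.
have C := L1_prodM Ln Lad; have D := L1_prodM Ldp Lan.
split; first exact: (L1D (L1D A B) (L1D C D)).
rewrite RintD; [|exact: (L1D A B)|exact: (L1D C D)].
by rewrite RintD// RintD// !Rint_prodM// dp0 Rint_n !mul0r !mulr0 !addr0.
Qed.

(** The two sides differ by a nonnegative multiple of the square of
    [n z.1 * dp z.2 - dp z.1 * n z.2]. *)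
Let HP_le z : HP z ^+ 2 / (p z.1 * p z.2) <= U1 z + (2 * t ^+ 2) * U2 z - (2 * t) * U3 z.
Proof.
have px := lt0r_neq0 (p0 z.1); have py := lt0r_neq0 (p0 z.2).
have S : 0 <= t ^+ 2 * (n z.1 * dp z.2 - dp z.1 * n z.2) ^+ 2 / (p z.1 * p z.2).
  by apply: divr_ge0; apply: mulr_ge0; rewrite ?sqr_ge0// ltW.
rewrite -subr_ge0 (_ : _ - _ = t ^+ 2 * (n z.1 * dp z.2 - dp z.1 * n z.2) ^+ 2 / (p z.1 * p z.2))//.
rewrite /HP /U1 /U2 /U3 /a2 /n2 /d2 /an /ad.
by move: (p z.1) (p z.2) px py (al z.1) (al z.2) (n z.1) (n z.2) (dp z.1) (dp z.2) => *; field; apply/andP.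
Qed.

Let mHP : measurable_fun setT (fun z => HP z ^+ 2 / (p z.1 * p z.2)).
Proof.
have m1 (a : R -> R) : measurable_fun setT a -> measurable_fun setT (fun z : R * R => a z.1).
  by move=> ma; apply: (measurableT_comp ma); mfun.
have m2 (a : R -> R) : measurable_fun setT a -> measurable_fun setT (fun z : R * R => a z.2).
  by move=> ma; apply: (measurableT_comp ma); mfun.
apply: measurable_funM; last first.
  apply: (measurableT_comp (@measurable_invr R)).
  by apply: measurable_funM; [exact: m1|exact: m2].
apply: measurable_funX; apply: measurable_funB.
  by apply: measurable_funD; apply: measurable_funM; [exact: m1|exact: m2|exact: m1|exact: m2].
apply: measurable_funM; first exact: measurable_cst.
by apply: measurable_funD; apply: measurable_funM; [exact: m1|exact: m2|exact: m1|exact: m2].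
Qed.

Let HP_int : L1 mu2 (fun z => HP z ^+ 2 / (p z.1 * p z.2)) /\
  \int[mu2]_z (HP z ^+ 2 / (p z.1 * p z.2)) <= 2 * \int[mu]_x a2 x + 4 * t ^+ 2 * (J * V0).
Proof.
have [L1U E1] := U1_int; have [L2U E2] := U2_int; have [L3U E3] := U3_int.
have L12 := L1D L1U (L1Z (2 * t ^+ 2) L2U).
have L := L1B L12 (L1Z (2 * t) L3U).
have LH : L1 mu2 (fun z => HP z ^+ 2 / (p z.1 * p z.2)).
  apply: L1_le L => [|z]; first exact: mHP.
  by rewrite ger0_norm ?HP_le// divr_ge0 ?sqr_ge0// mulr_ge0// ltW.
split => //; apply: (le_trans (Rint_le LH L HP_le)).
rewrite RintB//; last exact: (L1Z _ L3U).
rewrite RintD//; last exact: (L1Z _ L2U).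
rewrite !RintZ// E1 E2 E3 mulr0 subr0.
by move: (\int[mu]_x a2 x) (J * V0) => X Y; rewrite lerD2l le_eqVlt; apply/orP; left; apply/eqP; ring.
Qed.

Let w := convol p p.
Let dw := convol p dp.

Let measurable_dw : measurable_fun setT dw. Proof. exact: L1_line_measurable (L1_convol Lp Ldp). Qed.
Let measurable_w : measurable_fun setT w. Proof. exact: L1_line_measurable (L1_convol Lp Lp). Qed.

(** The projection is Cauchy-Schwarz on each fibre with the weight [p x * p (s - x)], of mass [w s];
    the factor 4 is the square of the 2 in [fiber_sum]. Integrating over [s] returns the plane
    integral of [HP], whose product term is controlled by [stein_var]. *)
Lemma fisher_sum_le : L1 mu (fun s => dw s ^+ 2 / w s) /\
  2 * \int[mu]_s (dw s ^+ 2 / w s) <= (1 - t) * J + t / v.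
Proof.
have [LH EH] := HP_int.
have LU := L1_unshear LH.
have aeL := ae_integrable2 LU.
have LQ := L1_fubini2 LU.
pose Q s := \int[mu]_x (HP (x, s - x) ^+ 2 / (p x * p (s - x))).
have Q0 s : 0 <= Q s.
  by apply: Rint_ge0 => x; rewrite divr_ge0 ?sqr_ge0// mulr_ge0// ltW.
have w0 s : 0 <= w s by apply: convol_ge0 => x; exact: ltW.
have fib (s : R) : L1 mu (fun x => HP (x, s - x) ^+ 2 / (p x * p (s - x))) ->
    `|dw s ^+ 2 / w s| <= 4^-1 * Q s.
  move=> Ls; rewrite ger0_norm; last by rewrite divr_ge0 ?sqr_ge0.
  have LW := L1_bounded_convol s Lp mp p_le.
  have W0 (x : R) : 0 < p x * p (s - x) by rewrite mulr_gt0.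
  have mHs := L1_line_measurable (fiber_sum s).1.
  have LW' : L1 mu (fun x : R => 1 ^+ 2 * (p x * p (s - x))) by apply: eq_L1 LW => x; rewrite expr1n mul1r.
  have := line_CauchySchwarz (measurable_cst (1 : R)) mHs W0 LW' Ls.
  have -> : \int[mu]_x (1 * HP (x, s - x)) = 2 * dw s.
    by rewrite -(fiber_sum s).2; apply: (eq_Rint mu) => x; rewrite mul1r.
  have -> : \int[mu]_x (1 ^+ 2 * (p x * p (s - x))) = w s.
    by apply: (eq_Rint mu) => x; rewrite expr1n mul1r.
  rewrite -/(Q s) => CS.
  have [->|ws0] := eqVneq (w s) 0; first by rewrite invr0 mulr0 mulr_ge0// invr_ge0.
  have ws : 0 < w s by rewrite lt_neqAle eq_sym ws0 w0.
  rewrite ler_pdivrMr// -(ler_pM2l (ltr0n _ 4)).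
  have -> : 4 * dw s ^+ 2 = (2 * dw s) ^+ 2 by ring.
  suff -> : 4 * (4^-1 * Q s * w s) = w s * Q s by exact: CS.
  by move: (Q s) (w s) => X Y; field.
have aeF : {ae mu, forall s, `|dw s ^+ 2 / w s| <= 4^-1 * Q s} by apply: ae_imp aeL => s; exact: fib.
have mq : measurable_fun setT (fun s => dw s ^+ 2 / w s).
  apply: measurable_funM; first exact: measurable_funX.
  exact: (measurableT_comp (@measurable_invr R)).
have Lq : L1 mu (fun s => dw s ^+ 2 / w s) by apply: L1_ae_le (L1Z 4^-1 LQ) => //; exact: aeF.
split => //.
have I : \int[mu]_s (dw s ^+ 2 / w s) <= 4^-1 * \int[mu]_s Q s.
  rewrite -RintZ//; apply: Rint_ae_le => //; first exact: L1Z.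
  by apply: ae_imp aeF => s; exact: le_trans (ler_norm _).
have EQ : \int[mu]_s Q s <= 2 * \int[mu]_x a2 x + 4 * t ^+ 2 * (J * V0).
  by move: EH; rewrite (Rint_unshear LH).
have := stein_var; rewrite -/V0 => SV; have := fisher_ge; move: I EQ.
rewrite al_var.2; move: (J * V0) (\int[mu]_s Q s) (\int[mu]_s (dw s ^+ 2 / w s)) SV.
move: J => j X q I SV H1 H2 H3.
pose u := v^-1; pose r := Rt / v.
have s0 : 0 <= j - u by rewrite subr_ge0 /u -[leLHS]mul1r ler_pdivrMr// mulrC.
have K : 0 <= t * (j - u) * (1 - t * (1 + 2 * r)).
  by rewrite mulr_ge0 ?(mulr_ge0 t0 s0)// subr_ge0 /r mulrA.
have X2 : t ^+ 2 * X <= t ^+ 2 * (r * (j - u)) by apply: ler_wpM2l => //; rewrite sqr_ge0.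
exact: fisher_sum_algebra H1 H2 X2 K.
Qed.

End fisher_sum.

(** * The heat kernel *)

Section heat_kernel.
Variable R : realType.
Local Notation mu := (@lebesgue_measure R).
Implicit Types (t z : R).

(** The normal density of variance [t]. The factor [1 / sqrt t] is put into the exponent so that
    differentiation in [t] only meets [ln] and [expR]. *)
Definition heat t z : R := normal_peak 1 * expR (- (2^-1 * ln t) - z ^+ 2 / (2 * t)).
Definition dheat t z : R := - (z / t) * heat t z.
Definition ddheat t z : R := (z ^+ 2 / t ^+ 2 - t^-1) * heat t z.

Lemma heatE t : 0 < t -> heat t = normal_pdf 0 (Num.sqrt t).
Proof.
move=> t0; apply/funext => z; have s0 : 0 < Num.sqrt t by rewrite sqrtr_gt0.
rewrite normal_pdf_expE ?lt0r_neq0// normal_peakE// /heat.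
have -> : (Num.sqrt t)^-1 = expR (- (2^-1 * ln t)).
  rewrite expRN; congr (_^-1); rewrite -{1}(lnK (x := t)) ?posrE//.
  by rewrite -powR12_sqrt ?expR_ge0// /powR gt_eqF ?expR_gt0// expRK.
rewrite expRD mulrA sqr_sqrtr ?ltW// subr0; congr (_ * expR _).
by rewrite mulNr [2 * t]mulrC.
Qed.

Lemma heat_gt0 t z : 0 < heat t z.
Proof. by rewrite /heat mulr_gt0 ?expR_gt0// normal_peak_gt0// oner_neq0. Qed.

Lemma heat_ge0 t z : 0 <= heat t z. Proof. exact: ltW (heat_gt0 _ _). Qed.

Lemma measurable_heat t : measurable_fun setT (heat t).
Proof.
apply: measurable_funM; first exact: measurable_cst.
apply: (measurableT_comp (@measurable_expR R)); apply: measurable_funB; first exact: measurable_cst.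
by mfun.
Qed.

Lemma L1_heat t : 0 < t -> L1 mu (heat t).
Proof. by move=> t0; rewrite heatE//; exact: L1_normal. Qed.

Lemma Rint_heat t : 0 < t -> \int[mu]_z heat t z = 1.
Proof. by move=> t0; rewrite heatE//; exact: Rint_normal. Qed.

Lemma L1_pow_heat (k : nat) t : 0 < t -> L1 mu (fun z => z ^+ (2 * k) * heat t z).
Proof. by move=> t0; rewrite heatE//; apply: L1_pow_normal; rewrite sqrtr_gt0. Qed.

Lemma L1_id_heat t : 0 < t -> L1 mu (fun z => z * heat t z).
Proof. by move=> t0; rewrite heatE//; apply: L1_id_normal; rewrite sqrtr_gt0. Qed.

Lemma Rint_id_heat t : 0 < t -> \int[mu]_z (z * heat t z) = 0.
Proof. by move=> t0; rewrite heatE//; apply: Rint_id_normal; rewrite sqrtr_gt0. Qed.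

Lemma heat_le t z : 0 < t -> heat t z <= heat t 0.
Proof.
move=> t0; rewrite /heat ler_pM2l ?normal_peak_gt0 ?oner_neq0// ler_expR lerD2l lerN2.
by rewrite expr0n/= mul0r divr_ge0 ?sqr_ge0// mulr_ge0// ltW.
Qed.

Lemma ln_heat t z : ln (heat t z) = ln (normal_peak 1) - 2^-1 * ln t - z ^+ 2 / (2 * t).
Proof.
by rewrite /heat lnM ?posrE ?expR_gt0 ?normal_peak_gt0 ?oner_neq0// expRK addrA.
Qed.

Lemma is_derive_heat t z : 0 < t -> is_derive z 1 (heat t) (dheat t z).
Proof.
move=> t0; rewrite /heat /dheat.
apply: is_derive_eq; rewrite /heat /GRing.scale/=.
by move: (expR _) => E; field; rewrite lt0r_neq0.
Qed.

Lemma is_derive_dheat t z : 0 < t -> is_derive z 1 (dheat t) (ddheat t z).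
Proof.
move=> t0; rewrite /dheat /ddheat; have D := is_derive_heat z t0.
apply: is_derive_eq; rewrite /dheat /GRing.scale/=.
by move: (heat t z) => E; field; rewrite lt0r_neq0.
Qed.

(** This is the heat equation; the factor 1/2 reflects that time is variance. *)
Lemma is_derive_heat_time t z : 0 < t -> is_derive t 1 (fun s => heat s z) (2^-1 * ddheat t z).
Proof.
move=> t0; rewrite /heat /ddheat; have D := is_derive1_ln t0.
have D2 : is_derive t (1 : R) (fun s : R => z ^+ 2 / (2 * s)) (- (z ^+ 2 / (2 * t ^+ 2))).
  have t1 : 2 * t != 0 by rewrite mulf_neq0// lt0r_neq0.
  have D1 : is_derive t (1 : R) (fun s : R => 2 * s) 2.
    by apply: is_derive_eq; rewrite /GRing.scale/= mulr1.
  have D2 : is_derive t (1 : R) (fun s : R => (2 * s)^-1) (- (2 * t) ^- 2 * 2).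
    apply: DeriveDef; first exact: derivableV t1 (@ex_derive _ _ _ _ _ _ _ D1).
    by rewrite deriveV ?(@derive_val _ _ _ _ _ _ _ D1)//; exact: (@ex_derive _ _ _ _ _ _ _ D1).
  have D3 := @is_deriveZ R _ _ (fun s : R => (2 * s)^-1) (z ^+ 2) t 1 _ D2.
  apply: is_derive_eq D3 _.
  by rewrite /GRing.scale/=; field; rewrite lt0r_neq0.
apply: is_derive_eq; rewrite /heat /GRing.scale/=.
by move: (expR _) => E; field; rewrite lt0r_neq0.
Qed.

(** One wide kernel dominates for all times near [T], as differentiation under the integral
    requires. With [w = z ^+ 2 / (8 * T)] the decay at time [t] is at least [2 * w]: one [w] is the
    exponent of [heat (4 * T)], the other absorbs the polynomial factors through
    [w * expR (- w) <= 1]. *)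
Lemma heat_dominated (T : R) : 0 < T -> exists2 C : R, 0 < C & forall t z, T / 2 < t < 2 * T ->
  [/\ heat t z <= C * heat (4 * T) z, `|dheat t z| <= C * heat (4 * T) z &
      `|ddheat t z| <= C * heat (4 * T) z].
Proof.
(* [K] compares the normalisations at times [T / 2] and [4 * T]; the 32 below arises from
   [z ^+ 2 / (T / 2) ^+ 2 = 32 / T * w]. *)
move=> T0; pose K := expR (2^-1 * ln (4 * T) - 2^-1 * ln (T / 2)).
have K0 : 0 < K by exact: expR_gt0.
pose C := (1 + 32 / T) * K.
have C0 : 0 < C by rewrite mulr_gt0// addr_gt0// divr_gt0.
have main t z : T / 2 < t < 2 * T -> (1 + z ^+ 2 / t ^+ 2) * heat t z <= C * heat (4 * T) z.
  move=> /andP[t1 t2]; have t0 : 0 < t by rewrite (lt_trans _ t1)// divr_gt0.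
  pose w := z ^+ 2 / (8 * T).
  have w0 : 0 <= w by rewrite divr_ge0 ?sqr_ge0// mulr_ge0// ltW.
  have H1 : heat t z <= expR (- w) * (K * heat (4 * T) z).
    rewrite /heat [K * _]mulrCA [leRHS]mulrCA ler_pM2l ?normal_peak_gt0 ?oner_neq0//.
    rewrite /K -!expRD ler_expR.
    have L : ln (T / 2) <= ln t by rewrite ler_ln ?posrE ?divr_gt0// ltW.
    have Z : 2 * w <= z ^+ 2 / (2 * t).
      have -> : 2 * w = z ^+ 2 / (2 * (2 * T)) by rewrite /w; field; rewrite lt0r_neq0.
      rewrite ler_wpM2l ?sqr_ge0// lef_pV2 ?posrE ?mulr_gt0// ler_pM2l// ltW//.
    have -> : z ^+ 2 / (2 * (4 * T)) = w by rewrite /w mulrA -natrM.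
    by move: L Z; move: (ln t) (ln (T / 2)) (ln (4 * T)) (z ^+ 2 / (2 * t)) (w) => a b c d e; lra.
  have H2 : 1 + z ^+ 2 / t ^+ 2 <= 1 + 32 / T * w.
    rewrite lerD2l.
    have -> : 32 / T * w = z ^+ 2 / (T / 2) ^+ 2 by rewrite /w; field; rewrite lt0r_neq0.
    rewrite ler_wpM2l ?sqr_ge0// lef_pV2 ?posrE ?exprn_gt0 ?divr_gt0//.
    by rewrite lerXn2r ?nnegrE ?ltW// divr_gt0.
  have H3 : (1 + 32 / T * w) * expR (- w) <= 1 + 32 / T.
    have E1 : expR (- w) <= 1 by rewrite expR_le1 oppr_le0.
    have E2 : w * expR (- w) <= 1.
      rewrite expRN ler_pdivrMr ?expR_gt0// mul1r (le_trans _ (expR_ge1Dx w))//.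
      by rewrite lerDr.
    rewrite mulrDl mul1r lerD// -mulrA ler_piMr//.
    by rewrite divr_ge0// ltW.
  have Z0 : 0 <= 1 + z ^+ 2 / t ^+ 2 by rewrite addr_ge0// divr_ge0 ?sqr_ge0.
  apply: (le_trans (ler_wpM2l Z0 H1)).
  have KH : 0 <= K * heat (4 * T) z by rewrite mulr_ge0 ?heat_ge0// ltW.
  rewrite [leLHS]mulrA /C -[leRHS]mulrA; apply: ler_wpM2r => //.
  by apply: le_trans H3; rewrite ler_wpM2r ?expR_ge0.
exists (C * (1 + 2 / T)); first by rewrite mulr_gt0// addr_gt0// divr_gt0.
move=> t z tT; have M := main t z tT; have /andP[t1 t2] := tT.
have t0 : 0 < t by rewrite (lt_trans _ t1)// divr_gt0.
have A0 : 0 <= z ^+ 2 / t ^+ 2 by rewrite divr_ge0 ?sqr_ge0.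
have T2 : 0 <= 2 / T by rewrite divr_ge0// ltW.
have k0 := heat_ge0 t z.
have M' : (1 + z ^+ 2 / t ^+ 2) * heat t z <= C * (1 + 2 / T) * heat (4 * T) z.
  apply: (le_trans M); rewrite ler_wpM2r ?heat_ge0// ler_peMr ?(ltW C0)//.
  by rewrite lerDl.
split.
- by apply: le_trans M'; rewrite ler_peMl// lerDl.
- apply: le_trans M'; rewrite /dheat normrM [`|heat t z|]ger0_norm// ler_wpM2r//.
  rewrite normrN.
  have -> : z ^+ 2 / t ^+ 2 = `|z / t| ^+ 2 by rewrite real_normK ?num_real// expr_div_n.
  move: `|z / t| (normr_ge0 (z / t)) => a a0.
  have : 0 <= (a - 2^-1) ^+ 2 by rewrite sqr_ge0.
  rewrite sqrrB; move: (a ^+ 2) => b; lra.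
- have H : z ^+ 2 / t ^+ 2 + t^-1 <= (1 + 2 / T) * (1 + z ^+ 2 / t ^+ 2).
    have : t^-1 <= 2 / T by rewrite -[2 / T]invf_div lef_pV2 ?posrE ?divr_gt0// ltW.
    have : 0 <= 2 / T * (z ^+ 2 / t ^+ 2) by rewrite mulr_ge0.
    by move: (z ^+ 2 / t ^+ 2) (2 / T) t^-1 => a b c; lra.
  rewrite /ddheat normrM [`|heat t z|]ger0_norm//.
  apply: (@le_trans _ _ ((1 + 2 / T) * ((1 + z ^+ 2 / t ^+ 2) * heat t z))).
    rewrite [leRHS]mulrA; apply: ler_wpM2r => //; apply: le_trans H.
    by rewrite (le_trans (ler_normB _ _))// !ger0_norm// invr_ge0 ltW.
  by rewrite [C * _]mulrC -[leRHS]mulrA; apply: ler_wpM2l => //; rewrite addr_ge0.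
Qed.

Lemma heat_self_dominated t : 0 < t -> exists2 C : R, 0 < C & forall z,
  [/\ heat t z <= C * heat (4 * t) z, `|dheat t z| <= C * heat (4 * t) z &
      `|ddheat t z| <= C * heat (4 * t) z].
Proof.
move=> t0; have [C C0 H] := heat_dominated t0; exists C => // z; apply: H.
by rewrite ltr_pdivrMr// !ltr_pMr// ltr1n mulrC ltr_pMr// ltr1n.
Qed.

Lemma continuous_dheat t : 0 < t -> continuous (dheat t).
Proof.
move=> t0 z; apply/differentiable_continuous/derivable1_diffP.
exact: (@ex_derive _ _ _ _ _ _ _ (is_derive_dheat z t0)).
Qed.

Lemma continuous_ddheat t : 0 < t -> continuous (ddheat t).
Proof.
move=> t0 z; apply/differentiable_continuous/derivable1_diffP.
have D := is_derive_heat z t0; rewrite /ddheat; exact: ex_derive.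
Qed.

Lemma L1_dheat t : 0 < t -> L1 mu (dheat t).
Proof.
move=> t0; apply: eq_L1 (L1Z (- t^-1) (L1_id_heat t0)) => z; rewrite /dheat; ring.
Qed.

Lemma L1_ddheat t : 0 < t -> L1 mu (ddheat t).
Proof.
move=> t0; apply: eq_L1 (L1B (L1Z (t ^- 2) (L1_pow_heat 1 t0)) (L1Z t^-1 (L1_heat t0))) => z.
by rewrite /ddheat muln1; ring.
Qed.

Lemma Rint_ddheat t : 0 < t -> \int[mu]_z ddheat t z = 0.
Proof.
move=> t0; apply: (@Rint_derive _ (dheat t)).
- by move=> z; exact: is_derive_dheat.
- exact: continuous_ddheat.
- exact: L1_dheat.
- exact: L1_ddheat.
Qed.

Lemma Rint_sqr_heat t : 0 < t -> \int[mu]_z (z ^+ 2 * heat t z) = t.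
Proof.
move=> t0; have t0' := lt0r_neq0 t0.
have E : \int[mu]_z ddheat t z = t ^- 2 * \int[mu]_z (z ^+ 2 * heat t z) - t^-1 * \int[mu]_z heat t z.
  rewrite -!RintZ; [|exact: L1_heat|exact: (L1_pow_heat 1 t0)].
  rewrite -RintB; [|exact: (L1Z _ (L1_pow_heat 1 t0))|exact: (L1Z _ (L1_heat t0))].
  by apply: (eq_Rint mu) => z; rewrite /ddheat; ring.
move: E; rewrite Rint_ddheat// Rint_heat// mulr1; move: (\int[mu]_z _) => X E.
have -> : X = t ^+ 2 * (t ^- 2 * X - t^-1) + t by field.
by rewrite -E mulr0 add0r.
Qed.

End heat_kernel.

(** * Moments, and smoothing by the heat kernel *)

Section moments.
Variable R : realType.
Local Notation mu := (@lebesgue_measure R).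
Local Notation mu2 := (mu \x mu)%E.

Lemma convol_weighted (f g h : R -> R) : L1 mu f -> L1 mu g -> measurable_fun setT h ->
  L1 mu2 (fun z => h (z.1 + z.2) * (f z.1 * g z.2)) ->
  L1 mu (fun x => h x * convol f g x) /\
  \int[mu]_x (h x * convol f g x) = \int[mu2]_z (h (z.1 + z.2) * (f z.1 * g z.2)).
Proof.
move=> Lf Lg mh L; have LU := L1_unshear L.
have mc : measurable_fun setT (fun x => h x * convol f g x).
  exact: (measurable_funM mh (L1_line_measurable (L1_convol Lf Lg))).
have LI := L1_fubini2 LU.
have aeE : {ae mu, forall s, \int[mu]_x (h (x + (s - x)) * (f x * g (s - x))) = h s * convol f g s}.
  apply: ae_imp (ae_convolE Lf Lg) => s Ls; rewrite -RintZ//.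
  by apply: (eq_Rint mu) => x; rewrite subrKC.
have Lc : L1 mu (fun x => h x * convol f g x) by apply: ae_eq_L1 aeE LI; exact: mc.
split => //; rewrite (Rint_unshear L); apply: ae_eq_Rint.
- exact: mc.
- exact: (L1_line_measurable LI).
- by apply: ae_imp aeE => s ->.
Qed.

Record moments (f : R -> R) (m v : R) : Prop := Moments {
  moments_L1 : L1 mu f;
  moments_ge0 : forall x, 0 <= f x;
  moments_mass : \int[mu]_x f x = 1;
  moments_L2 : L1 mu (fun x => (x - m) ^+ 2 * f x);
  moments_mean : \int[mu]_x ((x - m) * f x) = 0;
  moments_var : \int[mu]_x ((x - m) ^+ 2 * f x) = v }.

Lemma L1_first_moment (f : R -> R) (m : R) : L1 mu f -> (forall x, 0 <= f x) ->
  L1 mu (fun x => (x - m) ^+ 2 * f x) -> L1 mu (fun x => (x - m) * f x).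
Proof.
move=> Lf f0 L2; apply: L1_le (L1D Lf L2) => [|x].
  by apply: measurable_funM (L1_line_measurable Lf); mfun.
rewrite normrM (ger0_norm (f0 x)) -{2}(mul1r (f x)) -mulrDl ler_wpM2r//.
rewrite -[(x - m) ^+ 2]real_normK ?num_real//; move: `|x - m| => a.
have : 0 <= (a - 2^-1) ^+ 2 by rewrite sqr_ge0.
by rewrite sqrrB; move: (a ^+ 2) => b; lra.
Qed.

Lemma moments_heat (t : R) : 0 < t -> moments (heat t) 0 t.
Proof.
move=> t0; split.
- exact: L1_heat.
- by move=> x; exact: heat_ge0.
- exact: Rint_heat.
- by apply: eq_L1 (L1_pow_heat 1 t0) => x; rewrite subr0.
- by rewrite -[RHS](Rint_id_heat t0); apply: (eq_Rint mu) => x; rewrite subr0.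
- by rewrite -[RHS](Rint_sqr_heat t0); apply: (eq_Rint mu) => x; rewrite subr0.
Qed.

Lemma moments_convol (f g : R -> R) (m m' v v' : R) :
  moments f m v -> moments g m' v' -> moments (convol f g) (m + m') (v + v').
Proof.
move=> [Lf f0 f1 Lf2 fm fv] [Lg g0 g1 Lg2 gm gv].
have Lf1 := L1_first_moment Lf f0 Lf2; have Lg1 := L1_first_moment Lg g0 Lg2.
have P10 := L1_prodM Lf1 Lg; have P01 := L1_prodM Lf Lg1.
have P20 := L1_prodM Lf2 Lg; have P11 := L1_prodM Lf1 Lg1; have P02 := L1_prodM Lf Lg2.
have E1 (z : R * R) : (z.1 + z.2 - (m + m')) * (f z.1 * g z.2) =
    (z.1 - m) * f z.1 * g z.2 + f z.1 * ((z.2 - m') * g z.2) by ring.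
have E2 (z : R * R) : (z.1 + z.2 - (m + m')) ^+ 2 * (f z.1 * g z.2) =
    (z.1 - m) ^+ 2 * f z.1 * g z.2 + 2 * (((z.1 - m) * f z.1) * ((z.2 - m') * g z.2))
    + f z.1 * ((z.2 - m') ^+ 2 * g z.2) by ring.
have L1' := L1D P10 P01; have L2' := L1D (L1D P20 (L1Z 2 P11)) P02.
have m1 : measurable_fun setT (fun x : R => x - (m + m')) by mfun.
have m2 : measurable_fun setT (fun x : R => (x - (m + m')) ^+ 2) by mfun.
have W1 : L1 mu2 (fun z => (z.1 + z.2 - (m + m')) * (f z.1 * g z.2)).
  by apply: eq_L1 L1' => z; rewrite E1.
have W2 : L1 mu2 (fun z => (z.1 + z.2 - (m + m')) ^+ 2 * (f z.1 * g z.2)).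
  by apply: eq_L1 L2' => z; rewrite E2.
have [A1 B1] := convol_weighted Lf Lg m1 W1.
have [A2 B2] := convol_weighted Lf Lg m2 W2.
split.
- exact: L1_convol.
- by move=> x; exact: convol_ge0.
- by rewrite Rint_convol// f1 g1 mulr1.
- exact: A2.
- rewrite B1 (eq_Rint mu2 E1) RintD// (Rint_prodM Lf1 Lg) (Rint_prodM Lf Lg1).
  by rewrite fm gm f1 g1 mulr0 mul0r addr0.
- rewrite B2 (eq_Rint mu2 E2) RintD//; last exact: (L1D P20 (L1Z 2 P11)).
  rewrite RintD//; last exact: (L1Z 2 P11).
  rewrite RintZ// (Rint_prodM Lf2 Lg) (Rint_prodM Lf1 Lg1) (Rint_prodM Lf Lg2) fm gm f1 g1 fv gv.
  by rewrite mulr1 mul1r mulr0 mulr0 addr0.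
Qed.

End moments.

Section smoothing.
Variable R : realType.
Local Notation mu := (@lebesgue_measure R).
Local Notation mu2 := (mu \x mu)%E.
Variables (f : R -> R) (m v : R).
Hypothesis fm : moments f m v.
Implicit Types (t y : R).

Let Lf := moments_L1 fm.
Let f0 := moments_ge0 fm.
Let f1 := moments_mass fm.
Let mf : measurable_fun setT f. Proof. exact: L1_line_measurable. Qed.

Definition smooth t : R -> R := convol f (heat t).
Definition dsmooth t : R -> R := convol f (dheat t).
Definition ddsmooth t : R -> R := convol f (ddheat t).

Lemma moments_smooth t : 0 < t -> moments (smooth t) m (v + t).
Proof. by move=> t0; have := moments_convol fm (moments_heat t0); rewrite addr0. Qed.

Let heat_bnd t z : 0 < t -> `|heat t z| <= heat t 0.
Proof. by move=> t0; rewrite ger0_norm ?heat_ge0// heat_le. Qed.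

Let dheat_bnd t : 0 < t -> exists2 C : R, (forall z, `|dheat t z| <= C) & forall z, `|ddheat t z| <= C.
Proof.
move=> t0; have [C C0 H] := heat_self_dominated t0; have t4 : 0 < 4 * t by rewrite mulr_gt0.
exists (C * heat (4 * t) 0) => z; have [_ A B] := H z.
  by rewrite (le_trans A)// ler_wpM2l ?heat_le// ltW.
by rewrite (le_trans B)// ler_wpM2l ?heat_le// ltW.
Qed.

Let mdheat t : 0 < t -> measurable_fun setT (dheat t).
Proof. by move=> t0; exact: (L1_line_measurable (L1_dheat t0)). Qed.

Let mddheat t : 0 < t -> measurable_fun setT (ddheat t).
Proof. by move=> t0; exact: (L1_line_measurable (L1_ddheat t0)). Qed.

Lemma L1_smooth_fiber t y : 0 < t -> L1 mu (fun x => f x * heat t (y - x)).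
Proof.
move=> t0; exact: (L1_bounded_convol y Lf (measurable_heat t) (fun z => heat_bnd z t0)).
Qed.

Lemma smooth_gt0 t y : 0 < t -> 0 < smooth t y.
Proof.
move=> t0; rewrite ltNge; apply/negP => H.
have L := L1_smooth_fiber y t0.
have Z := @Rint_eq0 _ (measurableTypeR R) R mu _ L _ H.
have {}Z : {ae mu, forall x, f x * heat t (y - x) = 0}.
  by apply: Z; apply/aeW => x; rewrite mulr_ge0 ?heat_ge0.
have : \int[mu]_x f x = \int[mu]_x (0 : R).
  apply: ae_eq_Rint; [exact: mf|exact: measurable_cst|].
  apply: ae_imp Z => x /eqP; rewrite mulf_eq0 => /orP[/eqP//|].
  by rewrite gt_eqF// heat_gt0.
by rewrite f1 Rint0 => /eqP; rewrite oner_eq0.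
Qed.

Lemma is_derive_smooth t y : 0 < t -> is_derive y 1 (smooth t) (dsmooth t y).
Proof.
move=> t0; have [C B _] := dheat_bnd t0.
apply: (is_derive_convol y Lf (measurable_heat t) (fun z => heat_bnd z t0) _ B).
by move=> x; exact: is_derive_heat.
Qed.

Lemma is_derive_dsmooth t y : 0 < t -> is_derive y 1 (dsmooth t) (ddsmooth t y).
Proof.
move=> t0; have [C B1 B2] := dheat_bnd t0.
apply: (is_derive_convol y Lf (mdheat t0) B1 _ B2).
by move=> x; exact: is_derive_dheat.
Qed.

Lemma continuous_dsmooth t : 0 < t -> continuous (dsmooth t).
Proof.
move=> t0; have [C B _] := dheat_bnd t0.
exact: (continuous_convol Lf (continuous_dheat t0) B).
Qed.

Lemma continuous_ddsmooth t : 0 < t -> continuous (ddsmooth t).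
Proof.
move=> t0; have [C _ B] := dheat_bnd t0.
exact: (continuous_convol Lf (continuous_ddheat t0) B).
Qed.

Lemma L1_smooth t : 0 < t -> L1 mu (smooth t).
Proof. by move=> t0; apply: L1_convol => //; exact: L1_heat. Qed.

Lemma L1_dsmooth t : 0 < t -> L1 mu (dsmooth t).
Proof. by move=> t0; apply: L1_convol => //; exact: L1_dheat. Qed.

Lemma L1_ddsmooth t : 0 < t -> L1 mu (ddsmooth t).
Proof. by move=> t0; apply: L1_convol => //; exact: L1_ddheat. Qed.

Lemma tail_dsmooth t y : 0 < t -> tail (dsmooth t) y = - smooth t y.
Proof.
move=> t0; apply: tail_primitive.
- by move=> x; exact: is_derive_smooth.
- exact: continuous_dsmooth.
- exact: L1_smooth.
- exact: L1_dsmooth.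
Qed.

Lemma Rint_dsmooth t : 0 < t -> \int[mu]_y dsmooth t y = 0.
Proof.
move=> t0; apply: (@Rint_derive _ (smooth t)).
- by move=> x; exact: is_derive_smooth.
- exact: continuous_dsmooth.
- exact: L1_smooth.
- exact: L1_dsmooth.
Qed.

Lemma smooth_dominated (T : R) : 0 < T -> exists2 C : R, 0 < C & forall t y, T / 2 < t < 2 * T ->
  [/\ smooth t y <= C * smooth (4 * T) y, `|dsmooth t y| <= C * smooth (4 * T) y &
      `|ddsmooth t y| <= C * smooth (4 * T) y].
Proof.
move=> T0; have [C C0 H] := heat_dominated T0; exists C => // t y tT.
have t0 : 0 < t by case/andP: tT => t1 _; rewrite (lt_trans _ t1)// divr_gt0.
have T4 : 0 < 4 * T by rewrite mulr_gt0.
have [D B1 B2] := dheat_bnd t0.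
have L4 := L1_smooth_fiber y T4.
have dom (q : R -> R) : L1 mu (fun x => f x * q (y - x)) ->
    (forall z, `|q z| <= C * heat (4 * T) z) -> `|convol f q y| <= C * smooth (4 * T) y.
  move=> Lq qC; apply: (le_trans (le_normr_Rintegral measurableT Lq)).
  rewrite -RintZ//; apply: Rint_le (L1_norm Lq) (L1Z C L4) _ => x.
  by rewrite normrM (ger0_norm (f0 x)) mulrCA ler_wpM2l.
split.
- apply: (le_trans (ler_norm _)); apply: dom (L1_smooth_fiber y t0) _ => z.
  by rewrite ger0_norm ?heat_ge0//; have [] := H t z tT.
- by apply: dom (L1_bounded_convol y Lf (mdheat t0) B1) _ => z; have [] := H t z tT.
- by apply: dom (L1_bounded_convol y Lf (mddheat t0) B2) _ => z; have [] := H t z tT.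
Qed.

Lemma is_derive_smooth_time t y : 0 < t -> is_derive t 1 (fun s => smooth s y) (2^-1 * ddsmooth t y).
Proof.
move=> t0; have [C C0 H] := heat_dominated t0; have t4 : 0 < 4 * t by rewrite mulr_gt0.
have [D B1 B2] := dheat_bnd t0.
have -> : 2^-1 * ddsmooth t y = \int[mu]_x (f x * (2^-1 * ddheat t (y - x))).
  rewrite /ddsmooth /convol -RintZ; last exact: (L1_bounded_convol y Lf (mddheat t0) B2).
  by apply: (eq_Rint mu) => x; rewrite mulrCA.
apply: (@is_derive_under_integral _ (fun s x => f x * heat s (y - x))
  (fun s x => f x * (2^-1 * ddheat s (y - x))) (fun x => C * heat (4 * t) 0 * f x) t (t / 2) (2 * t)).
- by rewrite ltr_pdivrMr// !ltr_pMr// ltr1n mulrC ltr_pMr// ltr1n.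
- by move=> s /andP[s1 _]; apply: L1_smooth_fiber; rewrite (lt_trans _ s1)// divr_gt0.
- move=> s x /andP[s1 _]; have s0 : 0 < s by rewrite (lt_trans _ s1)// divr_gt0.
  have D1 := is_derive_heat_time (y - x) s0.
  exact: (@is_deriveZ R _ _ (fun s => heat s (y - x)) (f x) s 1 _ D1).
- by move=> x; rewrite mulr_ge0// mulr_ge0 ?heat_ge0// ltW.
- exact: (L1Z _ Lf).
- move=> s x sT; rewrite normrM (ger0_norm (f0 x)) mulrC ler_wpM2r// normrM.
  have [_ _ B] := H s (y - x) sT.
  rewrite ger0_norm// (@le_trans _ _ `|ddheat s (y - x)|)// ?ler_piMl// ?invf_le1 ?ler1n//.
  by rewrite (le_trans B)// ler_wpM2l ?heat_le// ltW.
Qed.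

(** Cauchy-Schwarz under the convolution, with [dheat] split as [- (z / t)] times [heat]: the square
    of [dsmooth] is at most [smooth] times the convolution of [f] with [q], and that convolution is
    integrable. *)
Lemma L1_fisher t : 0 < t -> L1 mu (fun y => dsmooth t y ^+ 2 / smooth t y).
Proof.
move=> t0.
pose q z := z ^+ 2 / t ^+ 2 * heat t z.
have Lq : L1 mu q.
  by apply: eq_L1 (L1Z (t ^- 2) (L1_pow_heat 1 t0)) => z; rewrite /q muln1; ring.
have [C C0 H] := heat_self_dominated t0; have t4 : 0 < 4 * t by rewrite mulr_gt0.
have qB z : `|q z| <= C * heat (4 * t) 0 + t^-1 * heat t 0.
  have -> : q z = ddheat t z + t^-1 * heat t z by rewrite /q /ddheat; ring.
  apply: (le_trans (ler_normD _ _)); apply: lerD.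
    by have [_ _ B] := H z; rewrite (le_trans B)// ler_wpM2l ?heat_le// ltW.
  by rewrite normrM ger0_norm ?invr_ge0 ?(ltW t0)// ler_wpM2l ?invr_ge0 ?(ltW t0)// heat_bnd.
have mq := L1_line_measurable Lq.
have [D B1 _] := dheat_bnd t0.
apply: L1_le (L1_convol Lf Lq) => [|y].
  apply: measurable_funM.
    by apply: measurable_funX; exact: (L1_line_measurable (L1_dsmooth t0)).
  exact: (measurableT_comp (@measurable_invr R) (L1_line_measurable (L1_smooth t0))).
have p0 := smooth_gt0 y t0.
rewrite ger0_norm; last by rewrite divr_ge0 ?sqr_ge0// ltW.
rewrite ler_pdivrMr// mulrC.
pose a x := Num.sqrt (f x * heat t (y - x)).
have a2 x : a x ^+ 2 = f x * heat t (y - x) by rewrite sqr_sqrtr// mulr_ge0 ?heat_ge0.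
have my : measurable_fun setT (fun x : R => y - x) by mfun.
have ma : measurable_fun setT a.
  apply: (@measurableT_comp _ _ _ _ _ _ (@Num.sqrt R)).
    by apply: continuous_measurable_fun; exact: sqrt_continuous.
  by apply: (measurable_funM mf); exact: (measurableT_comp (measurable_heat t) my).
pose b x := - ((y - x) / t) * a x.
have mb : measurable_fun setT b by apply: measurable_funM => //; apply: measurable_funN; mfun.
have La : L1 mu (fun x => a x ^+ 2).
  by apply: eq_L1 (L1_smooth_fiber y t0) => x; rewrite a2.
have b2 x : b x ^+ 2 = f x * q (y - x).
  by rewrite /b exprMn a2 /q; field; rewrite lt0r_neq0.
have Lb : L1 mu (fun x => b x ^+ 2).
  by apply: eq_L1 (L1_bounded_convol y Lf mq qB) => x; rewrite b2.
have := @CauchySchwarz _ (measurableTypeR R) R mu a b ma mb La Lb.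
have -> : \int[mu]_x (a x * b x) = dsmooth t y.
  by apply: (eq_Rint mu) => x; rewrite /b mulrCA -expr2 a2 /dheat; ring.
rewrite (eq_Rint mu a2) (eq_Rint mu b2); exact.
Qed.

End smoothing.

(** * De Bruijn's identity *)

Section de_bruijn.
Variable R : realType.
Local Notation mu := (@lebesgue_measure R).
Variables (f : R -> R) (m v : R).
Hypothesis fm : moments f m v.
Implicit Types (t y : R).

Local Notation p := (smooth f).
Local Notation dp := (dsmooth f).
Local Notation ddp := (ddsmooth f).

Let Lf := moments_L1 fm.
Let f0 := moments_ge0 fm.
Let f1 := moments_mass fm.

Lemma smooth_le t y : 0 < t -> p t y <= heat t 0.
Proof.
move=> t0; rewrite -[leRHS]mulr1 -f1 -RintZ//.
apply: Rint_le; [exact: (L1_smooth_fiber fm y t0)|exact: L1Z|move=> x].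
by rewrite mulrC ler_wpM2r// heat_le.
Qed.

Lemma second_moment_at y : L1 mu (fun x => (y - x) ^+ 2 * f x) /\
  \int[mu]_x ((y - x) ^+ 2 * f x) = (y - m) ^+ 2 + v.
Proof.
have L2 := moments_L2 fm; have Lm := L1_first_moment Lf f0 L2.
have E x : (y - x) ^+ 2 * f x =
    (y - m) ^+ 2 * f x + (- (2 * (y - m))) * ((x - m) * f x) + (x - m) ^+ 2 * f x by ring.
have LA := L1D (L1Z ((y - m) ^+ 2) Lf) (L1Z (- (2 * (y - m))) Lm).
split; first by apply: eq_L1 (L1D LA L2) => x; rewrite E.
rewrite (eq_Rint mu E) RintD// RintD; [|exact: (L1Z _ Lf)|exact: (L1Z _ Lm)].
by rewrite !RintZ// f1 (moments_mean fm) (moments_var fm) mulr1 mulr0 addr0.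
Qed.

(* Jensen's inequality for the exponential. *)
Lemma ln_smooth_ge t y : 0 < t ->
  ln (heat t 0) - ((y - m) ^+ 2 + v) / (2 * t) <= ln (p t y).
Proof.
move=> t0; have [L2 E2] := second_moment_at y.
set l := (X in X <= _); rewrite -[l]expRK ler_ln ?posrE ?expR_gt0 ?(smooth_gt0 fm)//.
pose lk x := ln (heat t 0) - (y - x) ^+ 2 / (2 * t).
have kE x : heat t (y - x) = expR (lk x).
  rewrite -[LHS]lnK ?posrE ?heat_gt0// /lk !ln_heat; congr expR.
  by rewrite expr0n/= mul0r subr0.
have E x : expR l * (1 + (lk x - l)) * f x =
    (expR l * (1 + (ln (heat t 0) - l))) * f x + (- (expR l / (2 * t))) * ((y - x) ^+ 2 * f x).
  by rewrite /lk; field; rewrite lt0r_neq0.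
have LA := L1Z (expR l * (1 + (ln (heat t 0) - l))) Lf.
have LB := L1Z (- (expR l / (2 * t))) L2.
have I : \int[mu]_x (expR l * (1 + (lk x - l)) * f x) = expR l.
  rewrite (eq_Rint mu E) RintD// !RintZ// f1 E2 /l.
  by move: (expR _) => e; field; rewrite lt0r_neq0.
rewrite -{}I; apply: Rint_le.
- by apply: eq_L1 (L1D LA LB) => x; rewrite E.
- exact: (L1_smooth_fiber fm y t0).
move=> x; rewrite [leLHS]mulrC; apply: ler_wpM2l => //.
have : (1 + (lk x - l)) * expR l <= expR (lk x - l) * expR l.
  by apply: ler_wpM2r (expR_ge1Dx _); exact: expR_ge0.
by rewrite -expRD subrK kE mulrC.
Qed.

(** The logarithm grows at most quadratically, so the finite second moment makes the entropy
    integrands along the flow integrable. *)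
Lemma norm_ln_smooth t y : 0 < t ->
  `|ln (p t y)| <= `|ln (heat t 0)| + ((y - m) ^+ 2 + v) / (2 * t).
Proof.
move=> t0; have H1 := ln_smooth_ge y t0.
have H2 : ln (p t y) <= ln (heat t 0).
  by rewrite ler_ln ?posrE ?heat_gt0 ?(smooth_gt0 fm)// smooth_le.
have V0 : 0 <= ((y - m) ^+ 2 + v) / (2 * t).
  rewrite divr_ge0//; last by rewrite mulr_ge0// ltW.
  by rewrite -(second_moment_at y).2; apply: Rint_ge0 => x; rewrite mulr_ge0 ?sqr_ge0.
have N1 := ler_norm (ln (heat t 0)).
have N2 := ler_norm (- ln (heat t 0)); rewrite normrN in N2.
move: H1 H2 V0 N1 N2; move: (ln (p t y)) (ln (heat t 0)) (_ / _) `|ln (heat t 0)| => a b c d.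
by move=> *; rewrite ler_norml; apply/andP; split; lra.
Qed.

Lemma L1_log_weight (T a b : R) : 0 < T -> L1 mu (fun y => (a + b * (y - m) ^+ 2) * p T y).
Proof.
move=> T0; have M := moments_smooth fm T0.
by apply: eq_L1 (L1D (L1Z a (moments_L1 M)) (L1Z b (moments_L2 M))) => y; ring.
Qed.

Let mln t : 0 < t -> measurable_fun setT (fun y => ln (p t y)).
Proof.
move=> t0; exact: (measurableT_comp (@measurable_ln R) (L1_line_measurable (L1_smooth fm t0))).
Qed.

Let L1_ln_mul (T t C : R) (h : R -> R) : 0 < T -> 0 < t -> 0 <= C -> measurable_fun setT h ->
  (forall y, `|h y| <= C * p T y) -> L1 mu (fun y => h y * ln (p t y)).
Proof.
move=> T0 t0 C0 mh hC.
apply: L1_le (L1Z C (L1_log_weight (`|ln (heat t 0)| + v / (2 * t)) (2 * t)^-1 T0)) => [|y].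
  exact: (measurable_funM mh (mln t0)).
rewrite normrM [leRHS]mulrCA mulrC; apply: ler_pM => //.
rewrite (le_trans (norm_ln_smooth y t0))// le_eqVlt; apply/orP; left; apply/eqP.
by move: `|_| => n; rewrite mulrDl addrA; ring.
Qed.

Lemma entropy_finite_smooth t : 0 < t -> L1 mu (fun y => p t y * ln (p t y)).
Proof.
move=> t0; apply: (@L1_ln_mul t t 1) => //.
  exact: (L1_line_measurable (L1_smooth fm t0)).
by move=> y; rewrite mul1r ger0_norm// ltW// (smooth_gt0 fm).
Qed.

Local Notation J t := (\int[mu]_y (dp t y ^+ 2 / p t y)).

(** Adding [dp ^+ 2 / p] to the integrand gives the derivative of the integrable function
    [dp * (ln p + 1)], and the integral of that derivative is 0. *)
Lemma Rint_ddsmooth_ln t : 0 < t -> L1 mu (fun y => ddp t y * (ln (p t y) + 1)) /\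
  \int[mu]_y (ddp t y * (ln (p t y) + 1)) = - J t.
Proof.
move=> t0; have t4 : 0 < 4 * t by rewrite mulr_gt0.
have [C C0 H] := smooth_dominated fm t0.
have {}H y : [/\ p t y <= C * p (4 * t) y, `|dp t y| <= C * p (4 * t) y & `|ddp t y| <= C * p (4 * t) y].
  apply: H; by rewrite ltr_pdivrMr// !ltr_pMr// ltr1n mulrC ltr_pMr// ltr1n.
have Ldd := L1_ddsmooth fm t0; have Ld := L1_dsmooth fm t0.
have LA : L1 mu (fun y => ddp t y * ln (p t y)).
  apply: (L1_ln_mul t4 t0 (ltW C0) (L1_line_measurable Ldd)).
  by move=> y; have [] := H y.
have LB : L1 mu (fun y => dp t y * ln (p t y)).
  apply: (L1_ln_mul t4 t0 (ltW C0) (L1_line_measurable Ld)).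
  by move=> y; have [] := H y.
have L1' : L1 mu (fun y => ddp t y * (ln (p t y) + 1)).
  by apply: eq_L1 (L1D LA Ldd) => y; rewrite mulrDr mulr1.
have LJ := L1_fisher fm t0.
split => //.
suff : \int[mu]_y (ddp t y * (ln (p t y) + 1) + dp t y ^+ 2 / p t y) = 0.
  by rewrite RintD// => /eqP; rewrite addr_eq0 => /eqP.
pose u y := dp t y * (ln (p t y) + 1).
pose du y := ddp t y * (ln (p t y) + 1) + dp t y ^+ 2 / p t y.
have D (y : R) : is_derive y 1 u (du y).
  have p0 := smooth_gt0 fm y t0.
  have D1 := is_derive_smooth fm y t0; have D2 := is_derive_dsmooth fm y t0.
  have D3 := @is_derive1_comp R (@ln R) (p t) y _ _ (is_derive1_ln p0) D1.
  rewrite /u /du; apply: is_derive_eq; rewrite /GRing.scale/=.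
  by move: (ln _) => l; field; rewrite lt0r_neq0.
have cdu : continuous du.
  move=> y; have p0 := smooth_gt0 fm y t0.
  have cp : p t x @[x --> y] --> p t y.
    apply/differentiable_continuous/derivable1_diffP.
    exact: (@ex_derive _ _ _ _ _ _ _ (is_derive_smooth fm y t0)).
  apply: cvgD.
    apply: cvgM; first exact: (continuous_ddsmooth fm t0).
    apply: cvgD; last exact: cvg_cst.
    by apply: (continuous_comp cp); exact: continuous_ln.
  apply: cvgM.
    by apply: cvgM; exact: (continuous_dsmooth fm t0).
  by apply: cvgV => //; rewrite gt_eqF.
have Lu : L1 mu u by apply: eq_L1 (L1D LB Ld) => y; rewrite /u mulrDr mulr1.
have Ldu : L1 mu du by exact: (L1D L1' LJ).
exact: (Rint_derive D cdu Lu Ldu).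
Qed.

(** By the heat equation the time derivative of [p * ln p] is half of [ddp * (ln p + 1)], and
    integration by parts in space turns its integral into Fisher information. The dominating
    function combines the wide kernel with the quadratic bound on the logarithm, uniformly over
    [t / 2 < s < 2 * t]. *)
Lemma de_bruijn t : 0 < t -> is_derive t 1 (fun s => entropy (p s)) (2^-1 * J t).
Proof.
move=> t0; have t4 : 0 < 4 * t by rewrite mulr_gt0.
have [C C0 H] := smooth_dominated fm t0.
have [Ldd Edd] := Rint_ddsmooth_ln t0.
have -> : 2^-1 * J t = - \int[mu]_y (2^-1 * (ddp t y * (ln (p t y) + 1))).
  by rewrite RintZ// Edd mulrN opprK.
pose L := `|ln (t / 2)| + `|ln (2 * t)|.
pose a := `|ln (normal_peak (1 : R))| + L + v / t + 1.
have v0 : 0 <= v.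
  by rewrite -(moments_var fm); apply: Rint_ge0 => x; rewrite mulr_ge0 ?sqr_ge0.
have a0 : 0 <= a.
  by apply: addr_ge0 => //; apply: addr_ge0; rewrite ?addr_ge0// divr_ge0// ltW.
rewrite /entropy; apply: is_deriveN.
apply: (@is_derive_under_integral _ (fun s y => p s y * ln (p s y))
  (fun s y => 2^-1 * (ddp s y * (ln (p s y) + 1)))
  (fun y => C * ((a + t^-1 * (y - m) ^+ 2) * p (4 * t) y)) t (t / 2) (2 * t)).
- by rewrite ltr_pdivrMr// !ltr_pMr// ltr1n mulrC ltr_pMr// ltr1n.
- move=> s /andP[s1 _]; apply: entropy_finite_smooth.
  by rewrite (lt_trans _ s1)// divr_gt0.
- move=> s y /andP[s1 _]; have s0 : 0 < s by rewrite (lt_trans _ s1)// divr_gt0.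
  have p0 := smooth_gt0 fm y s0.
  have D1 := is_derive_smooth_time fm y s0.
  have D3 := @is_derive1_comp R (@ln R) (fun s => p s y) s _ _ (is_derive1_ln p0) D1.
  have D4 := @is_deriveM R _ (fun s => p s y) (@ln R \o (fun s => p s y)) s 1 _ _ D1 D3.
  apply: is_derive_eq D4 _; rewrite /GRing.scale/=.
  by move: (ln _) => l; field; rewrite lt0r_neq0.
- move=> y; rewrite mulr_ge0// ?(ltW C0)// mulr_ge0//; last exact: ltW (smooth_gt0 fm y t4).
  by apply: addr_ge0 => //; rewrite mulr_ge0 ?sqr_ge0// invr_ge0 ltW.
- exact: (L1Z C (L1_log_weight a t^-1 t4)).
- move=> s y sT; have [_ _ B] := H s y sT; have /andP[s1 s2] := sT.
  have s0 : 0 < s by rewrite (lt_trans _ s1)// divr_gt0.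
  rewrite normrM ger0_norm// (@le_trans _ _ `|ddp s y * (ln (p s y) + 1)|)//.
    by rewrite ler_piMl// invf_le1 ?ler1n.
  rewrite normrM [leRHS]mulrCA mulrC; apply: ler_pM => //.
  apply: (le_trans (ler_normD _ _)); rewrite normr1.
  have N := norm_ln_smooth y s0.
  have lns : `|ln s| <= L.
    have A : ln (t / 2) <= ln s by rewrite ler_ln ?posrE ?divr_gt0// ltW.
    have A' : ln s <= ln (2 * t) by rewrite ler_ln ?posrE ?mulr_gt0// ltW.
    have B1 := ler_norm (- ln (t / 2)); rewrite normrN in B1.
    have B2 := ler_norm (ln (2 * t)).
    have B3 := normr_ge0 (ln (t / 2)); have B4 := normr_ge0 (ln (2 * t)).
    rewrite /L; move: A A' B1 B2 B3 B4.
    move: (ln s) (ln (t / 2)) (ln (2 * t)) `|ln (t / 2)| `|ln (2 * t)| => x1 x2 x3 x4 x5 *.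
    by rewrite ler_norml; apply/andP; split; lra.
  have hB : `|ln (heat s 0)| <= `|ln (normal_peak (1 : R))| + L.
    rewrite ln_heat expr0n/= mul0r subr0 (le_trans (ler_normB _ _))// lerD2l.
    rewrite normrM ger0_norm// (le_trans _ lns)// ler_piMl// invf_le1 ?ler1n//.
  have Q : ((y - m) ^+ 2 + v) / (2 * s) <= ((y - m) ^+ 2 + v) / t.
    rewrite ler_wpM2l ?addr_ge0 ?sqr_ge0// lef_pV2 ?posrE ?mulr_gt0//.
    by move: s1; rewrite ltr_pdivrMr// mulrC => /ltW.
  rewrite /a; move: N hB Q; rewrite [_ / t]mulrDl [_ / t]mulrC.
  move: `|ln (p s y)| `|ln (heat s 0)| (_ / (2 * s)) (t^-1 * _) (v / t) `|ln (normal_peak 1)| (L) => *.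
  lra.
Qed.

End de_bruijn.

(** * The Poincaré inequality along the heat flow *)

Section gaussian_poincare.
Variable R : realType.
Local Notation mu := (@lebesgue_measure R).
Local Notation mu2 := (mu \x mu)%E.
Variable a : R -> R.
Hypothesis La : L1 mu a.
Hypothesis La2 : L1 mu (fun x => a x ^+ 2).

Let ma : measurable_fun setT a. Proof. exact: L1_line_measurable. Qed.

Definition prim (h : R -> R) (y : R) : R := \int[mu]_z (step z y * h z).

Lemma primB (h : R -> R) (u u' : R) : L1 mu h ->
  prim h u - prim h u' = \int[mu]_w ((step w u - step w u') * h w).
Proof.
move=> Lh; rewrite -RintB; [|exact: L1_stepl..].
by apply: (eq_Rint mu) => w; rewrite mulrBl.
Qed.

(** Cauchy-Schwarz on the interval between [u'] and [u], whose indicator is a difference of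
    steps. *)
Lemma prim_sqr_le (u u' : R) :
  (prim a u - prim a u') ^+ 2 <= (u - u') * (prim (fun x => a x ^+ 2) u - prim (fun x => a x ^+ 2) u').
Proof.
wlog uu : u u' / u' <= u.
  move=> H; have [|/ltW uu] := leP u' u; first exact: H.
  have := H u' u uu; rewrite -sqrrN opprB.
  by rewrite -[(u' - u) * _]mulrNN !opprB.
rewrite !primB//; pose D w := step w u - step w u'.
have D2 w : D w ^+ 2 = D w.
  rewrite /D; have := step_diff uu => /(congr1 (fun f => f w)) ->.
  by rewrite indicE; case: (_ \in _); rewrite ?expr1n ?expr0n.
have [LD [_ ED]] := step_diff_int u' u.
have mD := L1_line_measurable LD.
have LD2 : L1 mu (fun w => D w ^+ 2) by apply: eq_L1 LD => w; rewrite D2.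
have LDa2 : L1 mu (fun w => (D w * a w) ^+ 2).
  have := L1B (L1_stepl u La2) (L1_stepl u' La2).
  by apply: eq_L1 => w; rewrite exprMn D2 mulrBl.
have := @CauchySchwarz _ (measurableTypeR R) R mu D (fun w => D w * a w) mD (measurable_funM mD ma) LD2 LDa2.
have -> : \int[mu]_w (D w * (D w * a w)) = \int[mu]_w ((step w u - step w u') * a w).
  by apply: (eq_Rint mu) => w; rewrite mulrA -expr2 D2.
have -> : \int[mu]_w (D w ^+ 2) = u - u' by rewrite -ED; apply: (eq_Rint mu) => w; rewrite D2.
have -> // : \int[mu]_w ((D w * a w) ^+ 2) = \int[mu]_w ((step w u - step w u') * a w ^+ 2).
by apply: (eq_Rint mu) => w; rewrite exprMn D2.
Qed.

Variable t : R.
Hypothesis t0 : 0 < t.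
Local Notation k := (heat t).

Lemma heat_opp (z : R) : k (- z) = k z. Proof. by rewrite /heat sqrrN. Qed.

Lemma prim_dheat (y : R) : prim (dheat t) y = k y.
Proof.
rewrite /prim primitive_tail; last exact: L1_dheat.
have -> : (fun z => dheat t (- z)) = (fun z => (-1) * dheat t z).
  by apply/funext => z; rewrite /dheat heat_opp; ring.
rewrite tailZ; last exact: L1_dheat.
have -> : tail (dheat t) (- y) = - k (- y).
  apply: tail_primitive.
  - by move=> x; exact: is_derive_heat.
  - exact: continuous_dheat.
  - exact: L1_heat.
  - exact: L1_dheat.
by rewrite mulN1r opprK heat_opp.
Qed.

(** Stein's identity: the derivative moves from the kernel to [prim h]. It goes through [tail_dual],
    so [h] can be any integrable function. *)
Lemma stein_heat (h : R -> R) (x : R) : L1 mu h ->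
  \int[mu]_z (dheat t z * prim h (x - z)) = convol k h x.
Proof.
move=> Lh; have Lr := L1_reflect x Lh; have := tail_dual (L1_dheat t0) Lr.
have -> : \int[mu]_y (\int[mu]_z (step z y * dheat t z) * h (x - y)) = convol k h x.
  by apply: (eq_Rint mu) => y; rewrite -[X in X * _]/(prim _ _) prim_dheat.
move=> ->; apply: (eq_Rint mu) => z; congr (_ * _).
rewrite /prim -(Rint_reflect x (L1_stepl (x - z) Lh)).
by apply: (eq_Rint mu) => w; rewrite /step ltrD2l ltrN2.
Qed.

Lemma L1_heat_bounded (h : R -> R) (B x : R) : measurable_fun setT h -> (forall y, `|h y| <= B) ->
  L1 mu (fun z => k z * h (x - z)).
Proof. by move=> mh hB; exact: (L1_bounded_convol x (L1_heat t0) mh hB). Qed.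

Local Notation g := (prim a).
Local Notation g2 := (prim (fun x => a x ^+ 2)).
Let mg : measurable_fun setT g. Proof. exact: measurable_primitive. Qed.
Let mg2 : measurable_fun setT g2. Proof. exact: measurable_primitive. Qed.
Let B := \int[mu]_z `|a z|.
Let gB y : `|g y| <= B. Proof. exact: norm_primitive. Qed.
Let B2 := \int[mu]_z `|a z ^+ 2|.
Let g2B y : `|g2 y| <= B2. Proof. exact: norm_primitive. Qed.
Let mgg : measurable_fun setT (fun x => g x ^+ 2). Proof. exact: measurable_funX. Qed.
Let ggB y : `|g y ^+ 2| <= B ^+ 2.
Proof. by rewrite normrX lerXn2r// ?nnegrE// (le_trans _ (gB y)). Qed.

(** Twice a variance is the mean square difference of two independent copies. [prim_sqr_le] bounds
    it by the mean of [z.2 - z.1] times an increment of the primitive of [a ^+ 2], and [stein_heat]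
    evaluates that as [2 * t] times the mean of [a ^+ 2]. *)
Lemma gaussian_poincare (x : R) :
  convol k (fun y => g y ^+ 2) x - convol k g x ^+ 2 <= t * convol k (fun y => a y ^+ 2) x.
Proof.
have Lk := L1_heat t0; have Lzk := L1_id_heat t0.
have LG := L1_heat_bounded x mg gB; have LGG := L1_heat_bounded x mgg ggB.
have LH := L1_heat_bounded x mg2 g2B.
have LZH : L1 mu (fun z => (z * k z) * g2 (x - z)) by exact: (L1_bounded_convol x Lzk mg2 g2B).
pose V (z : R * R) := k z.1 * g (x - z.1) ^+ 2 * k z.2 - 2 * ((k z.1 * g (x - z.1)) * (k z.2 * g (x - z.2)))
   + k z.1 * (k z.2 * g (x - z.2) ^+ 2).
pose W (z : R * R) := (k z.1 * g2 (x - z.1)) * (z.2 * k z.2) - k z.1 * (z.2 * k z.2 * g2 (x - z.2))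
   - (z.1 * k z.1 * g2 (x - z.1)) * k z.2 + (z.1 * k z.1) * (k z.2 * g2 (x - z.2)).
have A1 := L1_prodM LGG Lk; have A2 := L1_prodM LG LG; have A3 := L1_prodM Lk LGG.
have LV12 := L1B A1 (L1Z 2 A2); have LV : L1 mu2 V by exact: (L1D LV12 A3).
have C1 := L1_prodM LH Lzk; have C2 := L1_prodM Lk LZH; have C3 := L1_prodM LZH Lk.
have C4 := L1_prodM Lzk LH.
have LW12 := L1B C1 C2; have LW123 := L1B LW12 C3; have LW : L1 mu2 W by exact: (L1D LW123 C4).
have EV : \int[mu2]_z V z = 2 * (convol k (fun y => g y ^+ 2) x - convol k g x ^+ 2).
  rewrite RintD// RintB//; last exact: (L1Z 2 A2).
  rewrite RintZ// (Rint_prodM LGG Lk) (Rint_prodM LG LG) (Rint_prodM Lk LGG) Rint_heat//.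
  rewrite -[X in X * 1 - _]/(convol k (fun y => g y ^+ 2) x) -[X in _ - 2 * (X * X)]/(convol k g x).
  rewrite -[X in _ + 1 * X]/(convol k (fun y => g y ^+ 2) x).
  by move: (convol k _ x) (convol k g x) => *; ring.
have EW : \int[mu2]_z W z = 2 * (t * convol k (fun y => a y ^+ 2) x).
  rewrite RintD// RintB// RintB//.
  rewrite (Rint_prodM LH Lzk) (Rint_prodM Lk LZH) (Rint_prodM LZH Lk) (Rint_prodM Lzk LH).
  rewrite Rint_heat// Rint_id_heat// -(stein_heat x La2) -RintZ; last first.
    by apply: eq_L1 (L1Z (- t^-1) LZH) => z; rewrite /dheat; ring.
  have -> : \int[mu]_z (t * (dheat t z * g2 (x - z))) = - \int[mu]_z (z * k z * g2 (x - z)).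
    rewrite -RintN//; apply: (eq_Rint mu) => z; rewrite /dheat; field; by rewrite lt0r_neq0.
  by move: (\int[mu]_z _) (\int[mu]_z _) => *; ring.
rewrite -(ler_pM2l (ltr0n _ 2)) -EV -EW; apply: Rint_le => // z.
have -> : V z = k z.1 * k z.2 * (g (x - z.1) - g (x - z.2)) ^+ 2 by rewrite /V; ring.
have -> : W z = k z.1 * k z.2 * ((x - z.1 - (x - z.2)) * (g2 (x - z.1) - g2 (x - z.2))).
  by rewrite /W; ring.
apply: ler_wpM2l; first by rewrite mulr_ge0 ?heat_ge0.
exact: prim_sqr_le.
Qed.

End gaussian_poincare.

Section centering.
Context d (T : measurableType d) (R : realType) (mu : {measure set T -> \bar R}).
Variables (q G : T -> R) (c : R).
Hypotheses (Lq : L1 mu q) (q1 : \int[mu]_x q x = 1) (LG : L1 mu (fun x => G x * q x)).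

Lemma Rint_center : \int[mu]_x ((G x - c) * q x) = \int[mu]_x (G x * q x) - c.
Proof.
transitivity (\int[mu]_x (G x * q x - c * q x)); first by apply: eq_Rint => x; rewrite mulrBl.
by rewrite RintB//; [rewrite RintZ// q1 mulr1|exact: (L1Z _ Lq)].
Qed.

Lemma Rint_center_sqr : L1 mu (fun x => G x ^+ 2 * q x) -> c = \int[mu]_x (G x * q x) ->
  \int[mu]_x ((G x - c) ^+ 2 * q x) = \int[mu]_x (G x ^+ 2 * q x) - c ^+ 2.
Proof.
move=> LG2 cE.
transitivity (\int[mu]_y (G y ^+ 2 * q y - (2 * c) * (G y * q y) + c ^+ 2 * q y)).
  by apply: eq_Rint => y; ring.
rewrite RintD; [|exact: (L1B LG2 (L1Z _ LG))|exact: (L1Z _ Lq)].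
rewrite RintB//; last exact: (L1Z _ LG).
by rewrite !RintZ// q1 -cE; ring.
Qed.

End centering.

Section poincare_smooth.
Variable R : realType.
Local Notation mu := (@lebesgue_measure R).
Local Notation mu2 := (mu \x mu)%E.
Variables (f : R -> R) (m v t Rp : R).
Hypotheses (fm : moments f m v) (t0 : 0 < t) (Rp0 : 0 <= Rp).
Hypothesis pf : forall g dg : R -> R, abs_cont_with_deriv g dg ->
  L1 mu (fun x => g x * f x) -> \int[mu]_x (g x * f x) = 0 ->
  L1 mu (fun x => g x ^+ 2 * f x) -> L1 mu (fun x => dg x ^+ 2 * f x) ->
  \int[mu]_x (g x ^+ 2 * f x) <= Rp * \int[mu]_x (dg x ^+ 2 * f x).

Local Notation k := (heat t).
Local Notation p := (smooth f t).

Let Lf := moments_L1 fm.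
Let f0 := moments_ge0 fm.
Let f1 := moments_mass fm.
Let mf : measurable_fun setT f. Proof. exact: L1_line_measurable. Qed.
Let Lk := L1_heat t0.

Lemma measurable_convol_bounded (h : R -> R) (B : R) : measurable_fun setT h ->
  (forall y, `|h y| <= B) -> measurable_fun setT (convol k h).
Proof.
move=> mh hB.
(* Adding the bound [B] makes the integrand nonnegative, as Tonelli measurability asks; the surplus
   integrates to [B]. *)
have mH : measurable_fun setT (fun z : R * R => k z.1 * (h (z.2 - z.1) + B)).
  apply: measurable_funM; first by apply: (measurableT_comp (measurable_heat t)); mfun.
  by apply: measurable_funD; [apply: (measurableT_comp mh); mfun|exact: measurable_cst].
have H0 z : 0 <= k z.1 * (h (z.2 - z.1) + B).
  rewrite mulr_ge0 ?heat_ge0// -lerBlDr sub0r.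
  by have := hB (z.2 - z.1); rewrite ler_norml => /andP[].
have := measurable_funB (plane_measurable_Rint1 mH H0) (measurable_cst B).
rewrite (_ : (_ \- _) = convol k h)//; apply/funext => x /=.
rewrite (_ : (\int[mu]_z _) = \int[mu]_z (k z * h (x - z) + B * k z)).
  rewrite RintD; [|exact: (L1_heat_bounded t0 x mh hB)|exact: (L1Z B Lk)].
  by rewrite RintZ// Rint_heat// mulr1 addrK.
by apply: (eq_Rint mu) => z; rewrite mulrDr [k z * B]mulrC.
Qed.

Lemma convol_heat_bounded (h : R -> R) (B x : R) : measurable_fun setT h ->
  (forall y, `|h y| <= B) -> `|convol k h x| <= B.
Proof.
move=> mh hB; have := convol_bounded x Lk mh hB.
have -> : \int[mu]_z `|k z| = 1.
  by rewrite -[RHS](Rint_heat t0); apply: (eq_Rint mu) => z; rewrite ger0_norm ?heat_ge0.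
by rewrite mulr1.
Qed.

Lemma L1_bounded_density (q h : R -> R) (B : R) : L1 mu q -> measurable_fun setT h ->
  (forall y, `|h y| <= B) -> L1 mu (fun x => h x * q x).
Proof.
move=> Lq mh hB; apply: L1_le (L1Z B (L1_norm Lq)) => [|x].
  exact: (measurable_funM mh (L1_line_measurable Lq)).
by rewrite normrM ler_wpM2r.
Qed.

(** The heat kernel is even, so smoothing the density and smoothing the test function are
    adjoint. *)
Lemma smooth_expect (h : R -> R) (B : R) : measurable_fun setT h -> (forall y, `|h y| <= B) ->
  \int[mu]_y (h y * p y) = \int[mu]_x (convol k h x * f x).
Proof.
move=> mh hB; have Lp := L1_smooth fm t0.
have L := L1_bounded_density Lp mh hB.
rewrite (Rint_convol_comp Lf Lk mh f0 (heat_ge0 t) L).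
rewrite Rint_fubini1; last exact: (L1_convol_comp Lf Lk mh f0 (heat_ge0 t) L).
apply: (eq_Rint mu) => x /=; rewrite -RintZr; last exact: (L1_heat_bounded t0 x mh hB).
rewrite -(Rint_reflect 0 (L1Zr (f x) (L1_heat_bounded t0 x mh hB))).
by apply: (eq_Rint mu) => z; rewrite sub0r opprK heat_opp; ring.
Qed.

Variables (a : R -> R) (M : R).
Hypotheses (La : L1 mu a) (aM : forall x, `|a x| <= M).

Let ma : measurable_fun setT a. Proof. exact: L1_line_measurable. Qed.
Let a2M x : `|a x ^+ 2| <= M ^+ 2.
Proof. by rewrite normrX lerXn2r// ?nnegrE// (le_trans _ (aM x)). Qed.
Let ma2 : measurable_fun setT (fun x => a x ^+ 2). Proof. exact: measurable_funX. Qed.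
Let La2 : L1 mu (fun x => a x ^+ 2).
Proof. by have := L1_bounded_density La ma aM; apply: eq_L1 => x; rewrite expr2. Qed.

Local Notation g := (prim a).
Let mg : measurable_fun setT g. Proof. exact: measurable_primitive. Qed.
Let B := \int[mu]_z `|a z|.
Let gB y : `|g y| <= B. Proof. exact: norm_primitive. Qed.
Let mgg : measurable_fun setT (fun x => g x ^+ 2). Proof. exact: measurable_funX. Qed.
Let ggB y : `|g y ^+ 2| <= B ^+ 2.
Proof. by rewrite normrX lerXn2r// ?nnegrE// (le_trans _ (gB y)). Qed.

(** Fubini, with the increments of primitives written through the step difference [D]. This is what
    admits the smoothed [g] as a test function in the Poincaré inequality for [f]. *)
Lemma abs_cont_smooth : abs_cont_with_deriv (convol k g) (convol k a).
Proof.
move=> c b cb; have Lc := L1_convol Lk La; have mc := L1_line_measurable Lc.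
split; first by apply: integrableS Lc.
have [LD [_ _]] := step_diff_int c b; have mD := L1_line_measurable LD.
pose D w := step w b - step w c.
have P := L1_unshear (L1_prodM Lk La).
have LDP : L1 mu2 (fun z => D z.2 * (k z.1 * a (z.2 - z.1))).
  apply: L1_le (L1_norm P) => [|z].
    apply: measurable_funM; last exact: (L1_plane_measurable P).
    by apply: (measurableT_comp mD); mfun.
  rewrite normrM ler_piMl// /D; have := step_diff cb => /(congr1 (fun f => f z.2)) ->.
  by rewrite indicE; case: (_ \in _); rewrite ?normr1 ?normr0.
have -> : \int[mu]_(x in `[c, b]) convol k a x = \int[mu]_w (D w * convol k a w).
  rewrite /Rintegral; congr fine.
  rewrite -(@integral_itv_bndo_bndc _ (BLeft c) b (EFin \o convol k a)); last first.
    by apply: measurable_funTS; apply/measurable_EFinP.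
  rewrite (@integral_indicM _ _ _ mu _ (convol k a)); apply: eq_integral => w _.
  by rewrite /D; have := step_diff cb => /(congr1 (fun f => f w)) ->.
transitivity (\int[mu2]_z (D z.2 * (k z.1 * a (z.2 - z.1)))).
  rewrite Rint_fubini1// -RintB; [|exact: (L1_heat_bounded t0 _ mg gB)..].
  apply: (eq_Rint mu) => z /=; rewrite -mulrBr primB//.
  have LDz : L1 mu (fun w => (step w (b - z) - step w (c - z)) * a w).
    by apply: eq_L1 (L1B (L1_stepl (b - z) La) (L1_stepl (c - z) La)) => w; rewrite mulrBl.
  rewrite -(Rint_shift (- z) LDz) -RintZ; last exact: (L1_shift (- z) LDz).
  apply: (eq_Rint mu) => w; rewrite /D /step !ltrD2r; ring.
rewrite Rint_fubini2//; apply: (eq_Rint mu) => w /=.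
by rewrite RintZ//; exact: (L1_heat_bounded t0 w ma aM).
Qed.

(** Jensen's inequality: the variance of [a] under the kernel is nonnegative. *)
Lemma convol_heat_sqr (x : R) : convol k a x ^+ 2 <= convol k (fun y => a y ^+ 2) x.
Proof.
have LA := L1_heat_bounded t0 x ma aM; have LA2 := L1_heat_bounded t0 x ma2 a2M.
set A := convol k a x.
have L12 := L1B LA2 (L1Z (2 * A) LA).
have : 0 <= \int[mu]_z (k z * a (x - z) ^+ 2 - (2 * A) * (k z * a (x - z)) + A ^+ 2 * k z).
  apply: Rint_ge0 => z.
  have -> : k z * a (x - z) ^+ 2 - (2 * A) * (k z * a (x - z)) + A ^+ 2 * k z = k z * (a (x - z) - A) ^+ 2.
    by ring.
  by rewrite mulr_ge0 ?heat_ge0 ?sqr_ge0.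
rewrite RintD//; last exact: (L1Z _ Lk).
rewrite RintB//; last exact: (L1Z _ LA).
rewrite (RintZ (2 * A) LA) (RintZ (A ^+ 2) Lk) Rint_heat// -[X in X - _]/(convol k (fun y => a y ^+ 2) x).
rewrite -[X in _ - _ * X]/A; move: (convol k _ x) (A) => u w; lra.
Qed.

(** Variance decomposition for a variable of density [f] plus Gaussian noise: the mean conditional
    variance is at most [t] times the energy by [gaussian_poincare], and the variance of the
    conditional mean is at most [Rp] times it by the inequality for [f] and Jensen. The constants
    add. *)
Lemma poincare_smooth :
  \int[mu]_y ((g y - \int[mu]_z (g z * p z)) ^+ 2 * p y) <= (Rp + t) * \int[mu]_y (a y ^+ 2 * p y).
Proof.
have Lp := L1_smooth fm t0; have p1 := moments_mass (moments_smooth fm t0).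
set gb := \int[mu]_z (g z * p z).
have Lgp := L1_bounded_density Lp mg gB; have Lggp := L1_bounded_density Lp mgg ggB.
pose G := convol k g; pose A := convol k a.
have mG : measurable_fun setT G by exact: measurable_convol_bounded mg gB.
have mGG : measurable_fun setT (convol k (fun y => g y ^+ 2)) by exact: measurable_convol_bounded mgg ggB.
have mA : measurable_fun setT A by exact: measurable_convol_bounded ma aM.
have mAA : measurable_fun setT (convol k (fun y => a y ^+ 2)) by exact: measurable_convol_bounded ma2 a2M.
have GB x := convol_heat_bounded x mg gB.
have LGf : L1 mu (fun x => G x * f x) := L1_bounded_density Lf mG GB.
have LGGf := L1_bounded_density Lf mGG (fun x => convol_heat_bounded x mgg ggB).
have LAAf := L1_bounded_density Lf mAA (fun x => convol_heat_bounded x ma2 a2M).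
have LG2f : L1 mu (fun x => G x ^+ 2 * f x).
  apply: (@L1_bounded_density f _ (B ^+ 2)) => //; first exact: measurable_funX.
  by move=> x; rewrite normrX lerXn2r// ?nnegrE// (le_trans _ (GB x)).
have gbE : gb = \int[mu]_x (G x * f x) by exact: smooth_expect mg gB.
have E1 : \int[mu]_y ((g y - gb) ^+ 2 * p y) = \int[mu]_y (g y ^+ 2 * p y) - gb ^+ 2.
  exact: (Rint_center_sqr Lp p1 Lgp Lggp).
have E2 : \int[mu]_x ((G x - gb) ^+ 2 * f x) = \int[mu]_x (G x ^+ 2 * f x) - gb ^+ 2.
  exact: (Rint_center_sqr Lf f1 LGf LG2f gbE).
have S : \int[mu]_y (g y ^+ 2 * p y) <= \int[mu]_x (G x ^+ 2 * f x) + t * \int[mu]_y (a y ^+ 2 * p y).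
  rewrite (smooth_expect mgg ggB) (smooth_expect ma2 a2M) -RintZ// -RintD//; last exact: L1Z.
  apply: Rint_le => //; first exact: (L1D LG2f (L1Z _ LAAf)).
  move=> x; have := gaussian_poincare La La2 t0 x; rewrite lerBlDl => H.
  by rewrite mulrA -mulrDl ler_wpM2r.
have mGb : measurable_fun setT (fun x => G x - gb) by exact: (measurable_funB mG (measurable_cst gb)).
have GbB x : `|G x - gb| <= B + `|gb| by rewrite (le_trans (ler_normB _ _))// lerD2r GB.
have LA2f : L1 mu (fun x => A x ^+ 2 * f x).
  apply: (@L1_bounded_density f _ (M ^+ 2)) => //; first exact: measurable_funX.
  by move=> x; have AM := convol_heat_bounded x ma aM; rewrite normrX lerXn2r// ?nnegrE// (le_trans _ AM).
have P : \int[mu]_x ((G x - gb) ^+ 2 * f x) <= Rp * \int[mu]_x (A x ^+ 2 * f x).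
  apply: pf => //.
  - move=> c b cb; have [I E] := abs_cont_smooth cb; split => //.
    by rewrite -E opprB addrA subrK.
  - exact: (L1_bounded_density Lf mGb GbB).
  - by rewrite (Rint_center gb Lf f1 LGf) gbE subrr.
  - apply: (@L1_bounded_density f _ ((B + `|gb|) ^+ 2)) => //; first exact: measurable_funX.
    by move=> x; rewrite normrX lerXn2r// ?nnegrE// (le_trans _ (GbB x)).
have AA : \int[mu]_x (A x ^+ 2 * f x) <= \int[mu]_y (a y ^+ 2 * p y).
  rewrite (smooth_expect ma2 a2M); apply: Rint_le => // x.
  by rewrite ler_wpM2r// convol_heat_sqr.
rewrite E1 mulrDl; move: P; rewrite E2 => P.
have : Rp * \int[mu]_x (A x ^+ 2 * f x) <= Rp * \int[mu]_y (a y ^+ 2 * p y) by rewrite ler_wpM2l.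
move: S P; move: (\int[mu]_y (g y ^+ 2 * p y)) (\int[mu]_x (G x ^+ 2 * f x)) (t * _) (Rp * _) (Rp * _) (gb ^+ 2).
by move=> *; lra.
Qed.

End poincare_smooth.

Section poincare_constant.
Variable R : realType.
Local Notation mu := (@lebesgue_measure R).
Variable f : R -> R.
Hypothesis pfin : poincare f \is a fin_num.
Let Rp := fine (poincare f).

Lemma poincare_le (g dg : R -> R) : poincare_admissible f g dg ->
  L1 mu (fun x => dg x ^+ 2 * f x) -> (forall x, 0 <= f x) ->
  \int[mu]_x (g x ^+ 2 * f x) <= Rp * \int[mu]_x (dg x ^+ 2 * f x).
Proof.
move=> adm Ld f0; set I := \int[mu]_x (g x ^+ 2 * f x).
have I0 : 0 < I by have [_ [_ [_ []]]] := adm.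
set D := \int[mu]_x (dg x ^+ 2 * f x).
have D0 : 0 <= D by apply: Rint_ge0 => x; rewrite mulr_ge0 ?sqr_ge0.
have : (I%:E * (D%:E)^-1 <= poincare f)%E.
  apply: ereal_sup_ubound; exists g, dg; split; first exact: adm.
  by rewrite /D (EFin_Rint Ld).
rewrite -(fineK pfin) -/Rp inver; case: eqP => [_|/eqP D1].
  (* If [D = 0] the quotient is [+oo], which a finite supremum excludes. *)
  by rewrite gt0_muley ?lte_fin// leNgt ltry.
by rewrite -EFinM lee_fin ler_pdivrMr// lt_neqAle eq_sym D1.
Qed.

Variables (m v : R).
Hypothesis fm : moments f m v.

(** Zero variance would concentrate the law at the point [m], which is Lebesgue null. *)
Lemma moments_var_gt0 : 0 < v.
Proof.
have L2 := moments_L2 fm; have f0 := moments_ge0 fm.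
rewrite ltNge; apply/negP; rewrite -(moments_var fm) => v0.
have Z := @Rint_eq0 _ (measurableTypeR R) R mu _ L2 _ v0.
have {}Z : {ae mu, forall x, (x - m) ^+ 2 * f x = 0}.
  by apply: Z; apply/aeW => x; rewrite mulr_ge0 ?sqr_ge0.
have N : {ae mu, forall x, x != m}.
  exists [set m]; split; [exact: measurable_set1|exact: lebesgue_measure_set1|].
  by move=> x /= /negP; rewrite negbK => /eqP.
have : \int[mu]_x f x = \int[mu]_x (0 : R).
  apply: ae_eq_Rint; [exact: (L1_line_measurable (moments_L1 fm))|exact: measurable_cst|].
  apply: ae_imp (ae_and Z N) => x [/eqP]; rewrite mulf_eq0 expf_eq0/= subr_eq0.
  by case: eqP => //= _ /eqP.
by rewrite (moments_mass fm) Rint0 => /eqP; rewrite oner_eq0.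
Qed.

(** The test function is [x - m], with derivative 1. The bound keeps the ratio of Poincaré constant
    to variance from growing along the flow. *)
Lemma poincare_ge_var : v <= Rp.
Proof.
have L2 := moments_L2 fm; have f0 := moments_ge0 fm; have Lf := moments_L1 fm.
have := @poincare_le (fun x => x - m) (fun=> 1).
have -> : \int[mu]_x (1 ^+ 2 * f x) = 1.
  by rewrite -[RHS](moments_mass fm); apply: (eq_Rint mu) => x; rewrite expr1n mul1r.
rewrite (moments_var fm) mulr1; apply => //; last first.
  by apply: eq_L1 Lf => x; rewrite expr1n mul1r.
split; last split; last split; last split.
- move=> a b ab; split.
    apply: (@continuous_compact_integrable _ (fun=> 1)); first exact: segment_compact.
    by apply: continuous_subspaceT => x; exact: cvg_cst.
  rewrite Rintegral_cst//= lebesgue_measure_itv/= lte_fin.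
  case: ltgtP ab => //= [ab _|-> _].
    by rewrite mul1r; ring.
  by rewrite mulr0 subrr.
- exact: (L1_first_moment Lf f0 L2).
- exact: (moments_mean fm).
- exact: L2.
- by rewrite (moments_var fm) moments_var_gt0.
Qed.

Lemma poincare_inequality (g dg : R -> R) : abs_cont_with_deriv g dg ->
  L1 mu (fun x => g x * f x) -> \int[mu]_x (g x * f x) = 0 ->
  L1 mu (fun x => g x ^+ 2 * f x) -> L1 mu (fun x => dg x ^+ 2 * f x) ->
  \int[mu]_x (g x ^+ 2 * f x) <= Rp * \int[mu]_x (dg x ^+ 2 * f x).
Proof.
move=> ac L E L2 Ld; have f0 := moments_ge0 fm.
have [I0|I0] := ltP 0 (\int[mu]_x (g x ^+ 2 * f x)); first by apply: poincare_le.
apply: (le_trans I0); rewrite mulr_ge0//.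
  by rewrite (le_trans _ poincare_ge_var)// ltW// moments_var_gt0.
by apply: Rint_ge0 => x; rewrite mulr_ge0 ?sqr_ge0.
Qed.

End poincare_constant.

(** * The heat semigroup and the sum of two smoothed copies *)

Section semigroup.
Variable R : realType.
Local Notation mu := (@lebesgue_measure R).
Local Notation mu2 := (mu \x mu)%E.

Lemma convolA_bounded (a b q : R -> R) (B : R) : L1 mu a -> L1 mu b ->
  (forall x, 0 <= a x) -> (forall x, 0 <= b x) -> measurable_fun setT q ->
  (forall x, `|q x| <= B) -> convol (convol a b) q = convol a (convol b q).
Proof.
move=> La Lb a0 b0 mq qB; apply/funext => y.
have Lab := L1_convol La Lb.
have mq' : measurable_fun setT (fun x : R => q (y - x)) by apply: (measurableT_comp mq); mfun.
have L := L1_bounded_density Lab mq' (fun x => qB (y - x)).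
transitivity (\int[mu]_x (q (y - x) * convol a b x)).
  by apply: (eq_Rint mu) => x; rewrite mulrC.
rewrite (Rint_convol_comp La Lb mq' a0 b0 L).
rewrite Rint_fubini1; last exact: (L1_convol_comp La Lb mq' a0 b0 L).
apply: (eq_Rint mu) => x /=; rewrite -RintZ; last exact: (L1_bounded_convol (y - x) Lb mq qB).
by apply: (eq_Rint mu) => w; rewrite opprD addrA; ring.
Qed.

Lemma convol_heat (t : R) : 0 < t -> convol (heat t) (heat t) = heat (2 * t).
Proof.
move=> t0; rewrite !heatE ?mulr_gt0// convol_normal ?sqrtr_gt0// mulr0.
by rewrite [2 * t]mulrC sqrtrM// ltW.
Qed.

Variables (f : R -> R) (m v t : R).
Hypotheses (fm : moments f m v) (t0 : 0 < t).
Let Lf := moments_L1 fm.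
Let f0 := moments_ge0 fm.
Let Lk := L1_heat t0.
Let k0 := heat_ge0 t.
Let t2 : 0 < 2 * t. Proof. by rewrite mulr_gt0. Qed.
Let mk := @measurable_heat R t.
Let kB (s : R) (s0 : 0 < s) z : `|heat s z| <= heat s 0.
Proof. by rewrite ger0_norm ?heat_ge0// heat_le. Qed.
Local Notation p := (smooth f t).
Let Lp := L1_smooth fm t0.
Let p0 x : 0 <= p x. Proof. by apply: ltW; exact: (smooth_gt0 fm). Qed.
Let mp : measurable_fun setT p. Proof. exact: L1_line_measurable. Qed.
Let pB x : `|p x| <= heat t 0. Proof. by rewrite ger0_norm// (smooth_le fm). Qed.

(** Associativity and commutativity regroup two copies of [f] and two kernels, whose variances add
    up to [2 * t]. *)
Lemma convol_smooth : convol p p = smooth (convol f f) (2 * t).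
Proof.
have -> : convol p p = convol f (convol (heat t) p) by exact: (convolA_bounded Lf Lk f0 k0 mp pB).
have -> : convol (heat t) p = convol f (heat (2 * t)).
  rewrite (convolC mk mp k0 p0) /smooth (convolA_bounded Lf Lk f0 k0 mk (kB t0)).
  by rewrite convol_heat.
by rewrite /smooth (convolA_bounded Lf Lf f0 f0 (@measurable_heat R (2 * t)) (kB t2)).
Qed.

(** Both sides are derivatives of the same function [convol p p]. *)
Lemma convol_dsmooth : convol p (dsmooth f t) = dsmooth (convol f f) (2 * t).
Proof.
have gm := moments_convol fm fm.
apply/funext => y; have D1 := is_derive_smooth gm y t2.
rewrite -convol_smooth in D1.
have [C C0 H] := heat_self_dominated t0; have t4 : 0 < 4 * t by rewrite mulr_gt0.
have dB z : `|dheat t z| <= C * heat (4 * t) 0.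
  by have [_ A _] := H z; rewrite (le_trans A)// ler_wpM2l ?heat_le// ltW.
have dpB x := convol_bounded x Lf (L1_line_measurable (L1_dheat t0)) dB.
have D2 := is_derive_convol y Lp mp pB (fun x => is_derive_smooth fm x t0) dpB.
by have := @derive_val _ _ _ _ _ _ _ D1; rewrite (@derive_val _ _ _ _ _ _ _ D2).
Qed.

Variable Rp : R.
Hypothesis Rpv : v <= Rp.
Hypothesis pf : forall g dg : R -> R, abs_cont_with_deriv g dg ->
  L1 mu (fun x => g x * f x) -> \int[mu]_x (g x * f x) = 0 ->
  L1 mu (fun x => g x ^+ 2 * f x) -> L1 mu (fun x => dg x ^+ 2 * f x) ->
  \int[mu]_x (g x ^+ 2 * f x) <= Rp * \int[mu]_x (dg x ^+ 2 * f x).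

Local Notation th := (2 * Rp / v + 1)^-1.

(** [fisher_sum_le] is applied with variance [v + t] and Poincaré constant [Rp + t]. From [v <= Rp],
    the ratio [(Rp + t) / (v + t)] is at most [Rp / v], so the choice of [th] is independent of
    [t]. *)
Lemma fisher_smooth_sum :
  2 * \int[mu]_s (dsmooth (convol f f) (2 * t) s ^+ 2 / smooth (convol f f) (2 * t) s) <=
  (1 - th) * \int[mu]_x (dsmooth f t x ^+ 2 / p x) + th / (v + t).
Proof.
have v0 := moments_var_gt0 fm; have Rp0 : 0 <= Rp by rewrite (le_trans (ltW v0)).
have M := moments_smooth fm t0.
rewrite -convol_smooth -convol_dsmooth.
have vt : 0 < v + t by rewrite addr_gt0.
have Q0 : 0 < 2 * Rp / v + 1.
  by rewrite ltr_wpDl// divr_ge0 ?mulr_ge0// ltW.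
have [] := @fisher_sum_le R p (dsmooth f t) m (v + t) (Rp + t) Lp
  (fun x => smooth_gt0 fm x t0) (moments_mass M) (moments_L2 M) (moments_mean M) (moments_var M)
  vt (L1_dsmooth fm t0) (fun y => tail_dsmooth fm y t0) (Rint_dsmooth fm t0) (L1_fisher fm t0) _ _ th.
- by rewrite addr_ge0// ltW.
- by move=> a La [B aB] /=; exact: (poincare_smooth fm t0 Rp0 pf La aB).
- by rewrite invr_ge0 ltW.
- rewrite mulrC ler_pdivrMr// mul1r [leRHS]addrC lerD2l.
  rewrite ler_pdivrMr// mulrAC ler_pdivlMr// -!mulrA ler_pM2l//.
  by rewrite mulrDl mulrDr lerD2l mulrC ler_wpM2r// ltW.
- by [].
Qed.

End semigroup.

(** * Entropy along the heat flow *)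

Section entropy_monotone.
Variable R : realType.
Local Notation mu := (@lebesgue_measure R).
Local Notation mu2 := (mu \x mu)%E.

(* Integrating the pointwise bound [b ln q - b ln b <= q - b], with [q] the density of the sum,
   against the law of the independent summand. *)
Lemma entropy_convol_ge (a b : R -> R) : L1 mu a -> L1 mu b ->
  (forall x, 0 <= a x) -> (forall x, 0 <= b x) ->
  \int[mu]_x a x = 1 -> \int[mu]_x b x = 1 -> (forall x, 0 < convol a b x) ->
  L1 mu (fun x => b x * ln (b x)) -> L1 mu (fun x => convol a b x * ln (convol a b x)) ->
  entropy b <= entropy (convol a b).
Proof.
move=> La Lb a0 b0 a1 b1 q0 Lbl Lql; set q := convol a b.
have Lq : L1 mu q by exact: L1_convol.
have mq := L1_line_measurable Lq.
have mlq : measurable_fun setT (fun x => ln (q x)) by exact: (measurableT_comp (@measurable_ln R) mq).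
have Lql' : L1 mu (fun x => ln (q x) * q x) by apply: eq_L1 Lql => x; rewrite mulrC.
have A := L1_convol_comp La Lb mlq a0 b0 Lql'.
have EA := Rint_convol_comp La Lb mlq a0 b0 Lql'.
have B := L1_prodM La Lbl.
have C : L1 mu2 (fun z => a z.1 * q (z.1 + z.2)) by exact: (L1_shear (L1_prodM La Lq)).
have D := L1_prodM La Lb.
have I : \int[mu2]_z (a z.1 * q (z.1 + z.2)) = 1.
  rewrite Rint_fubini1//= -a1; apply: (eq_Rint mu) => x.
  have Lqx : L1 mu (fun y => q (x + y)) by apply: eq_L1 (L1_shift x Lq) => y; rewrite addrC.
  rewrite RintZ//.
  have -> : \int[mu]_y q (x + y) = 1.
    transitivity (\int[mu]_y q (y + x)); first by apply: (eq_Rint mu) => y; rewrite addrC.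
    by rewrite Rint_shift// Rint_convol// a1 b1 mulr1.
  by rewrite mulr1.
have LL := L1B A B; have LRh := L1B C D.
have : \int[mu2]_z (ln (q (z.1 + z.2)) * (a z.1 * b z.2) - a z.1 * (b z.2 * ln (b z.2))) <=
       \int[mu2]_z (a z.1 * q (z.1 + z.2) - a z.1 * b z.2).
  apply: Rint_le LL LRh _ => z.
  have -> : ln (q (z.1 + z.2)) * (a z.1 * b z.2) - a z.1 * (b z.2 * ln (b z.2)) =
     a z.1 * (b z.2 * (ln (q (z.1 + z.2)) - ln (b z.2))) by ring.
  have -> : a z.1 * q (z.1 + z.2) - a z.1 * b z.2 = a z.1 * (q (z.1 + z.2) - b z.2) by ring.
  apply: ler_wpM2l => //; have := b0 z.2; rewrite le_eqVlt => /orP[/eqP <-|bz].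
    by rewrite mul0r subr0 ltW// q0.
  have Q := q0 (z.1 + z.2); rewrite -/q in Q.
  have := ln_le_sub1 (divr_gt0 Q bz); rewrite ln_div ?posrE// => H.
  apply: (le_trans (ler_wpM2l (ltW bz) H)).
  by rewrite mulrBr mulrCA divff ?gt_eqF// !mulr1.
rewrite RintB// RintB// I (Rint_prodM La Lb) (Rint_prodM La Lbl) a1 b1 !mul1r subrr -EA.
rewrite /entropy -/q subr_le0 lerN2 => H; apply: le_trans H.
by rewrite le_eqVlt; apply/orP; left; apply/eqP; apply: (eq_Rint mu) => x; rewrite mulrC.
Qed.

Lemma entropy_heat (t : R) : 0 < t -> entropy (heat t) = 2^-1 * ln t + entropy (normal_pdf (0 : R) 1).
Proof.
move=> t0; rewrite heatE// entropy_normal ?sqrtr_gt0//; congr (_ + _).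
rewrite -powR12_sqrt ?(ltW t0)// ln_powR; by rewrite mulrC.
Qed.

Lemma L1_heat_ln (t : R) : 0 < t -> L1 mu (fun x => heat t x * ln (heat t x)).
Proof. by move=> t0; rewrite heatE//; apply: L1_normal_ln; rewrite sqrtr_gt0. Qed.

Variables (f : R -> R) (m v : R).
Hypothesis fm : moments f m v.
Let Lf := moments_L1 fm.
Let f0 := moments_ge0 fm.
Let f1 := moments_mass fm.
Let mf : measurable_fun setT f. Proof. exact: L1_line_measurable. Qed.

Lemma entropy_smooth_ge_heat (t : R) : 0 < t -> entropy (heat t) <= entropy (smooth f t).
Proof.
move=> t0; apply: entropy_convol_ge => //.
- exact: L1_heat.
- exact: heat_ge0.
- exact: Rint_heat.
- by move=> x; exact: (smooth_gt0 fm).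
- exact: L1_heat_ln.
- exact: (entropy_finite_smooth fm).
Qed.

Lemma entropy_smooth_ge (t : R) : 0 < t -> L1 mu (fun x => f x * ln (f x)) ->
  entropy f <= entropy (smooth f t).
Proof.
move=> t0 Lfl.
have E : smooth f t = convol (heat t) f by rewrite /smooth (convolC mf (@measurable_heat R t) f0 (heat_ge0 t)).
rewrite E; apply: entropy_convol_ge => //.
- exact: L1_heat.
- exact: heat_ge0.
- exact: Rint_heat.
- by move=> x; rewrite -E; exact: (smooth_gt0 fm).
- by rewrite -E; exact: (entropy_finite_smooth fm).
Qed.

Variable Rp : R.
Hypothesis Rpv : v <= Rp.
Hypothesis pf : forall g dg : R -> R, abs_cont_with_deriv g dg ->
  L1 mu (fun x => g x * f x) -> \int[mu]_x (g x * f x) = 0 ->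
  L1 mu (fun x => g x ^+ 2 * f x) -> L1 mu (fun x => dg x ^+ 2 * f x) ->
  \int[mu]_x (g x ^+ 2 * f x) <= Rp * \int[mu]_x (dg x ^+ 2 * f x).

Local Notation th := (2 * Rp / v + 1)^-1.
Local Notation g := (convol f f).
Let gm := moments_convol fm fm.

Let E (t : R) := entropy (smooth g (2 * t)) - (1 - th) * entropy (smooth f t) - th / 2 * ln (v + t).

Let v0 := moments_var_gt0 fm.

Let Rp0 : 0 <= Rp. Proof. exact: le_trans (ltW v0) Rpv. Qed.

Let Q0 : 1 <= 2 * Rp / v + 1.
Proof. by rewrite lerDr divr_ge0 ?mulr_ge0// ltW. Qed.

Let th0 : 0 < th. Proof. by rewrite invr_gt0 (lt_le_trans _ Q0). Qed.
Let th1 : th <= 1. Proof. by rewrite invf_le1 ?(lt_le_trans _ Q0). Qed.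

Let Jf t := \int[mu]_y (dsmooth f t y ^+ 2 / smooth f t y).
Let Jg t := \int[mu]_y (dsmooth g t y ^+ 2 / smooth g t y).

(** In the first term the chain rule factor 2 of the time [2 * t] cancels the 1/2 of de Bruijn's
    identity. *)
Let is_derive_E (t : R) : 0 < t ->
  is_derive t 1 E (Jg (2 * t) - (1 - th) * (2^-1 * Jf t) - th / 2 * (v + t)^-1).
Proof.
move=> t0; have t2 : 0 < 2 * t by rewrite mulr_gt0.
have vt : 0 < v + t by rewrite addr_gt0.
have D0 : is_derive t (1 : R) (fun s : R => 2 * s) 2.
  by apply: is_derive_eq; rewrite /GRing.scale/= mulr1.
have D1 := @is_derive1_comp R (fun s => entropy (smooth g s)) (fun s : R => 2 * s) t _ _ (de_bruijn gm t2) D0.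
have D2 := @is_deriveZ R _ _ (fun s => entropy (smooth f s)) (1 - th) t 1 _ (de_bruijn fm t0).
have D3 : is_derive t (1 : R) (fun s : R => v + s) 1.
  exact: (is_derive_eq (is_deriveD (is_derive_cst v t 1) (is_derive_id t 1)) (add0r 1)).
have D4 := @is_derive1_comp R (@ln R) (fun s : R => v + s) t _ _ (is_derive1_ln vt) D3.
have D5 := @is_deriveZ R _ _ (@ln R \o (fun s : R => v + s)) (th / 2) t 1 _ D4.
have D6 := is_deriveB (is_deriveB D1 D2) D5.
apply: is_derive_eq D6 _; rewrite /GRing.scale/=.
rewrite -/(Jg (2 * t)) -/(Jf t) mulr1; congr (_ - _ - _).
by rewrite mulrAC mulVf ?mul1r// pnatr_eq0.
Qed.

Let E_derive_le0 (t : R) : 0 < t -> Jg (2 * t) - (1 - th) * (2^-1 * Jf t) - th / 2 * (v + t)^-1 <= 0.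
Proof.
move=> t0; have := fisher_smooth_sum fm t0 Rpv pf.
rewrite -/(Jg (2 * t)) -/(Jf t); move: (Jg (2 * t)) (Jf t) (th) ((v + t)^-1) => a b c d; lra.
Qed.

Let E_nonincreasing (s t : R) : 0 < s -> s <= t -> E t <= E s.
Proof.
move=> s0 st; have s2 : 0 < s / 2 by rewrite divr_gt0.
have D (x : R) : s / 2 <= x -> is_derive x 1 E (Jg (2 * x) - (1 - th) * (2^-1 * Jf x) - th / 2 * (v + x)^-1).
  by move=> sx; apply: is_derive_E; rewrite (lt_le_trans _ sx).
apply: (@ler0_derive1_nincry R E (s / 2)) => //.
- move=> x; rewrite in_itv/= andbT => /ltW /D D'.
  exact: (@ex_derive _ _ _ _ _ _ _ D').
- move=> x; rewrite in_itv/= andbT => sx; have D' := D x (ltW sx).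
  rewrite derive1E (@derive_val _ _ _ _ _ _ _ D') E_derive_le0//.
  exact: lt_trans sx.
- apply: derivable_within_continuous => x; rewrite in_itv/= andbT => /D D'.
  exact: (@ex_derive _ _ _ _ _ _ _ D').
- by rewrite ler_pdivrMr// ler_peMr ?ler1n// ltW.
Qed.

Local Notation hphi := (entropy (normal_pdf (0 : R) 1)).

(** The entropy power inequality leaves [th] times the entropy of the smoothed [f], which is at
    least that of the added noise; the logarithms then differ by [ln (1 + v / t) <= v / t]. *)
Let E_far (t : R) : 0 < t -> 2^-1 * ln 2 + th * hphi - th / 2 * (v / t) <= E t.
Proof.
move=> t0; have M := moments_smooth fm t0.
have Lp := moments_L1 M.
have epi : entropy (smooth f t) + 2^-1 * ln 2 <= entropy (smooth g (2 * t)).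
  rewrite -(convol_smooth fm t0); apply: entropy_power_inequality.
  - exact: L1_line_measurable.
  - exact: (moments_ge0 M).
  - by rewrite -EFin_Rint// (moments_mass M).
  - exact: (entropy_finite_smooth fm).
  - by rewrite (convol_smooth fm t0); apply: (entropy_finite_smooth gm); rewrite mulr_gt0.
have hp := entropy_smooth_ge_heat t0; rewrite entropy_heat// in hp.
have vt : 0 < v + t by rewrite addr_gt0.
have lnv : ln (v + t) - ln t <= v / t.
  rewrite -ln_div ?posrE//; apply: (le_trans (ln_le_sub1 (divr_gt0 vt t0))).
  by rewrite mulrDl divff ?gt_eqF// addrK.
have H1 : th * (2^-1 * ln t + hphi) <= th * entropy (smooth f t) by rewrite ler_pM2l.
have H2 : th / 2 * (ln (v + t) - ln t) <= th / 2 * (v / t) by rewrite ler_pM2l// divr_gt0.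
move: epi H1 H2; rewrite /E.
move: (entropy (smooth g _)) (entropy (smooth f t)) (ln (v + t)) (ln t) (ln 2) (v / t) hphi (th).
by move=> a b c d e h i j; lra.
Qed.

Lemma smooth_entropy_jump (t : R) : 0 < t ->
  2^-1 * ln 2 + th * hphi + (1 - th) * entropy (smooth f t) + th / 2 * ln (v + t)
    <= entropy (smooth g (2 * t)).
Proof.
move=> t0.
suff : 2^-1 * ln 2 + th * hphi <= E t.
  by rewrite /E lerBrDr lerBrDr addrAC.
rewrite leNgt; apply/negP => H.
pose e := 2^-1 * ln 2 + th * hphi - E t; have e0 : 0 < e by rewrite subr_gt0.
(* At this time the error [th / 2 * (v / T)] is at most half of the supposed deficit [e]. *)
pose T := Num.max t (th * v / e).
have T0 : 0 < T by rewrite lt_max t0.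
have H1 : E T <= E t by apply: E_nonincreasing => //; rewrite le_max lexx.
have H2 := E_far T0.
have H3 : th / 2 * (v / T) <= e / 2.
  rewrite mulrAC ler_pM2r ?invr_gt0//.
  by rewrite mulrA ler_pdivrMr// [e * T]mulrC -ler_pdivrMr// le_max lexx orbT.
have := le_trans H2 H1; rewrite lerBlDr => H4.
have := le_trans H4 (lerD (lexx (E t)) H3); rewrite -lerBlDl -/e leNgt => /negP; apply.
by rewrite ltr_pdivrMr// ltr_pMr// ltr1n.
Qed.


End entropy_monotone.

Lemma three_epsilon (R : realFieldType) (a b c d e : R) :
  `|a - b| <= e / 4 -> `|c - d| <= e / 4 -> `|d - b| < e / 2 -> `|a - c| <= e.
Proof.
rewrite !ler_norml ltr_norml => /andP[? ?] /andP[? ?] /andP[? ?].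
by apply/andP; split; lra.
Qed.

(** * Weak continuity as the Gaussian noise vanishes *)

Section weak_continuity.
Variable R : realType.
Local Notation mu := (@lebesgue_measure R).
Local Notation mu2 := (mu \x mu)%E.

Definition plateau (n : nat) (x : R) : R := Num.min 1 (Num.max 0 (n.+1%:R - `|x|)).

Lemma plateau01 n x : 0 <= plateau n x <= 1.
Proof. by rewrite /plateau le_min ler01 le_max lexx/= ge_min lexx. Qed.

Lemma plateau_out n x : n.+1%:R <= `|x| -> plateau n x = 0.
Proof.
by move=> nx; rewrite /plateau max_l ?subr_le0// min_r.
Qed.

Lemma plateau_in (n : nat) x : `|x| <= n%:R -> plateau n x = 1.
Proof.
move=> nx; have H : 1 <= n.+1%:R - `|x| by rewrite -natr1 lerBrDr addrC lerD2r.
by rewrite /plateau max_r ?(le_trans ler01)// min_l.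
Qed.

Lemma continuous_plateau n : continuous (plateau n).
Proof.
have -> : plateau n = (fun=> 1) \min ((fun=> 0) \max (fun x : R => n.+1%:R - `|x|)) by [].
move=> x; apply: continuous_min; first exact: cvg_cst.
apply: continuous_max; first exact: cvg_cst.
by apply: cvgB; [exact: cvg_cst|exact: norm_continuous].
Qed.

(** Multiplying a continuous approximant on the compact [E] by a plateau gives compact support; the
    error splits into the error on [E] and the mass of [|g|] under [1 - plateau]. *)
Lemma L1_approx_continuous (g : R -> R) (e : R) : L1 mu g -> 0 < e ->
  exists u : R -> R, exists n : nat, exists B : R,
    [/\ continuous u, forall x, `|u x| <= B, forall x, n%:R <= `|x| -> u x = 0, L1 mu u &
        \int[mu]_x `|g x - u x| <= e].
Proof.
move=> Lg e0; have e2 : 0 < e / 2 by rewrite divr_gt0.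
have mg := L1_line_measurable Lg.
have mpl n : measurable_fun setT (plateau n) by apply: continuous_measurable_fun; exact: continuous_plateau.
have m1pl n : measurable_fun setT (fun x : R => 1 - plateau n x).
  by apply: measurable_funB; [exact: measurable_cst|exact: mpl].
have [n Hn] : exists n, \int[mu]_x ((1 - plateau n x) * `|g x|) < e / 2.
  have [] := @L1_dominated_cvg _ _ _ mu (fun n x => (1 - plateau n x) * `|g x|) (fun=> 0) (fun x => `|g x|).
  - move=> n; apply: (measurable_funM _ (L1_line_measurable (L1_norm Lg))).
    exact: m1pl.
  - exact: measurable_cst.
  - exact: L1_norm.
  - move=> n x; have /andP[p0 p1] := plateau01 n x.
    by rewrite ger0_norm ?mulr_ge0 ?subr_ge0// ler_piMl// lerBlDr lerDl.
  - move=> x; apply: cvg_near_cst; near=> n.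
    rewrite plateau_in ?subrr ?mul0r//.
    by rewrite (le_trans (ltW (Num.Theory.truncnS_gt `|x|)))// ler_nat; near: n; exact: nbhs_infty_ge.
  move=> _; rewrite Rint0 => /cvgrPdist_lt /(_ _ e2) [n _ /(_ n (leqnn n))] /=.
  by rewrite sub0r normrN => H; exists n; rewrite (le_lt_trans (ler_norm _)).
pose E : set R := `[(- n.+1%:R)%R, n.+1%:R]%classic.
have mE : measurable E by exact: measurable_itv.
have muE : (mu E < +oo)%E by rewrite lebesgue_measure_itv/=; case: ifP => _; rewrite ?ltry// -EFinB ltry.
have LgE : mu.-integrable E (EFin \o g) by apply: integrableS Lg.
have [g_ [cg Lg_ cvg]] := approximation_continuous_integrable mE muE LgE.
have [k Hk] : exists k, (\int[mu]_(z in E) (`|g z - g_ k z|)%:E < (e / 2)%:E)%E.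
  move/fine_cvgP: cvg => [fin /cvgrPdist_lt/(_ _ e2) H].
  near \oo => k; exists k.
  have fk : (\int[mu]_(z in E) (`|(g z - g_ k z)%R%:E|))%E \is a fin_num by near: k.
  rewrite -[ltLHS]/(\int[mu]_(z in E) (`|(g z - g_ k z)%R%:E|))%E -(fineK fk) lte_fin.
  apply: (le_lt_trans (ler_norm _)); rewrite -normrN -sub0r; near: k; exact: H.
pose c := g_ k; pose u x := c x * plateau n x.
have cc : continuous c by exact: cg.
have cu : continuous u by move=> x; apply: cvgM; [exact: cc|exact: continuous_plateau].
have mc : measurable_fun setT c by exact: continuous_measurable_fun.
have mu_ : measurable_fun setT u by exact: continuous_measurable_fun.
have u0 x : n.+1%:R <= `|x| -> u x = 0 by move=> nx; rewrite /u plateau_out// mulr0.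
have [B uB] : exists B : R, forall x, `|u x| <= B.
  have /compact_bounded[M [_ HM]] := continuous_compact (continuous_subspaceT cu) (@segment_compact R (- n.+1%:R) n.+1%:R).
  exists (`|M| + 1) => x; have [xn|xn] := ltP `|x| n.+1%:R; last first.
    by rewrite u0// normr0 addr_ge0.
  apply: (HM (`|M| + 1)); first by rewrite (le_lt_trans (ler_norm _))// ltrDl.
  by exists x => //; rewrite /= in_itv/= -ler_norml ltW.
have inE x : `|x| < n.+1%:R -> x \in E.
  by move=> xn; rewrite in_setE /E/= in_itv/= -ler_norml ltW.
have LIE : L1 mu (\1_E : R -> R).
  apply: L1_ge0; [exact: measurable_indic|by []|].
  by rewrite integral_indic// setIT.
have Lu : L1 mu u.
  apply: L1_le (L1Z B LIE) => // x.
  have [xn|xn] := ltP `|x| n.+1%:R; first by rewrite indicE inE// mulr1.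
  rewrite u0// normr0 mulr_ge0//; exact: le_trans (uB 0).
have LEc : L1 mu (fun x => \1_E x * `|g x - c x|).
  apply: L1_ge0.
  - apply: measurable_funM; first exact: measurable_indic.
    exact: (measurableT_comp (@normr_measurable R setT) (measurable_funB mg mc)).
  - by move=> x; rewrite mulr_ge0.
  - rewrite -(@integral_indicM _ (measurableTypeR R) R mu E (fun x => `|g x - c x|)).
    exact: lt_trans Hk (ltry _).
have Lpl : L1 mu (fun x => (1 - plateau n x) * `|g x|).
  apply: L1_le (L1_norm Lg) => [|x].
    apply: (measurable_funM _ (L1_line_measurable (L1_norm Lg))).
    exact: m1pl.
  have /andP[p0 p1] := plateau01 n x.
  by rewrite ger0_norm ?mulr_ge0 ?subr_ge0// ler_piMl// lerBlDr lerDl.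
exists u, n.+1, B; split => //.
apply: (@le_trans _ _ (\int[mu]_x (\1_E x * `|g x - c x| + (1 - plateau n x) * `|g x|))).
  apply: Rint_le; [exact: (L1_norm (L1B Lg Lu))|exact: (L1D LEc Lpl)|move=> x].
  have /andP[p0 p1] := plateau01 n x.
  have -> : g x - u x = (g x - c x) * plateau n x + (1 - plateau n x) * g x by rewrite /u; ring.
  apply: (le_trans (ler_normD _ _)); apply: lerD; last first.
    by rewrite normrM ger0_norm ?subr_ge0.
  rewrite normrM [`|plateau n x|]ger0_norm// mulrC ler_wpM2r//.
  have [xn|xn] := ltP `|x| n.+1%:R; first by rewrite indicE inE.
  by rewrite plateau_out.
rewrite RintD// [leRHS]splitr lerD//; last exact: ltW.
rewrite -lee_fin EFin_Rint// -(@integral_indicM _ (measurableTypeR R) R mu E (fun x => `|g x - c x|)).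
exact: ltW.
Unshelve. all: by end_near. Qed.

(** Rescaling fixes the kernel at time 1 and moves the small parameter [r] into the argument of [u],
    where continuity can act. *)
Lemma convol_heat_scaled (u : R -> R) (r x B : R) : 0 < r -> measurable_fun setT u ->
  (forall y, `|u y| <= B) ->
  convol u (heat (r ^+ 2)) x = \int[mu]_z (heat 1 z * u (x - r * z)).
Proof.
move=> r0 mu_ uB; have r2 : 0 < r ^+ 2 by rewrite exprn_gt0.
have L := L1_heat_bounded r2 x mu_ uB.
rewrite /convol (Rint_convol_sym L) -(Rint_affine 0 (lt0r_neq0 r0) L) gtr0_norm// -RintZ; last first.
  exact: (L1_affine 0 (lt0r_neq0 r0) L).
apply: (eq_Rint mu) => z; rewrite addr0 mulrA; congr (_ * _).
rewrite !heatE// sqrtr_sqr gtr0_norm// sqrtr1 -(normal_pdf_affine 0 z r0).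
by rewrite addr0.
Qed.

(** Since [|x|] is at most [n + |z|], [x ^+ 2 / 8] is at most [n ^+ 2 / 4 + z ^+ 2 / 4]: half of the
    exponent [z ^+ 2 / 2] is traded for decay in [x]. The resulting bound is integrable on the plane
    and uniform in [r]. *)
Lemma heat1_dominated (n x y z r : R) : 0 <= n -> 0 <= r <= 1 -> `|x - r * z| <= n ->
  heat 1 z <= (expR (2^-1 * ln 2 + 2^-1 * ln 4 + n ^+ 2 / 4) / normal_peak 1) * (heat 4 x * heat 2 z).
Proof.
move=> n0 /andP[r0 r1] xn.
have P0 : 0 < normal_peak (1 : R) by rewrite normal_peak_gt0// oner_neq0.
rewrite /heat ln1 mulr0 oppr0 add0r mulr1.
set A := expR (_ + _ + _).
have -> : A / normal_peak 1 * (normal_peak 1 * expR (- (2^-1 * ln 4) - x ^+ 2 / (2 * 4)) *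
     (normal_peak 1 * expR (- (2^-1 * ln 2) - z ^+ 2 / (2 * 2)))) =
  normal_peak 1 * (A * expR (- (2^-1 * ln 4) - x ^+ 2 / (2 * 4)) * expR (- (2^-1 * ln 2) - z ^+ 2 / (2 * 2))).
  by field; rewrite lt0r_neq0.
rewrite ler_pM2l// /A -!expRD ler_expR.
have X : x ^+ 2 <= 2 * n ^+ 2 + 2 * z ^+ 2.
  have H1 : `|x| <= n + `|z|.
    rewrite -(subrK (r * z) x); apply: (le_trans (ler_normD _ _)); apply: lerD => //.
    by rewrite normrM (ger0_norm r0) ler_piMl.
  have H2 : `|x| ^+ 2 <= (n + `|z|) ^+ 2 by rewrite lerXn2r ?nnegrE ?addr_ge0.
  rewrite real_normK ?num_real// in H2; apply: (le_trans H2).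
  have : 0 <= (n - `|z|) ^+ 2 by rewrite sqr_ge0.
  by rewrite sqrrB sqrrD real_normK ?num_real//; move: (n * `|z|) (n ^+ 2) (z ^+ 2) => a b c; lra.
by move: X; move: (x ^+ 2) (n ^+ 2) (z ^+ 2) (ln 4) (ln 2) => a b c d l; lra.
Qed.

Lemma weak_cvg_continuous (u h : R -> R) (n : nat) (B M : R) : continuous u ->
  (forall x, `|u x| <= B) -> (forall x, n%:R <= `|x| -> u x = 0) -> L1 mu u ->
  measurable_fun setT h -> (forall x, `|h x| <= M) ->
  (fun j : nat => \int[mu]_x (h x * convol u (heat (j.+1%:R^-1 ^+ 2)) x)) @ \oo --> \int[mu]_x (h x * u x).
Proof.
move=> cu uB u0 Lu mh hM.
have mu_ : measurable_fun setT u by exact: continuous_measurable_fun.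
have B0 : 0 <= B by exact: le_trans (uB 0).
have M0 : 0 <= M by exact: le_trans (hM 0).
pose H (r : R) (z : R * R) := h z.1 * (heat 1 z.2 * u (z.1 - r * z.2)).
have mH r : measurable_fun setT (H r).
  apply: measurable_funM; first by apply: (measurableT_comp mh); mfun.
  apply: measurable_funM; first by apply: (measurableT_comp (@measurable_heat R 1)); mfun.
  by apply: (measurableT_comp mu_); mfun.
pose C := expR (2^-1 * ln 2 + 2^-1 * ln 4 + n%:R ^+ 2 / 4) / normal_peak (1 : R).
pose b (z : R * R) := M * B * C * (heat 4 z.1 * heat 2 z.2).
have Lb : L1 mu2 b by apply: L1Z; apply: L1_prodM; apply: L1_heat.
have C0 : 0 <= C by rewrite divr_ge0 ?expR_ge0// normal_peak_ge0.
have Hb (r : R) z : 0 <= r <= 1 -> `|H r z| <= b z.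
  move=> r01; rewrite /H normrM [X in _ * X]normrM (ger0_norm (heat_ge0 1 z.2)).
  have hh : 0 <= heat 4 z.1 * heat 2 z.2 by rewrite mulr_ge0 ?heat_ge0.
  have [xn|xn] := leP n%:R `|z.1 - r * z.2|.
    rewrite u0// normr0 !mulr0 /b; apply: mulr_ge0 => //.
    by apply: mulr_ge0 => //; exact: mulr_ge0.
  have D := heat1_dominated z.1 (ler0n _ n) r01 (ltW xn).
  have -> : b z = M * (B * (C * (heat 4 z.1 * heat 2 z.2))) by rewrite /b -mulrA -mulrA.
  rewrite [heat 1 _ * _]mulrC; apply: ler_pM => //; first by rewrite mulr_ge0 ?heat_ge0.
  by apply: ler_pM => //; exact: heat_ge0.
have r01 (j : nat) : 0 <= (j.+1%:R^-1 : R) <= 1.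
  by rewrite invr_ge0 ler0n/= invf_le1// ler1n.
have r_cvg : (fun j : nat => (j.+1%:R^-1 : R)) @ \oo --> (0 : R) by exact: cvg_harmonic.
have [] := @L1_dominated_cvg _ _ _ mu2 (fun j => H j.+1%:R^-1) (H 0) b.
- by move=> j; exact: mH.
- exact: mH.
- exact: Lb.
- by move=> j z; exact: Hb.
- move=> z; apply: cvgM; first exact: cvg_cst.
  apply: cvgM; first exact: cvg_cst.
  apply: (@cvg_comp _ _ _ (fun j : nat => z.1 - j.+1%:R^-1 * z.2) u _ (nbhs (z.1 - 0 * z.2))); last exact: cu.
  by apply: cvgB; [exact: cvg_cst|apply: cvgM => //; exact: cvg_cst].
move=> L0 cv.
have E0 : \int[mu2]_z H 0 z = \int[mu]_x (h x * u x).
  rewrite Rint_fubini1//; apply: (eq_Rint mu) => x; rewrite /H/=.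
  transitivity (\int[mu]_z ((h x * u x) * heat 1 z)).
    by apply: (eq_Rint mu) => z; rewrite mul0r subr0 [heat 1 z * _]mulrC mulrA.
  by rewrite RintZ ?Rint_heat ?mulr1//; exact: L1_heat.
have Ej (j : nat) : \int[mu2]_z H j.+1%:R^-1 z = \int[mu]_x (h x * convol u (heat (j.+1%:R^-1 ^+ 2)) x).
  have LH : L1 mu2 (H j.+1%:R^-1).
    by apply: L1_le Lb; [exact: mH|move=> z; exact: Hb].
  rewrite Rint_fubini1//; apply: (eq_Rint mu) => x.
  rewrite (@convol_heat_scaled u _ x B) ?invr_gt0// /H/= RintZ//.
  apply: L1_le (L1Zr B (L1_heat ltr01)) => [|z].
    apply: measurable_funM; first exact: measurable_heat.
    by apply: (measurableT_comp mu_); mfun.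
  by rewrite normrM ger0_norm ?heat_ge0// ler_wpM2l ?heat_ge0.
rewrite -E0; apply: cvg_trans cv; apply: near_eq_cvg; apply: nearW => j; exact: Ej.
Qed.

(** Smoothing contracts the [L1] norm, so replacing [g] by a compactly supported continuous [u]
    costs little both before and after it. The test function is measurable and bounded, as the
    truncated log-ratios used later are. *)
Lemma smooth_weak (g h : R -> R) (M e d : R) : L1 mu g -> measurable_fun setT h ->
  (forall x, `|h x| <= M) -> 0 < e -> 0 < d ->
  exists2 s : R, 0 < s < d & `|\int[mu]_x (h x * convol g (heat s) x) - \int[mu]_x (h x * g x)| <= e.
Proof.
move=> Lg mh hM e0 d0; have M0 : 0 <= M by exact: le_trans (hM 0).
pose e' := e / (4 * (M + 1)).
have M1 : 0 < M + 1 by rewrite ltr_wpDl.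
have e'0 : 0 < e' by rewrite divr_gt0// mulr_gt0.
have [u [n [B [cu uB u0 Lu Hu]]]] := L1_approx_continuous Lg e'0.
have cv := weak_cvg_continuous cu uB u0 Lu mh hM.
have e2 : 0 < e / 2 by rewrite divr_gt0.
have [j jd Hj] : exists2 j : nat, (j.+1%:R^-1 ^+ 2 : R) < d &
   `|\int[mu]_x (h x * u x) - \int[mu]_x (h x * convol u (heat (j.+1%:R^-1 ^+ 2)) x)| < e / 2.
  near \oo => j; exists j.
    near: j; have /cvgrPdist_lt/(_ _ d0) : (fun j : nat => (j.+1%:R^-1 ^+ 2 : R)) @ \oo --> (0 : R).
      by rewrite -[X in _ --> X](mul0r 0); under eq_fun do rewrite expr2; apply: cvgM; exact: cvg_harmonic.
    by apply: filterS => j; rewrite sub0r normrN ger0_norm ?sqr_ge0.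
  by near: j; move/cvgrPdist_lt: cv; apply.
set s := (j.+1%:R^-1 ^+ 2 : R) in jd Hj.
have s0 : 0 < s by rewrite exprn_gt0// invr_gt0.
exists s; first by rewrite s0.
have Lk := L1_heat s0.
have bnd (q : R -> R) : L1 mu q -> `|\int[mu]_x (h x * q x)| <= M * \int[mu]_x `|q x|.
  move=> Lq; have L := L1_bounded_density Lq mh hM.
  apply: (le_trans (le_normr_Rintegral measurableT L)); rewrite -RintZ; last exact: L1_norm.
  apply: Rint_le (L1_norm L) (L1Z M (L1_norm Lq)) _ => x.
  by rewrite normrM ler_wpM2r.
have Lgu := L1B Lg Lu.
have C1 : \int[mu]_x `|convol (fun y => g y - u y) (heat s) x| <= \int[mu]_x `|g x - u x|.
  have Ln := L1_norm Lgu.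
  rewrite -[leRHS]mulr1 -(Rint_heat s0) -(Rint_convol Ln Lk).
  have kB z : `|heat s z| <= heat s 0 by rewrite ger0_norm ?heat_ge0// heat_le.
  apply: Rint_le; [exact: (L1_norm (L1_convol Lgu Lk))|exact: L1_convol|move=> x].
  have L := L1_bounded_convol x Lgu (@measurable_heat R s) kB.
  apply: (le_trans (le_normr_Rintegral measurableT L)).
  rewrite le_eqVlt; apply/orP; left; apply/eqP; apply: (eq_Rint mu) => y.
  by rewrite normrM [`|heat _ _|]ger0_norm ?heat_ge0.
have E : \int[mu]_x (h x * convol g (heat s) x) - \int[mu]_x (h x * convol u (heat s) x) =
    \int[mu]_x (h x * convol (fun y => g y - u y) (heat s) x).
  rewrite -RintB; [|exact: (L1_bounded_density (L1_convol Lg Lk) mh hM)|exact: (L1_bounded_density (L1_convol Lu Lk) mh hM)].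
  apply: (eq_Rint mu) => x; rewrite -mulrBr; congr (_ * _); rewrite /convol.
  have kB z : `|heat s z| <= heat s 0 by rewrite ger0_norm ?heat_ge0// heat_le.
  rewrite -RintB; [|exact: (L1_bounded_convol x Lg (@measurable_heat R s) kB)|exact: (L1_bounded_convol x Lu (@measurable_heat R s) kB)].
  by apply: (eq_Rint mu) => y; rewrite mulrBl.
have F : \int[mu]_x (h x * g x) - \int[mu]_x (h x * u x) = \int[mu]_x (h x * (g x - u x)).
  rewrite -RintB; [|exact: (L1_bounded_density Lg mh hM)|exact: (L1_bounded_density Lu mh hM)].
  by apply: (eq_Rint mu) => x; rewrite mulrBr.
have B1 : `|\int[mu]_x (h x * convol (fun y => g y - u y) (heat s) x)| <= e / 4.
  apply: (le_trans (bnd _ (L1_convol Lgu Lk))); apply: (@le_trans _ _ (M * e')).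
    by rewrite ler_wpM2l// (le_trans C1).
  by rewrite /e' mulrA ler_pdivrMr ?mulr_gt0// mulrA divfK ?pnatr_eq0// mulrC ler_pM2l// lerDl.
have B2 : `|\int[mu]_x (h x * (g x - u x))| <= e / 4.
  apply: (le_trans (bnd _ Lgu)); apply: (@le_trans _ _ (M * e')).
    by rewrite ler_wpM2l.
  by rewrite /e' mulrA ler_pdivrMr ?mulr_gt0// mulrA divfK ?pnatr_eq0// mulrC ler_pM2l// lerDl.
move: B1 B2 Hj; rewrite -E -F.
move: (\int[mu]_x (h x * convol g (heat s) x)) (\int[mu]_x (h x * convol u (heat s) x))
  (\int[mu]_x (h x * g x)) (\int[mu]_x (h x * u x)) => a b c d'.
exact: three_epsilon.
Unshelve. all: by end_near. Qed.

End weak_continuity.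

(** Young's inequality for the conjugate pair [p * ln p - p] and [expR a]; it bounds an entropy
    integrand below by expressions affine in [p]. *)
Lemma fenchel_ln (R : realType) (a p : R) : 0 < p -> p * a + p - expR a <= p * ln p.
Proof.
move=> p0; have := ln_le_sub1 (divr_gt0 (expR_gt0 a) p0).
rewrite ln_div ?posrE ?expR_gt0// expRK => /(ler_wpM2l (ltW p0)).
have -> : p * (expR a / p - 1) = expR a - p by field; rewrite gt_eqF.
by rewrite mulrBr; move: (p * a) (p * ln p) (expR a) => *; lra.
Qed.

Section entropy_limit.
Variable R : realType.
Local Notation mu := (@lebesgue_measure R).
Variables (g : R -> R) (m v : R).
Hypothesis gm : moments g m v.
Hypothesis Lgl : L1 mu (fun x => g x * ln (g x)).
Let Lg := moments_L1 gm.
Let g0 := moments_ge0 gm.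
Let g1 := moments_mass gm.
Let mg : measurable_fun setT g. Proof. exact: L1_line_measurable. Qed.

Local Notation gam := (normal_pdf m 1).

Let gam0 x : 0 < gam x. Proof. by apply: normal_pdf_gt0; exact: oner_neq0. Qed.
Let mgam : measurable_fun setT gam. Proof. exact: measurable_normal_pdf. Qed.
Let Lgam : L1 mu gam. Proof. exact: L1_normal. Qed.

Lemma cross_entropy (q : R -> R) (s : R) : moments q m s ->
  L1 mu (fun x => q x * ln (gam x)) /\
  \int[mu]_x (q x * ln (gam x)) = ln (normal_peak 1) - s / 2.
Proof.
move=> qm; have Lq := moments_L1 qm; have L2 := moments_L2 qm.
have E x : q x * ln (gam x) = ln (normal_peak 1) * q x - 2^-1 * ((x - m) ^+ 2 * q x).
  by rewrite ln_normal_pdf ?oner_eq0// expr1n mul1r; ring.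
split; first by apply: eq_L1 (L1B (L1Z _ Lq) (L1Z 2^-1 L2)) => x; rewrite E.
rewrite (eq_Rint mu E) RintB; [|exact: (L1Z _ Lq)|exact: (L1Z _ L2)].
by rewrite !RintZ// (moments_mass qm) (moments_var qm) mulr1 [2^-1 * _]mulrC.
Qed.

Let lr x := ln (g x) - ln (gam x).

Let Lglr : L1 mu (fun x => g x * lr x).
Proof. by apply: eq_L1 (L1B Lgl (cross_entropy gm).1) => x; rewrite /lr mulrBr. Qed.

(** The log-likelihood ratio against [gam], truncated at level [n]. Where [g] vanishes the ratio is
    minus infinity, hence the value [- n%:R] in place of the default [ln 0]. *)
Let clip (n : nat) x : R := if 0 < g x then Num.max (- n%:R) (Num.min n%:R (lr x)) else - n%:R.

Let mln (q : R -> R) : measurable_fun setT q -> measurable_fun setT (fun x => ln (q x)).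
Proof. by move=> mq; exact: (measurableT_comp (@measurable_ln R) mq). Qed.

Let mclip n : measurable_fun setT (clip n).
Proof.
apply: measurable_fun_ifT; last exact: measurable_cst.
  by apply: measurable_fun_ltr; [exact: measurable_cst|exact: mg].
apply: measurable_maxr; first exact: measurable_cst.
apply: measurable_minr; first exact: measurable_cst.
exact: (measurable_funB (mln mg) (mln mgam)).
Qed.

Let clipB n x : `|clip n x| <= n%:R.
Proof.
rewrite /clip; case: ifP => _; last by rewrite normrN ger0_norm.
rewrite ler_norml le_max lexx/= ge_max ge_min lexx/= andbT.
by rewrite (@le_trans _ _ 0)// oppr_le0.
Qed.

Let clip_le n x : 0 < g x -> `|clip n x| <= `|lr x|.
Proof.
move=> gx; rewrite /clip gx.
have n0 : (0 : R) <= n%:R by exact: ler0n.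
case: (lerP n%:R (lr x)) => [nl|ln].
  rewrite max_r ?(le_trans _ n0) ?oppr_le0//.
  by rewrite ger0_norm// (le_trans nl)// ler_norm.
case: (lerP (- n%:R) (lr x)) => // lx.
rewrite normrN ger0_norm// ltr0_norm; first by rewrite lerNr ltW.
by rewrite (lt_le_trans lx)// oppr_le0.
Qed.

(** A bound uniform in [n] for dominated convergence: a positive [clip n x] is at most [lr x], whose
    exponential is [g x / gam x], and a nonpositive one has exponential at most 1. *)
Let gam_clip n x : gam x * expR (clip n x) <= g x + gam x.
Proof.
have := g0 x; rewrite le_eqVlt => /orP[/eqP gx|gx].
  by rewrite -gx add0r /clip -gx ltxx ler_piMr ?(ltW (gam0 x))// ?expR_le1 ?oppr_le0.
have [cl|cl] := leP (clip n x) 0.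
  rewrite (@le_trans _ _ (gam x))// ?lerDr ?(ltW gx)//.
  by rewrite ler_piMr ?(ltW (gam0 x))// expR_le1.
rewrite (@le_trans _ _ (g x))// ?lerDl ?(ltW (gam0 x))//.
have H : clip n x <= lr x.
  move: cl; rewrite /clip gx; case: (lerP (- n%:R) (Num.min n%:R (lr x))) => [_ _|_].
    by rewrite ge_min lexx orbT.
  by rewrite oppr_gt0 ltNge ler0n.
rewrite -ler_pdivlMl// mulrC -[leRHS]lnK ?posrE ?divr_gt0//.
by rewrite ler_expR ln_div ?posrE.
Qed.

Let clip_cvg x : (fun n => g x * clip n x - gam x * expR (clip n x)) @ \oo --> g x * lr x - g x.
Proof.
have := g0 x; rewrite le_eqVlt => /orP[/eqP gx|gx].
  rewrite -gx mul0r subrr.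
  rewrite (_ : (fun n : nat => _) = (fun n : nat => (- gam x) * expR (- n%:R))); last first.
    by apply/funext => n; rewrite /clip -gx ltxx mul0r add0r mulNr.
  have H0 : (fun n : nat => expR (- n%:R) : R) @ \oo --> (0 : R).
    exact: (cvg_comp _ _ (@cvgr_idn R) (@cvgr_expR R)).
  have C : (fun n : nat => - gam x * expR (- n%:R)) @ \oo --> - gam x * 0.
    by apply: cvgM; [exact: cvg_cst|exact: H0].
  by rewrite mulr0 in C.
apply: cvg_near_cst; near=> n.
have H : `|lr x| <= n%:R.
  by rewrite (le_trans (ltW (Num.Theory.truncnS_gt `|lr x|)))// ler_nat; near: n; exact: nbhs_infty_ge.
have cE : clip n x = lr x.
  by move: H; rewrite ler_norml => /andP[H1 H2]; rewrite /clip gx min_r// max_r.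
rewrite cE; congr (_ - _).
by rewrite /lr -ln_div ?posrE// lnK ?posrE ?divr_gt0// mulrCA divff ?mulr1// gt_eqF.
Unshelve. all: by end_near. Qed.

(** The relative entropy to [gam] is a supremum of functionals affine and weakly continuous in the
    density. A level [n] nearly optimal for [g] is fixed, [smooth_weak] carries its value to a short
    time [s < e], and [fenchel_ln] is applied to the smoothed density. The variance has grown by
    [s], which costs [s / 2]. *)
Lemma entropy_smooth_limit (e : R) : 0 < e ->
  exists2 s : R, 0 < s & entropy (smooth g s) <= entropy g + e.
Proof.
move=> e0; have e4 : 0 < e / 4 by rewrite divr_gt0.
have Lc n : L1 mu (fun x => g x * clip n x).
  by apply: eq_L1 (L1_bounded_density Lg (mclip n) (clipB n)) => x; rewrite mulrC.
have mgc n : measurable_fun setT (fun x => gam x * expR (clip n x)).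
  by apply: measurable_funM => //; exact: (measurableT_comp (@measurable_expR R) (mclip n)).
have Lgc n : L1 mu (fun x => gam x * expR (clip n x)).
  apply: L1_le (L1D Lg Lgam) => [|x]; first exact: mgc.
  by rewrite ger0_norm ?mulr_ge0 ?expR_ge0 ?(ltW (gam0 x))// gam_clip.
have [n Hn] : exists n, \int[mu]_x (g x * lr x - g x) - e / 4 <
    \int[mu]_x (g x * clip n x - gam x * expR (clip n x)).
  have [] := @L1_dominated_cvg _ _ _ mu (fun n x => g x * clip n x - gam x * expR (clip n x))
    (fun x => g x * lr x - g x) (fun x => `|g x * lr x| + (g x + gam x)).
  - by move=> n; exact: (L1_measurable (L1B (Lc n) (Lgc n))).
  - exact: (L1_measurable (L1B Lglr Lg)).
  - exact: (L1D (L1_norm Lglr) (L1D Lg Lgam)).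
  - move=> n x; apply: (le_trans (ler_normB _ _)); apply: lerD; last first.
      by rewrite ger0_norm ?mulr_ge0 ?expR_ge0 ?(ltW (gam0 x))// gam_clip.
    have := g0 x; rewrite le_eqVlt => /orP[/eqP <-|gx]; first by rewrite !mul0r.
    by rewrite !normrM ler_wpM2l// clip_le.
  - exact: clip_cvg.
  move=> _ /cvgrPdist_lt /(_ _ e4) [n _ /(_ n (leqnn n))] /=.
  by rewrite ltr_norml => /andP[_ H]; exists n; rewrite ltrBlDr addrC -ltrBlDr.
have [s /andP[s0 se] Hs] := smooth_weak Lg (mclip n) (clipB n) e4 e0.
exists s => //.
have pm := moments_smooth gm s0; set p := smooth g s.
have Lp := moments_L1 pm; have [Lpg Epg] := cross_entropy pm; have [Lgg Egg] := cross_entropy gm.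
have Lpl := entropy_finite_smooth gm s0.
have Lpc := L1_bounded_density Lp (mclip n) (clipB n).
have Lb := L1D (L1D (L1D Lpg Lpc) Lp) (L1N (Lgc n)).
have fen x : p x * ln (gam x) + clip n x * p x + p x - gam x * expR (clip n x) <= p x * ln (p x).
  have p0 := smooth_gt0 gm x s0; rewrite -/p in p0.
  have := fenchel_ln (ln (gam x) + clip n x) p0; rewrite expRD lnK ?posrE//.
  by rewrite mulrDr [clip n x * _]mulrC.
have I := Rint_le Lb Lpl fen.
have I2 : \int[mu]_x (p x * ln (gam x)) + \int[mu]_x (clip n x * p x) + 1
    - \int[mu]_x (gam x * expR (clip n x)) <= \int[mu]_x (p x * ln (p x)).
  move: I; rewrite RintD; [|exact: (L1D (L1D Lpg Lpc) Lp)|exact: (L1N (Lgc n))].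
  rewrite RintD//; last exact: (L1D Lpg Lpc).
  by rewrite RintD// RintN// (moments_mass pm).
have J1 : \int[mu]_x (g x * lr x - g x) = \int[mu]_x (g x * ln (g x)) - (ln (normal_peak 1) - v / 2) - 1.
  rewrite RintB// g1 -Egg -RintB//; congr (_ - _).
  by apply: (eq_Rint mu) => x; rewrite /lr mulrBr.
have J2 : \int[mu]_x (g x * clip n x - gam x * expR (clip n x)) =
    \int[mu]_x (clip n x * g x) - \int[mu]_x (gam x * expR (clip n x)).
  rewrite RintB//; congr (_ - _); by apply: (eq_Rint mu) => x; rewrite mulrC.
move: Hn I2 Hs; rewrite J1 J2 Epg /entropy -/p ler_norml => H1 H2 /andP[H3 _].
move: H1 H2 H3 se; move: (\int[mu]_x (clip n x * g x)) (\int[mu]_x (gam x * expR (clip n x)))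
  (\int[mu]_x (p x * ln (p x))) (\int[mu]_x (g x * ln (g x))) (ln _) => a b c d l.
rewrite -[X in _ <= X - _]/(\int[mu]_x (clip n x * p x)).
by move: (\int[mu]_x (clip n x * p x)) => k; lra.
Qed.

End entropy_limit.

(** * Pinsker's inequality and the entropy jump *)

Section pinsker.
Variable R : realType.
Local Notation mu := (@lebesgue_measure R).

(** The sign condition says that [c] lies on the same side of 1 as [x], which treats [x < 1] and
    [x > 1] at once. *)
Lemma MVT_one (F dF : R -> R) (x : R) : (forall y : R, 0 < y -> is_derive y 1 F (dF y)) ->
  F 1 = 0 -> 0 < x -> exists c, [/\ 0 < c, 0 <= (c - 1) * (x - 1) & F x = dF c * (x - 1)].
Proof.
move=> FD F1 x0; have cF (a b : R) : 0 < a -> {within `[a, b], continuous F}.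
  move=> a0; apply: derivable_within_continuous => y; rewrite in_itv/= => /andP[ay _].
  exact: (@ex_derive _ _ _ _ _ _ _ (FD y (lt_le_trans a0 ay))).
have [x1|x1|->] := ltgtP x 1.
- have FD' (y : R) : y \in `]x, 1[%R -> is_derive y 1 F (dF y).
    by rewrite in_itv/= => /andP[xy _]; apply: FD; exact: lt_trans xy.
  have [c] := @MVT R F dF x 1 x1 FD' (cF _ _ x0).
  rewrite in_itv/= F1 => /andP[xc c1] E; exists c; split.
  + exact: lt_trans xc.
  + by rewrite mulr_le0// subr_le0 ltW.
  + by rewrite -opprB mulrN -E sub0r opprK.
- have FD' (y : R) : y \in `]1, x[%R -> is_derive y 1 F (dF y).
    by rewrite in_itv/= => /andP[xy _]; apply: FD; exact: lt_trans xy.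
  have [c] := @MVT R F dF 1 x x1 FD' (cF _ _ ltr01).
  rewrite in_itv/= F1 subr0 => /andP[c1 xc] E; exists c; split => //.
  + exact: lt_trans c1.
  + by rewrite mulr_ge0// subr_ge0 ltW.
- by exists 1; rewrite !subrr !mulr0 F1.
Qed.

(** With the weights 3, 2 and 4 the difference [G] vanishes at 1 to fourth order. Its derivative is
    [4 * (y + 1) * L y], and [L] vanishes at 1 with a nonnegative derivative, so two uses of the
    mean value theorem write [G u] as a product of nonnegative factors. *)
Lemma relative_entropy_quadratic (u : R) : 0 <= u ->
  3 * (u - 1) ^+ 2 <= (2 * u + 4) * (u * ln u - u + 1).
Proof.
rewrite le_eqVlt => /orP[/eqP <-|u0]; first by rewrite mul0r; lra.
pose G x : R := (2 * x + 4) * (x * ln x - x + 1) - 3 * (x - 1) ^+ 2.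
pose L x : R := ln x - 2 * ((x - 1) / (x + 1)).
have DG (y : R) : 0 < y -> is_derive y 1 G (4 * (y + 1) * L y).
  move=> y0; have D := is_derive1_ln y0; rewrite /G /L.
  have y1 : y + 1 != 0 by rewrite gt_eqF// addr_gt0.
  apply: is_derive_eq; rewrite /GRing.scale/=.
  by move: (ln y) => l; field; rewrite y1 gt_eqF.
have DL (y : R) : 0 < y -> is_derive y 1 L ((y - 1) ^+ 2 / (y * (y + 1) ^+ 2)).
  move=> y0; have D := is_derive1_ln y0; rewrite /L.
  have y1 : y + 1 != 0 by rewrite gt_eqF// addr_gt0.
  have DV : is_derive y (1 : R) (fun x : R => (x + 1)^-1) (- (y + 1) ^- 2).
    have D1 : is_derive y (1 : R) (fun x : R => x + 1) 1 by apply: is_derive_eq; rewrite addr0.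
    have D2 : derivable (fun x : R => x + 1) y 1 by exact: ex_derive.
    apply: DeriveDef; first exact: (@derivableV R _ (fun x : R => x + 1) y 1 y1 D2).
    rewrite (@deriveV R _ (fun x : R => x + 1) y 1 y1 D2) (@derive_val _ _ _ _ _ _ _ D1).
    by rewrite /GRing.scale/= mulr1.
  apply: is_derive_eq; rewrite /GRing.scale/=.
  by field; rewrite y1 gt_eqF.
have G1 : G 1 = 0 by rewrite /G ln1; ring.
have L1' : L 1 = 0 by rewrite /L ln1 subrr mul0r mulr0 subrr.
rewrite -subr_ge0 -/(G u).
have [c [c0 cu ->]] := MVT_one DG G1 u0.
have [d [d0 dc ->]] := MVT_one DL L1' c0.
have X0 : 0 <= (d - 1) ^+ 2 / (d * (d + 1) ^+ 2).
  by rewrite divr_ge0 ?sqr_ge0// mulr_ge0 ?sqr_ge0// ltW.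
move: (_ / _) X0 => X X0; rewrite [_ * (X * _)]mulrA -[_ * (u - 1)]mulrA.
by apply: mulr_ge0 => //; rewrite mulr_ge0// mulr_ge0// addr_ge0// ltW.
Qed.

Variables f q : R -> R.
Hypotheses (Lf : L1 mu f) (Lq : L1 mu q) (f0 : forall x, 0 <= f x) (q0 : forall x, 0 < q x).
Hypotheses (f1 : \int[mu]_x f x = 1) (q1 : \int[mu]_x q x = 1).
Hypothesis LD : L1 mu (fun x => f x * ln (f x / q x)).

(** Cauchy-Schwarz with the weight [W], which has mass 2, and the quadratic bound at [f / q]. The
    terms [- f + q] in [psi] make it nonnegative pointwise and integrate to 0. *)
Lemma pinsker : 2^-1 * (\int[mu]_x `|f x - q x|) ^+ 2 <= \int[mu]_x (f x * ln (f x / q x)).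
Proof.
have Lfq := L1B Lf Lq; have Ln := L1_norm Lfq; have mn := L1_line_measurable Ln.
pose W x := 3^-1 * (2 * f x + 4 * q x).
have W0 x : 0 < W x by rewrite mulr_gt0// ltr_wpDl ?mulr_ge0// mulr_gt0.
have LW : L1 mu W by exact: (L1Z 3^-1 (L1D (L1Z 2 Lf) (L1Z 4 Lq))).
have EW : \int[mu]_x W x = 2.
  rewrite RintZ; last exact: (L1D (L1Z 2 Lf) (L1Z 4 Lq)).
  rewrite RintD; [|exact: (L1Z _ Lf)|exact: (L1Z _ Lq)].
  by rewrite !RintZ// f1 q1; field.
pose psi x := f x * ln (f x / q x) - f x + q x.
have Lpsi : L1 mu psi by exact: (L1D (L1B LD Lf) Lq).
have Epsi : \int[mu]_x psi x = \int[mu]_x (f x * ln (f x / q x)).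
  by rewrite RintD//; [rewrite RintB// f1 q1 subrK|exact: (L1B LD Lf)].
have le x : `|f x - q x| ^+ 2 / W x <= psi x.
  have qx := q0 x; have qx' := lt0r_neq0 qx.
  rewrite ler_pdivrMr// real_normK ?num_real//.
  have := relative_entropy_quadratic (divr_ge0 (f0 x) (ltW qx)).
  move=> /(ler_wpM2l (ltW (exprn_gt0 2 qx))).
  rewrite /psi /W; move: (f x) (q x) qx' => a b b0; move: (ln (a / b)) => l.
  have -> : b ^+ 2 * (3 * (a / b - 1) ^+ 2) = 3 * (a - b) ^+ 2 by field.
  have -> : b ^+ 2 * ((2 * (a / b) + 4) * (a / b * l - a / b + 1)) =
    (2 * a + 4 * b) * (a * l - a + b) by field.
  by move: ((a - b) ^+ 2) ((2 * a + 4 * b)) (a * l - a + b) => x1 x2 x3; rewrite mulrCA [x2 * _]mulrC; lra.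
have LnW : L1 mu (fun x => `|f x - q x| ^+ 2 / W x).
  apply: L1_le Lpsi => [|x]; last by rewrite ger0_norm ?le// divr_ge0 ?sqr_ge0// ltW.
  apply: measurable_funM; first exact: measurable_funX.
  exact: (measurableT_comp (@measurable_invr R) (L1_line_measurable LW)).
have LW1 : L1 mu (fun x => 1 ^+ 2 * W x) by apply: eq_L1 LW => x; rewrite expr1n mul1r.
have := line_CauchySchwarz (measurable_cst (1 : R)) mn W0 LW1 LnW.
have -> : \int[mu]_x (1 * `|f x - q x|) = \int[mu]_x `|f x - q x|.
  by apply: (eq_Rint mu) => x; rewrite mul1r.
have -> : \int[mu]_x (1 ^+ 2 * W x) = 2.
  by rewrite -EW; apply: (eq_Rint mu) => x; rewrite expr1n mul1r.
move=> CS; rewrite -Epsi ler_pdivrMl//; apply: (le_trans CS).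
by rewrite ler_pM2l//; apply: Rint_le.
Qed.

End pinsker.

Section entropy_jump.
Variable R : realType.
Local Notation mu := (@lebesgue_measure R).
Variable f : R -> R.
Hypotheses (fd : is_density f) (fent : entropy_finite f) (gent : entropy_finite (convol f f)).
Hypotheses (fvar : finite_variance f) (pfin : poincare f \is a fin_num).

Let mf : measurable_fun setT f. Proof. by case: fd. Qed.
Let f0 x : 0 <= f x. Proof. by have [_ []] := fd. Qed.
Let Lf : L1 mu f.
Proof. by have [_ [_ E]] := fd; apply: L1_ge0; [exact: mf|exact: f0|rewrite E ltry]. Qed.
Let f1 : \int[mu]_x f x = 1. Proof. by have [_ [_ E]] := fd; rewrite /Rintegral E. Qed.

Let m := dmean f.
Let v := dvariance f.

Let Lx2 : L1 mu (fun x => (x - 0) ^+ 2 * f x).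
Proof. by apply: eq_L1 (fvar : L1 mu (fun x => x ^+ 2 * f x)) => x; rewrite subr0. Qed.

Let Lx : L1 mu (fun x => x * f x).
Proof. by apply: eq_L1 (L1_first_moment Lf f0 Lx2) => x; rewrite subr0. Qed.

Let fm : moments f m v.
Proof.
split => //.
- apply: eq_L1 (L1D (L1D Lx2 (L1Z (- (2 * m)) Lx)) (L1Z (m ^+ 2) Lf)) => x; ring.
- rewrite (Rint_center m Lf f1 Lx); exact: subrr.
Qed.

Let s := Num.sqrt v.
Let v0 := moments_var_gt0 fm.
Let s0 : 0 < s. Proof. by rewrite sqrtr_gt0. Qed.
Let phi := gauss_match f.
Let phi0 x : 0 < phi x. Proof. by apply: normal_pdf_gt0; rewrite gt_eqF. Qed.
Local Notation hphi := (entropy (normal_pdf (0 : R) 1)).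

(** [ln phi] is a quadratic polynomial, so its mean under [f] depends on the mean and the variance
    alone and is minus the entropy of [phi]. *)
Let Lcross : L1 mu (fun x => f x * ln (phi x)) /\
  \int[mu]_x (f x * ln (phi x)) = - (2^-1 * ln v + hphi).
Proof.
have E x : f x * ln (phi x) = ln (normal_peak s) * f x + (- (2 * v)^-1) * ((x - m) ^+ 2 * f x).
  rewrite /phi /gauss_match ln_normal_pdf ?gt_eqF// sqr_sqrtr ?ltW// -/m -/v.
  by rewrite [v * 2]mulrC; ring.
have L2 := moments_L2 fm.
split; first by apply: eq_L1 (L1D (L1Z _ Lf) (L1Z (- (2 * v)^-1) L2)) => x; rewrite E.
rewrite (eq_Rint mu E) RintD; [|exact: (L1Z _ Lf)|exact: (L1Z _ L2)].
rewrite !RintZ// f1 (moments_var fm) mulr1.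
have H : hphi = 2^-1 - ln (normal_peak (1 : R)).
  have := cross_entropy (moments_heat (@ltr01 R)).
  rewrite heatE// sqrtr1 => -[_ E1].
  by rewrite /entropy E1 opprB mul1r.
rewrite H normal_peakE// ln_div ?posrE ?normal_peak_gt0 ?oner_neq0//.
have -> : ln s = 2^-1 * ln v by rewrite /s -powR12_sqrt ?ltW// ln_powR mulrC.
by move: (ln _) (ln v) => a b; field; rewrite gt_eqF.
Qed.

Let Lrel : L1 mu (fun x => f x * ln (f x / phi x)).
Proof.
apply: eq_L1 (L1B (fent : L1 mu (fun x => f x * ln (f x))) Lcross.1) => x.
have := f0 x; rewrite le_eqVlt => /orP[/eqP <-|fx]; first by rewrite !mul0r subrr.
by rewrite ln_div ?posrE// mulrBr.
Qed.

Let rel_entropyE : \int[mu]_x (f x * ln (f x / phi x)) = 2^-1 * ln v + hphi - entropy f.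
Proof.
have E x : f x * ln (f x / phi x) = f x * ln (f x) - f x * ln (phi x).
  have := f0 x; rewrite le_eqVlt => /orP[/eqP <-|fx]; first by rewrite !mul0r subrr.
  by rewrite ln_div ?posrE// mulrBr.
rewrite (eq_Rint mu E) RintB//; last exact: Lcross.1.
by rewrite Lcross.2 /entropy !opprK addrC.
Qed.

Let Rp := fine (poincare f).
Local Notation K := (2 * Rp / v + 1).

Let K1 : 1 <= K.
Proof.
have Rv := poincare_ge_var pfin fm; rewrite lerDr divr_ge0 ?(ltW v0)// mulr_ge0//.
by rewrite (le_trans (ltW v0)).
Qed.

(** By contradiction there is a gap, half of which is granted to [entropy_smooth_limit] for the sum
    at some time [t]; [f] is then taken at time [t / 2]. On that side [entropy_smooth_ge] and
    [v <= v + t / 2] point the right way, so the other half remains as the contradiction. *)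
Lemma entropy_jump : \int[mu]_x (f x * ln (f x / phi x)) <=
  K * (entropy (convol f f) - entropy f - 2^-1 * ln 2).
Proof.
have gm := moments_convol fm fm.
have K0 : 0 < K by exact: lt_le_trans K1.
suff H : K^-1 * (2^-1 * ln v + hphi - entropy f) <= entropy (convol f f) - entropy f - 2^-1 * ln 2.
  by rewrite rel_entropyE -ler_pdivrMl// mulrC mulrC.
set th := K^-1; have th1 : th <= 1 by rewrite invf_le1.
have th0 : 0 < th by rewrite invr_gt0.
rewrite leNgt; apply/negP => H.
pose lhs := th * (2^-1 * ln v + hphi - entropy f).
pose rhs := entropy (convol f f) - entropy f - 2^-1 * ln 2.
have e0 : 0 < lhs - rhs by rewrite subr_gt0.
have e2 : 0 < (lhs - rhs) / 2 by rewrite divr_gt0.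
have [t t0 Ht] := entropy_smooth_limit gm gent e2.
have t2 : 0 < t / 2 by rewrite divr_gt0.
have := smooth_entropy_jump fm (poincare_ge_var pfin fm) (poincare_inequality pfin fm) t2.
have tE : 2 * (t / 2) = t by rewrite mulrC divfK// pnatr_eq0.
rewrite -/Rp -/th tE => J.
have J1 : (1 - th) * entropy f <= (1 - th) * entropy (smooth f (t / 2)).
  apply: ler_wpM2l; first by rewrite subr_ge0.
  exact: (entropy_smooth_ge fm t2 fent).
have J2 : th / 2 * ln v <= th / 2 * ln (v + t / 2).
  apply: ler_wpM2l; first by rewrite divr_ge0// ltW.
  by rewrite ler_ln ?posrE ?addr_gt0// lerDl ltW.
move: Ht J J1 J2 e0; rewrite /lhs /rhs.
move: (entropy (smooth (convol f f) t)) (entropy (convol f f)) (entropy f) (entropy (smooth f _))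
  (ln v) (ln (v + _)) (ln 2) hphi (th) => a b c d l l' l2 hh tt.
by lra.
Qed.

Lemma pinsker_gauss :
  ((2^-1)%:E * (L1dist f phi * L1dist f phi) <= rel_entropy f phi)%E.
Proof.
have Lphi : L1 mu phi by exact: L1_normal.
have Ld : L1 mu (fun x => `|f x - phi x|) by exact: (L1_norm (L1B Lf Lphi)).
rewrite /L1dist /rel_entropy -(EFin_Rint Ld) -(EFin_Rint Lrel) -!EFinM lee_fin -expr2.
by apply: pinsker => //; exact: Rint_normal.
Qed.

Lemma rel_entropy_gauss (C : R) : doubling f <= C ->
  (rel_entropy f phi <= (K * ln (C / Num.sqrt 2))%:E)%E.
Proof.
move=> fC; rewrite /rel_entropy -(EFin_Rint Lrel) lee_fin.
apply: (le_trans entropy_jump); rewrite ler_wpM2l ?(le_trans _ K1)//.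
have C0 : 0 < C by apply: lt_le_trans fC; exact: expR_gt0.
rewrite ln_div ?posrE ?sqrtr_gt0// ln_sqrt2 lerD2r.
by rewrite -[leLHS]expRK ler_ln ?posrE ?expR_gt0.
Qed.

End entropy_jump.

Theorem mainTheorem17 (R : realType) (f : R -> R) :
  is_density f -> entropy_finite f -> entropy_finite (convol f f) ->
  (Num.sqrt 2 <= doubling f /\ (doubling f = Num.sqrt 2 <-> is_gaussian f)) /\
  (forall C : R, doubling f <= C -> finite_variance f ->
     poincare f \is a fin_num ->
     ((2^-1)%:E * (L1dist f (gauss_match f) * L1dist f (gauss_match f))
        <= rel_entropy f (gauss_match f))%E /\
     (rel_entropy f (gauss_match f)
        <= ((2 * fine (poincare f) / dvariance f + 1) * ln (C / Num.sqrt 2))%:E)%E).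
Proof.
move=> fd fent gent; split; first by split; [exact: doubling_ge|exact: doubling_eq].
move=> C fC fvar pfin; split; first exact: pinsker_gauss.
exact: rel_entropy_gauss.
Qed.
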